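(* Let $k\ge1$ and let $\Gamma(\bar{x})\cup\Delta(\bar{x})$ be a finite multiset of $\hat{\Pi}^b_k$-formulas. Then: (i) $S^k_2\vdash\bigwedge\Gamma(\bar{x})\rightarrow\bigvee\Delta(\bar{x})$ if and only if $\Gamma(\bar{x})\rhd^p_k\Delta(\bar{x})$; (ii) $T^k_2\vdash\bigwedge\Gamma(\bar{x})\rightarrow\bigvee\Delta(\bar{x})$ if and only if $\Gamma(\bar{x})\rhd_k\Delta(\bar{x})$.
   Context: $\mathcal{L}_{\mathrm{PV}}$ is the language with a function symbol for every polynomial-time algorithm in Cobham's characterization; $\mathrm{PV}$ is Cook's universal theory of polynomial-time functions (first-order form $\mathrm{PV}_1$). $|x|$ is the binary length of $x$. Bounded quantifiers: $\forall y\le t\,A$ abbreviates $\forall y(y\le t\to A)$, $\exists y\le t\,A$ abbreviates $\exists y(y\le t\wedge A)$, with $y$ not in $t$. The classes $\hat{\Sigma}^b_k,\hat{\Pi}^b_k$: $\hat{\Sigma}^b_0=\hat{\Pi}^b_0$ are the quantifier-free formulas; $\hat{\Sigma}^b_k\subseteq\hat{\Sigma}^b_{k+1}$, $\hat{\Pi}^b_k\subseteq\hat{\Pi}^b_{k+1}$; both closed under $\wedge,\vee$; if $B\in\hat{\Sigma}^b_k$ then $\exists y\le t B\in\hat{\Sigma}^b_k$ and $\forall y\le t B\in\hat{\Pi}^b_{k+1}$; if $B\in\hat{\Pi}^b_k$ then $\forall y\le tB\in\hat{\Pi}^b_k$ and $\exists y\le tB\in\hat{\Sigma}^b_{k+1}$.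 $S^k_2$ is $\mathrm{PV}$ plus $A(0)\wedge\forall x(A(\lfloor x/2\rfloor)\to A(x))\to\forall xA(x)$ for $A\in\hat{\Pi}^b_k$; $T^k_2$ is $\mathrm{PV}$ plus $A(0)\wedge\forall x(A(x)\to A(x+1))\to\forall xA(x)$ for $A\in\hat{\Pi}^b_k$. For $A(\bar{x}),B(\bar{x})\in\hat{\Pi}^b_k$ and an $\mathcal{L}_{\mathrm{PV}}$-term $t(\bar{x})$, a $k$-flow from $A$ to $B$ of length $t$ is a pair $(H(u,\bar{x}),t(\bar{x}))$ with $H\in\hat{\Pi}^b_k$ such that $\mathrm{PV}\vdash H(0,\bar{x})\leftrightarrow A(\bar{x})$, $\mathrm{PV}\vdash H(t(\bar{x}),\bar{x})\leftrightarrow B(\bar{x})$, $\mathrm{PV}\vdash\forall u<t(\bar{x})[H(u,\bar{x})\to H(u+1,\bar{x})]$. It is polynomial if $t(\bar{x})$ is syntactically $q(|\bar{x}|)$ for a polynomial $q$. $A\rhd_kB$ (resp. $A\rhd^p_kB$) means a $k$-flow (resp. polynomial $k$-flow) from $A$ to $B$ exists; $\Gamma\rhd_k\Delta$ means $\bigwedge\Gamma\rhd_k\bigvee\Delta$, similarly for $\rhd^p_k$. *)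

(* Defs.v *)
From Stdlib Require List.
From mathcomp Require Import all_boot.

Set Implicit Arguments.
Unset Strict Implicit.
Unset Printing Implicit Defensive.

(* Tuples are functions on ordinals; they serve both as argument lists and as
   substitutions. *)

Definition tnil {T : Type} (i : 'I_0) : T :=
  let: Ordinal _ lt_m0 := i in False_rect T (notF lt_m0).

Definition tcons {T : Type} {n : nat} (a : T) (v : 'I_n -> T) (i : 'I_n.+1) : T :=
  match i with
  | @Ordinal _ 0 _ => a
  | @Ordinal _ m.+1 lt_mn => v (@Ordinal n m lt_mn)
  end.

(* L_PV: a symbol is an algorithm of Cobham's calculus.  Besides Cobham's
   initial functions, the other symbols of Buss's language of bounded arithmetic
   are taken as primitive.  [Rec g h0 h1 k] is limited recursion on notation

     f(0, y)    = g(y)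
     f(2x, y)   = h0(x, f(x, y), y)   (x <> 0)
     f(2x+1, y) = h1(x, f(x, y), y)

   limited by f(x, y) <= k(x, y).  The limit is enforced by taking at each step
   the minimum with k, so that every such symbol is polynomial-time and no side
   condition is needed for it to belong to the language. *)

Inductive sym : nat -> Type :=
| Zero : sym 0
| Succ : sym 1
| Half : sym 1
| Len : sym 1
| Add : sym 2
| Mul : sym 2
| Smash : sym 2
| Proj (n : nat) (i : 'I_n) : sym n
| Comp (m n : nat) (f : sym m) (g : 'I_m -> sym n) : sym n
| Rec (n : nat) (g : sym n) (h0 h1 : sym n.+2) (k : sym n.+1) : sym n.+1.

(* [term n] and [form n] have their free variables among 'I_n; a quantifier
   binds variable 0 (de Bruijn). *)

Inductive term (n : nat) : Type :=
| Var (i : 'I_n)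
| App (m : nat) (f : sym m) (ts : 'I_m -> term n).

Arguments Var {n} i.
Arguments App {n m} f ts.

Inductive form (n : nat) : Type :=
| Bot
| Eq (s t : term n)
| Le (s t : term n)
| And (A B : form n)
| Or (A B : form n)
| Imp (A B : form n)
| All (A : form n.+1)
| Ex (A : form n.+1).

Arguments Bot {n}.

Declare Scope pvt_scope.
Delimit Scope pvt_scope with T.
Bind Scope pvt_scope with term.
Declare Scope pvf_scope.
Delimit Scope pvf_scope with F.
Bind Scope pvf_scope with form.

Definition t0 {n} : term n := App Zero tnil.
Definition tS {n} (s : term n) : term n := App Succ (tcons s tnil).
Definition thalf {n} (s : term n) : term n := App Half (tcons s tnil).
Definition len {n} (s : term n) : term n := App Len (tcons s tnil).
Definition tadd {n} (s t : term n) : term n := App Add (tcons s (tcons t tnil)).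
Definition tmul {n} (s t : term n) : term n := App Mul (tcons s (tcons t tnil)).
Definition smash {n} (s t : term n) : term n :=
  App Smash (tcons s (tcons t tnil)).

Notation "0" := t0 : pvt_scope.
Notation "1" := (tS t0) : pvt_scope.
Notation "2" := (tS (tS t0)) : pvt_scope.
Notation "s + t" := (tadd s t) : pvt_scope.
Notation "s * t" := (tmul s t) : pvt_scope.
Notation "s # t" := (smash s t)
  (at level 40, left associativity) : pvt_scope.

Notation "s = t" := (Eq s%T t%T) : pvf_scope.
Notation "s <= t" := (Le s%T t%T) : pvf_scope.
Notation "~ A" := (Imp A Bot) : pvf_scope.
Notation "A /\ B" := (And A B) : pvf_scope.
Notation "A \/ B" := (Or A B) : pvf_scope.
Notation "A --> B" := (Imp A B)
  (at level 90, right associativity) : pvf_scope.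
Notation "A <--> B" := (And (Imp A B) (Imp B A))
  (at level 95, no associativity) : pvf_scope.

Definition Lt {n} (s t : term n) : form n := (s <= t /\ ~ (s = t))%F.

Notation "s < t" := (Lt s%T t%T) : pvf_scope.

Definition Top {n} : form n := (~ Bot)%F.

Definition bigAnd {n} (G : seq (form n)) : form n := foldr (@And n) Top G.
Definition bigOr {n} (D : seq (form n)) : form n := foldr (@Or n) Bot D.

Fixpoint tsubst {n m : nat} (sg : 'I_n -> term m) (t : term n) : term m :=
  match t with
  | Var i => sg i
  | App _ f ts => App f (fun j => tsubst sg (ts j))
  end.

Definition wk {n : nat} (i : 'I_n) : term n.+1 := Var (lift ord0 i).

Definition x0 {n : nat} : term n.+1 := Var ord0.

Definition tshift {n : nat} : term n -> term n.+1 := tsubst wk.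

Definition up {n m : nat} (sg : 'I_n -> term m) : 'I_n.+1 -> term m.+1 :=
  tcons x0 (fun i => tshift (sg i)).

Fixpoint fsubst {n m : nat} (sg : 'I_n -> term m) (A : form n) {struct A} :
    form m :=
  match A with
  | Bot => Bot
  | Eq s t => Eq (tsubst sg s) (tsubst sg t)
  | Le s t => Le (tsubst sg s) (tsubst sg t)
  | And A B => And (fsubst sg A) (fsubst sg B)
  | Or A B => Or (fsubst sg A) (fsubst sg B)
  | Imp A B => Imp (fsubst sg A) (fsubst sg B)
  | All A => All (fsubst (up sg) A)
  | Ex A => Ex (fsubst (up sg) A)
  end.

Definition fshift {n : nat} : form n -> form n.+1 := fsubst wk.

(* A(s), where s does not mention the variable x of A(x) *)
Definition inst {n : nat} (A : form n.+1) (s : term n) : form n :=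
  fsubst (tcons s Var) A.

(* A(s(x)), where the variable x of A(x) stays free *)
Definition repl {n : nat} (A : form n.+1) (s : term n.+1) : form n.+1 :=
  fsubst (tcons s wk) A.

Definition AllB {n : nat} (t : term n) (A : form n.+1) : form n :=
  All (x0 <= tshift t --> A).
Definition ExB {n : nat} (t : term n) (A : form n.+1) : form n :=
  Ex (x0 <= tshift t /\ A).

(* Natural deduction for classical first-order logic with equality.  Axioms of
   a theory are implicitly universally closed: see [prv_ax]. *)

Definition theory : Type := forall n : nat, form n -> Prop.

Inductive prv (T : theory) (n : nat) : seq (form n) -> form n -> Prop :=
| prv_ax G m (A : form m) (sg : 'I_m -> term n) : T m A -> prv T G (fsubst sg A)
| prv_hyp G A : List.In A G -> prv T G A
| prv_raa G A : prv T ((~ A)%F :: G) Bot -> prv T G A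
| prv_andI G A B : prv T G A -> prv T G B -> prv T G (A /\ B)
| prv_andE1 G A B : prv T G (A /\ B) -> prv T G A
| prv_andE2 G A B : prv T G (A /\ B) -> prv T G B
| prv_orI1 G A B : prv T G A -> prv T G (A \/ B)
| prv_orI2 G A B : prv T G B -> prv T G (A \/ B)
| prv_orE G A B C :
    prv T G (A \/ B) -> prv T (A :: G) C -> prv T (B :: G) C -> prv T G C
| prv_impI G A B : prv T (A :: G) B -> prv T G (A --> B)
| prv_impE G A B : prv T G (A --> B) -> prv T G A -> prv T G B
| prv_allI G A : prv T (map fshift G) A -> prv T G (All A)
| prv_allE G A t : prv T G (All A) -> prv T G (inst A t)
| prv_exI G A t : prv T G (inst A t) -> prv T G (Ex A)
| prv_exE G A B :
    prv T G (Ex A) -> prv T (A :: map fshift G) (fshift B) -> prv T G B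
| prv_eqI G t : prv T G (t = t)
| prv_eqE G A s t : prv T G (s = t) -> prv T G (inst A s) -> prv T G (inst A t).

Definition proves (T : theory) (n : nat) (A : form n) : Prop := prv T [::] A.

Fixpoint qf {n : nat} (A : form n) : bool :=
  match A with
  | Bot | Eq _ _ | Le _ _ => true
  | And A B | Or A B | Imp A B => qf A && qf B
  | All _ | Ex _ => false
  end.

(* Buss's axioms for the primitive symbols *)

Section Basic.
Let x : term 4 := Var (@Ordinal 4 0 isT).
Let y : term 4 := Var (@Ordinal 4 1 isT).
Let z : term 4 := Var (@Ordinal 4 2 isT).
Let w : term 4 := Var (@Ordinal 4 3 isT).

Definition BASIC : seq (form 4) := [::
  y <= x --> y <= tS x;
  ~ (x = tS x);
  0 <= x;
  (x <= y /\ ~ (x = y)) <--> tS x <= y;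
  ~ (x = 0) --> ~ (2 * x = 0);
  y <= x \/ x <= y;
  (x <= y /\ y <= x) --> x = y;
  (x <= y /\ y <= z) --> x <= z;
  len 0 = 0;
  ~ (x = 0) --> (len (2 * x) = tS (len x) /\ len (tS (2 * x)) = tS (len x));
  len 1 = 1;
  x <= y --> len x <= len y;
  len (x # y) = tS (len x * len y);
  0 # y = 1;
  ~ (x = 0) --> (1 # (2 * x) = 2 * (1 # x) /\ 1 # tS (2 * x) = 2 * (1 # x));
  x # y = y # x;
  len x = len y --> x # z = y # z;
  len x = len z + len w --> x # y = (z # y) * (w # y);
  x <= x + y;
  (x <= y /\ ~ (x = y)) --> (tS (2 * x) <= 2 * y /\ ~ (tS (2 * x) = 2 * y));
  x + y = y + x;
  x + 0 = x;
  x + tS y = tS (x + y);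
  (x + y) + z = x + (y + z);
  x + y <= x + z <--> y <= z;
  x * 0 = 0;
  x * tS y = (x * y) + x;
  x * y = y * x;
  x * (y + z) = (x * y) + (x * z);
  1 <= x --> (x * y <= x * z <--> y <= z);
  ~ (x = 0) --> len x = tS (len (thalf x));
  x = thalf y <--> (2 * x = y \/ tS (2 * x) = y)
]%F.
End Basic.

Definition is_min {n : nat} (r s t : term n) : form n :=
  ((s <= t --> r = s) /\ (t <= s --> r = t))%F.

(* Besides the defining axioms of the symbols, PV is closed under the rule of
   induction on notation for quantifier-free formulas (with parameters).  All
   the axioms below are quantifier-free, so PV is a universal theory. *)

Inductive PV : theory :=
| PV_basic A : List.In A BASIC -> PV A
| PV_proj n (i : 'I_n) : PV (App (Proj i) Var = Var i)%F
| PV_comp m n (f : sym m) (g : 'I_m -> sym n) :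
    PV (App (Comp f g) Var = App f (fun j => App (g j) Var))%F
| PV_rec0 n (g : sym n) (h0 h1 : sym n.+2) (k : sym n.+1) :
    PV (is_min (App (Rec g h0 h1 k) (tcons 0%T Var))
               (App g Var)
               (App k (tcons 0%T Var)))
| PV_rec_even n (g : sym n) (h0 h1 : sym n.+2) (k : sym n.+1) :
    PV (~ (x0 = 0) -->
        is_min (App (Rec g h0 h1 k) (tcons (2 * x0)%T wk))
               (App h0 (tcons x0 (tcons (App (Rec g h0 h1 k) (tcons x0 wk)) wk)))
               (App k (tcons (2 * x0)%T wk)))%F
| PV_rec_odd n (g : sym n) (h0 h1 : sym n.+2) (k : sym n.+1) :
    PV (is_min (App (Rec g h0 h1 k) (tcons (tS (2 * x0)) wk))
               (App h1 (tcons x0 (tcons (App (Rec g h0 h1 k) (tcons x0 wk)) wk)))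
               (App k (tcons (tS (2 * x0)) wk)))
| PV_induct n (A : form n.+1) :
    qf A ->
    proves PV (inst A 0) ->
    proves PV (repl A (thalf x0) --> A) ->
    PV A.

(* Level 0 consists of the quantifier-free formulas only, hence the closure
   under quantifiers of the same kind starts at level 1. *)

Inductive hSigma : nat -> forall n : nat, form n -> Prop :=
| hSigma_qf n (A : form n) : qf A -> hSigma 0 A
| hSigma_up k n (A : form n) : hSigma k A -> hSigma k.+1 A
| hSigma_and k n (A B : form n) : hSigma k A -> hSigma k B -> hSigma k (A /\ B)
| hSigma_or k n (A B : form n) : hSigma k A -> hSigma k B -> hSigma k (A \/ B)
| hSigma_ex k n (t : term n) (B : form n.+1) :
    hSigma k.+1 B -> hSigma k.+1 (ExB t B)
| hSigma_ex_hPi k n (t : term n) (B : form n.+1) :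
    hPi k B -> hSigma k.+1 (ExB t B)
with hPi : nat -> forall n : nat, form n -> Prop :=
| hPi_qf n (A : form n) : qf A -> hPi 0 A
| hPi_up k n (A : form n) : hPi k A -> hPi k.+1 A
| hPi_and k n (A B : form n) : hPi k A -> hPi k B -> hPi k (A /\ B)
| hPi_or k n (A B : form n) : hPi k A -> hPi k B -> hPi k (A \/ B)
| hPi_all k n (t : term n) (B : form n.+1) :
    hPi k.+1 B -> hPi k.+1 (AllB t B)
| hPi_all_hSigma k n (t : term n) (B : form n.+1) :
    hSigma k B -> hPi k.+1 (AllB t B).

Inductive S2 (k : nat) : theory :=
| S2_PV n (A : form n) : PV A -> S2 k A
| S2_pinduct n (A : form n.+1) : hPi k A ->
    S2 k ((inst A 0 /\ All (repl A (thalf x0) --> A)) --> All A)%F.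

Inductive T2 (k : nat) : theory :=
| T2_PV n (A : form n) : PV A -> T2 k A
| T2_induct n (A : form n.+1) : hPi k A ->
    T2 k ((inst A 0 /\ All (A --> repl A (tS x0))) --> All A)%F.

Definition kflow (k n : nat) (A B : form n) (H : form n.+1) (t : term n) : Prop :=
  [/\ hPi k H,
      proves PV (inst H 0 <--> A),
      proves PV (inst H t <--> B) &
      proves PV (All (x0 < tshift t --> (H --> repl H (tS x0))))].

(* the terms q(|x_0|, ..., |x_(n-1)|) for q a polynomial over the naturals *)
Inductive len_poly (n : nat) : term n -> Prop :=
| len_poly0 : len_poly 0
| len_polyS q : len_poly q -> len_poly (tS q)
| len_polyX i : len_poly (len (Var i))
| len_polyD p q : len_poly p -> len_poly q -> len_poly (p + q)
| len_polyM p q : len_poly p -> len_poly q -> len_poly (p * q).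

Definition flows (k n : nat) (G D : seq (form n)) : Prop :=
  exists (H : form n.+1) (t : term n), kflow k (bigAnd G) (bigOr D) H t.

Definition pflows (k n : nat) (G D : seq (form n)) : Prop :=
  exists (H : form n.+1) (t : term n),
    len_poly t /\ kflow k (bigAnd G) (bigOr D) H t.

(* Main.v *)
Require Import Defs.
From HB Require Import structures.
From mathcomp Require Import all_boot.
From mathcomp Require Import boolp classical_sets.

Set Implicit Arguments.
Unset Strict Implicit.
Unset Printing Implicit Defensive.

(** Completeness of first-order logic (Henkin's construction, with Hilbert's
    epsilon terms as witnesses) turns all reasoning in PV into reasoning inside
    the models of PV.  There flows compose, commute with conjunction,
    disjunction, substitution and bounded universal quantification, and can be
    iterated along [i < N] for a term [N] (of polynomial size in the polynomial
    case): the lengths of the flows to be combined are made uniform by bounding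
    every term by a polynomial in the lengths of its variables.

    A proof in [S2 k] or [T2 k] may use formulas of any complexity.  Instead of
    eliminating cuts, such proofs are interpreted by forcing: a condition is a
    pair [(G, D)], it is inconsistent when a flow leads from [G] to [D], and it
    forces an atom [A] when a flow leads from [G] to [D \/ A].  By the closure
    properties of flows the latter characterization extends to all [hPi k]
    formulas, and the induction axioms are forced because flows can be iterated.

    Conversely, a flow is turned into a proof by induction along the flow; in
    [S2 k] the induction variable is [|z|], and the polynomial length is
    dominated by the length of a term built with smash. *)

(** * Tuples and substitutions *)

(** The flows of the theorem have exact endpoints and, in the polynomial case, a length of the rigid
    form q(|x|); combining flows preserves neither. [Flow] therefore asks only for implications at
    the ends and tolerates any larger length, and [kflow_of_flow] restores the exact form once, at
    the end. The component [D] of a condition makes the forcing classical. The negation of an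
    [hPi k] formula cannot in general be adjoined to [G], but the formula itself can be adjoined to
    [D], which amounts to assuming it false. Most clauses of forcing quantify over all extensions;
    feeding them one generic extension (a fresh variable, a formula added to [G] or [D]) gives back
    a single flow. A cut formula of high complexity thus becomes a meta-level statement about flows
    between [hPi k] predicates. The assumption k >= 1 pays for time-keeping: subtracting or dividing
    the clock is expressed by bounded universal quantifiers in front of the running formula, which
    must not leave [hPi k]. Length induction up to s is a chain of only |s| steps, through the
    values of s with its last bits cut off; hence polynomial flows for [S2]. *)

Lemma tnilP T (v : 'I_0 -> T) : v = tnil.
Proof. by apply/funext => -[]. Qed.

Lemma tconsS T n (a : T) (v : 'I_n -> T) i : tcons a v (lift ord0 i) = v i.
Proof. by case: i => m lt_mn; congr v; apply/val_inj. Qed.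

Arguments tcons : simpl never.
Arguments lift : simpl never.

Lemma ordS_ind n (P : 'I_n.+1 -> Prop) :
  P ord0 -> (forall i, P (lift ord0 i)) -> forall i, P i.
Proof. by move=> P0 PS i; case: (unliftP ord0 i) => [j|] ->. Qed.

Lemma tconsP T n (a : T) (v : 'I_n -> T) (f : 'I_n.+1 -> T) :
  f ord0 = a -> (forall i, f (lift ord0 i) = v i) -> f = tcons a v.
Proof.
by move=> f0 fS; apply/funext; elim/ordS_ind => [|i] //; rewrite tconsS.
Qed.

Lemma comp_tcons T U n (h : T -> U) (a : T) (v : 'I_n -> T) :
  (fun i => h (tcons a v i)) = tcons (h a) (fun i => h (v i)).
Proof. by apply: tconsP => // i; rewrite tconsS. Qed.

Lemma tconsK T n (v : 'I_n.+1 -> T) : tcons (v ord0) (fun i => v (lift ord0 i)) = v.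
Proof. by apply/esym/tconsP. Qed.

Lemma tsubst_Var n (t : term n) : tsubst Var t = t.
Proof. by elim: t => //= m f ts IH; congr App; apply/funext => j. Qed.

Lemma tsubst_comp n m p (tau : 'I_m -> term p) (sg : 'I_n -> term m) t :
  tsubst tau (tsubst sg t) = tsubst (fun i => tsubst tau (sg i)) t.
Proof. by elim: t => //= q f ts IH; congr App; apply/funext => j. Qed.

Lemma tsubst_tshift n m (sg : 'I_n.+1 -> term m) t :
  tsubst sg (tshift t) = tsubst (fun i => sg (lift ord0 i)) t.
Proof. by rewrite /tshift tsubst_comp. Qed.

Lemma tshift_tsubst n m (sg : 'I_n -> term m) t :
  tshift (tsubst sg t) = tsubst (fun i => tshift (sg i)) t.
Proof. by rewrite /tshift tsubst_comp. Qed.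

Lemma up_Var n : up (@Var n) = Var.
Proof. by apply/esym/tconsP. Qed.

Lemma upS n m (sg : 'I_n -> term m) i : up sg (lift ord0 i) = tshift (sg i).
Proof. exact: tconsS. Qed.

Lemma tsubst_up n m (sg : 'I_n -> term m) t :
  tsubst (up sg) (tshift t) = tshift (tsubst sg t).
Proof.
rewrite tsubst_tshift tshift_tsubst; congr tsubst.
by apply/funext => i; rewrite upS.
Qed.

Lemma up_comp n m p (tau : 'I_m -> term p) (sg : 'I_n -> term m) :
  (fun i => tsubst (up tau) (up sg i)) = up (fun i => tsubst tau (sg i)).
Proof. by apply: tconsP => // i; rewrite upS tsubst_up. Qed.

Lemma fsubst_Var n (A : form n) : fsubst Var A = A.
Proof.
by elim: A => /= *; rewrite ?up_Var ?tsubst_Var; congruence.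
Qed.

Lemma fsubst_comp n m p (tau : 'I_m -> term p) (sg : 'I_n -> term m) A :
  fsubst tau (fsubst sg A) = fsubst (fun i => tsubst tau (sg i)) A.
Proof.
elim: A m p tau sg => //= {n}.
- by move=> *; rewrite !tsubst_comp.
- by move=> *; rewrite !tsubst_comp.
- by move=> n A IHA B IHB *; rewrite IHA IHB.
- by move=> n A IHA B IHB *; rewrite IHA IHB.
- by move=> n A IHA B IHB *; rewrite IHA IHB.
- by move=> n A IH *; rewrite IH up_comp.
- by move=> n A IH *; rewrite IH up_comp.
Qed.

Lemma fshift_fsubst n m (sg : 'I_n -> term m) A :
  fshift (fsubst sg A) = fsubst (fun i => tshift (sg i)) A.
Proof. exact: fsubst_comp. Qed.

Lemma fsubst_tcons_fshift n m (t : term m) (sg : 'I_n -> term m) A :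
  fsubst (tcons t sg) (fshift A) = fsubst sg A.
Proof.
by rewrite /fshift fsubst_comp; congr fsubst; apply/funext => i; exact: tconsS.
Qed.

Lemma inst_fshift n (t : term n) A : inst (fshift A) t = A.
Proof. by rewrite /inst fsubst_tcons_fshift fsubst_Var. Qed.

Lemma inst_fsubst_up n m (sg : 'I_n -> term m) A t :
  inst (fsubst (up sg) A) t = fsubst (tcons t sg) A.
Proof.
rewrite /inst fsubst_comp; congr fsubst; apply: tconsP => // i.
rewrite upS tsubst_tshift -[RHS]tsubst_Var; congr tsubst.
by apply/funext => j; rewrite tconsS.
Qed.

(** * Natural deduction *)

Lemma prv_wk T n (G G' : seq (form n)) A :
  (forall B, List.In B G -> List.In B G') -> prv T G A -> prv T G' A.
Proof.
move=> sGG' prA; elim: prA G' sGG' => {n G A}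
  [n G m A sg TA|n G A GA|n G A _ IH|n G A B _ IHA _ IHB|n G A B _ IH
  |n G A B _ IH|n G A B _ IH|n G A B _ IH|n G A B C _ IHAB _ IHA _ IHB
  |n G A B _ IH|n G A B _ IHAB _ IHA|n G A _ IH|n G A t _ IH|n G A t _ IH
  |n G A B _ IHA _ IHB|n G t|n G A s t _ IHe _ IHA] G' sGG'.
all: have sC K D : List.In D (K :: G) -> List.In D (K :: G')
  by move=> -[->|/sGG' ?]; [left | right].
all: have sS D : List.In D (map fshift G) -> List.In D (map fshift G')
  by move/List.in_map_iff => [E [<- /sGG' ?]]; apply/List.in_map_iff; exists E.
- exact: prv_ax.
- exact/prv_hyp/sGG'.
- exact/prv_raa/IH/sC.
- by apply: prv_andI; [exact: IHA | exact: IHB].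
- exact/prv_andE1/IH.
- exact/prv_andE2/IH.
- exact/prv_orI1/IH.
- exact/prv_orI2/IH.
- by apply: (prv_orE (IHAB _ sGG')); [exact/IHA/sC | exact/IHB/sC].
- exact/prv_impI/IH/sC.
- by apply: prv_impE (IHAB _ sGG') (IHA _ sGG').
- exact/prv_allI/IH/sS.
- exact/prv_allE/IH.
- exact/prv_exI/IH.
- by apply: (prv_exE (IHA _ sGG')); apply: IHB => D [->|/sS ?]; [left | right].
- exact: prv_eqI.
- exact: prv_eqE (IHe _ sGG') (IHA _ sGG').
Qed.

Lemma prv_wk1 T n (G : seq (form n)) A B : prv T G A -> prv T (B :: G) A.
Proof. by apply: prv_wk => C ?; right. Qed.

Lemma prv_hyp1 T n (G : seq (form n)) A : prv T (A :: G) A.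
Proof. by apply: prv_hyp; left. Qed.

Lemma prv_hyp2 T n (G : seq (form n)) A B : prv T (B :: A :: G) A.
Proof. by apply: prv_hyp; right; left. Qed.

Lemma prv_botE T n (G : seq (form n)) A : prv T G Bot -> prv T G A.
Proof. by move=> prB; apply/prv_raa/prv_wk1. Qed.

Lemma prv_contra T n (G : seq (form n)) A : prv T G (Imp A Bot) -> prv T G A ->
  forall B, prv T G B.
Proof. by move=> prN prA B; apply/prv_botE/(prv_impE prN). Qed.

(** Leibniz's rule replaces a single term, so the coordinates are switched one by one: [mix i] has
    the first [i] of them already switched, and [sg] puts a hole at coordinate [i]. *)
Lemma prv_fsubst_eq T n m (G : seq (form n)) (A : form m) (s t : 'I_m -> term n) :
  (forall j, prv T G (Eq (s j) (t j))) ->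
  prv T G (fsubst s A) -> prv T G (fsubst t A).
Proof.
move=> st prA.
pose mix i (j : 'I_m) := if j < i then t j else s j.
suff main i : i <= m -> prv T G (fsubst (mix i) A).
  have := main m (leqnn m); congr prv; congr fsubst.
  by apply/funext => j; rewrite /mix ltn_ord.
elim: i => [_|i IHi lt_im].
  by move: prA; congr prv; congr fsubst; apply/funext => j.
pose o := Ordinal lt_im.
pose sg (j : 'I_m) := if j == o then x0 else tshift (mix i j).
have instE r : inst (fsubst sg A) r =
    fsubst (fun j => if j == o then r else mix i j) A.
  rewrite /inst fsubst_comp; congr fsubst; apply/funext => j; rewrite /sg.
  case: ifP => // _; rewrite tsubst_tshift -[RHS]tsubst_Var; congr tsubst.
  by apply/funext => l; rewrite tconsS.
have := @prv_eqE T n G (fsubst sg A) (s o) (t o) (st o).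
rewrite !instE.
have -> : (fun j => if j == o then s o else mix i j) = mix i.
  by apply/funext => j; case: eqP => // ->; rewrite /mix ltnn.
have -> : (fun j => if j == o then t o else mix i j) = mix i.+1.
  apply/funext => j; rewrite /mix; case: eqP => [->|/eqP neq].
    by rewrite ltnSn.
  by rewrite [in RHS]ltnS [in RHS]leq_eqVlt -[i in j == i :> nat]/(val o)
    (inj_eq val_inj) (negbTE neq).
by apply; apply: IHi; apply: ltnW.
Qed.

Lemma prv_eq_sym T n (G : seq (form n)) s t :
  prv T G (Eq s t) -> prv T G (Eq t s).
Proof.
move=> st; pose A : form n.+1 := Eq x0 (tshift s).
have E r : inst A r = Eq r s.
  rewrite /inst /A /= tsubst_tshift; congr Eq; rewrite -[RHS]tsubst_Var.
  by congr tsubst; apply/funext => i; rewrite tconsS.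
by rewrite -E; apply: (prv_eqE st); rewrite E; apply: prv_eqI.
Qed.

Lemma prv_eq_trans T n (G : seq (form n)) s t r :
  prv T G (Eq s t) -> prv T G (Eq t r) -> prv T G (Eq s r).
Proof.
move=> st tr; pose A : form n.+1 := Eq (tshift s) x0.
have E u : inst A u = Eq s u.
  rewrite /inst /A /= tsubst_tshift; congr Eq; rewrite -[RHS]tsubst_Var.
  by congr tsubst; apply/funext => i; rewrite tconsS.
by rewrite -E; apply: (prv_eqE tr); rewrite E.
Qed.

(** * Tarskian semantics *)

(** Equality will be read as identity, so these are normal models; the Henkin model must therefore
    identify provably equal terms. *)
Record structure := Structure {
  dom :> Type;
  fint : forall m, sym m -> ('I_m -> dom) -> dom;
  leint : dom -> dom -> Prop }.

Fixpoint eval (M : structure) n (rho : 'I_n -> M) (t : term n) : M :=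
  match t with
  | Var i => rho i
  | App m f ts => fint f (fun j => eval rho (ts j))
  end.

Fixpoint sat (M : structure) n (A : form n) (rho : 'I_n -> M) {struct A} : Prop :=
  match A with
  | Bot => False
  | Eq s t => eval rho s = eval rho t
  | Le s t => leint (eval rho s) (eval rho t)
  | And A B => sat A rho /\ sat B rho
  | Or A B => sat A rho \/ sat B rho
  | Imp A B => sat A rho -> sat B rho
  | All A => forall d, sat A (tcons d rho)
  | Ex A => exists d, sat A (tcons d rho)
  end.

Definition models (M : structure) (T : theory) : Prop :=
  forall m (A : form m), T m A -> forall rho : 'I_m -> M, sat A rho.

Section Semantics.
Variable M : structure.

Lemma eval_tsubst n m (sg : 'I_n -> term m) t (rho : 'I_m -> M) :
  eval rho (tsubst sg t) = eval (fun i => eval rho (sg i)) t.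
Proof. by elim: t => //= p f ts IH; congr fint; apply/funext => j. Qed.

Lemma eval_tshift n (t : term n) d (rho : 'I_n -> M) :
  eval (tcons d rho) (tshift t) = eval rho t.
Proof.
by rewrite /tshift eval_tsubst; congr eval; apply/funext => i; exact: tconsS.
Qed.

Lemma eval_wk n d (rho : 'I_n -> M) : (fun i => eval (tcons d rho) (wk i)) = rho.
Proof. by apply/funext => i; exact: tconsS. Qed.

Lemma eval_up n m (sg : 'I_n -> term m) d (rho : 'I_m -> M) :
  (fun i => eval (tcons d rho) (up sg i)) = tcons d (fun i => eval rho (sg i)).
Proof. by apply: tconsP => // i; rewrite upS eval_tshift. Qed.

Lemma sat_fsubst n m (sg : 'I_n -> term m) A (rho : 'I_m -> M) :
  sat (fsubst sg A) rho = sat A (fun i => eval rho (sg i)).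
Proof.
elim: A m sg rho => //= {n}.
- by move=> *; rewrite !eval_tsubst.
- by move=> *; rewrite !eval_tsubst.
- by move=> n A IHA B IHB m sg rho; rewrite IHA IHB.
- by move=> n A IHA B IHB m sg rho; rewrite IHA IHB.
- by move=> n A IHA B IHB m sg rho; rewrite IHA IHB.
- move=> n A IH m sg rho; apply/propext; split=> h d; have := h d;
  by rewrite IH eval_up.
- move=> n A IH m sg rho; apply/propext; split=> -[d]; exists d; move: p;
  by rewrite IH eval_up.
Qed.

Lemma sat_fshift n (A : form n) d (rho : 'I_n -> M) :
  sat (fshift A) (tcons d rho) = sat A rho.
Proof. by rewrite /fshift sat_fsubst eval_wk. Qed.

Lemma sat_inst n (A : form n.+1) t (rho : 'I_n -> M) :
  sat (inst A t) rho = sat A (tcons (eval rho t) rho).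
Proof. by rewrite /inst sat_fsubst comp_tcons. Qed.

Lemma sat_repl n (A : form n.+1) t d (rho : 'I_n -> M) :
  sat (repl A t) (tcons d rho) = sat A (tcons (eval (tcons d rho) t) rho).
Proof. by rewrite /repl sat_fsubst comp_tcons eval_wk. Qed.

Lemma soundness T n (G : seq (form n)) A : models M T -> prv T G A ->
  forall rho : 'I_n -> M, (forall B, List.In B G -> sat B rho) -> sat A rho.
Proof.
move=> MT prA; elim: prA => {n G A}
  [n G m A sg TA|n G A GA|n G A _ IH|n G A B _ IHA _ IHB|n G A B _ IH
  |n G A B _ IH|n G A B _ IH|n G A B _ IH|n G A B C _ IHAB _ IHA _ IHB
  |n G A B _ IH|n G A B _ IHAB _ IHA|n G A _ IH|n G A t _ IH|n G A t _ IH
  |n G A B _ IHA _ IHB|n G t|n G A s t _ IHe _ IHA] rho GS.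
all: have GC K : sat K rho -> forall D, List.In D (K :: G) -> sat D rho
  by move=> satK D [<-|/GS].
all: have GF d D : List.In D (map fshift G) -> sat D (tcons d rho)
  by move/List.in_map_iff => [E [<- /GS]]; rewrite sat_fshift.
- by rewrite sat_fsubst; apply: MT.
- exact: GS.
- by apply: contrapT => nA; apply: (IH rho); apply: GC.
- by split; [exact: IHA | exact: IHB].
- by case: (IH _ GS).
- by case: (IH _ GS).
- by left; apply: IH.
- by right; apply: IH.
- by case: (IHAB _ GS) => ?; [exact/IHA/GC | exact/IHB/GC].
- by move=> ?; exact/IH/GC.
- exact: IHAB (IHA _ GS).
- by move=> d; apply: IH => B; apply: GF.
- by rewrite sat_inst; apply: IH.
- by exists (eval rho t); rewrite -sat_inst; apply: IH.
- have [d satA] := IHA _ GS.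
  by rewrite -(sat_fshift B d); apply: IHB => D [<-|/GF].
- by [].
- by move: (IHA _ GS); rewrite !sat_inst (IHe _ GS).
Qed.

End Semantics.

(** * Completeness *)

Lemma prv_cuts T n (L G : seq (form n)) A :
  (forall B, List.In B L -> prv T G B) -> prv T L A -> prv T G A.
Proof.
elim: L A => [|C L IH] A GL prA; first by apply: prv_wk prA.
apply: (@prv_impE _ _ _ C); last by apply: GL; left.
by apply: IH (prv_impI prA) => B LB; apply: GL; right.
Qed.

Lemma prv_not_all T n (G : seq (form n)) A :
  prv T G (Imp (All A) Bot) -> prv T G (Ex (Imp A Bot)).
Proof.
move=> prN; apply: prv_raa; apply: prv_impE (prv_wk1 _ prN) _.
apply: prv_allI; apply: prv_raa => /=.
apply: prv_impE (prv_hyp2 _ _ _ _) _; apply: (@prv_exI _ _ _ _ x0).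
rewrite -[X in inst X _]/(fsubst (up wk) (Imp A Bot)) inst_fsubst_up (_ : tcons x0 wk = Var) ?fsubst_Var; last exact: up_Var.
exact: prv_hyp1.
Qed.

(* The elements of the Henkin model: terms over [n] constants, in which
   [HEps A rho] is Hilbert's epsilon term for [Ex A] under [rho]. *)
Inductive hterm (n : nat) : Type :=
| HVar (i : 'I_n)
| HApp (m : nat) (f : sym m) (ts : 'I_m -> hterm n)
| HEps (m : nat) (A : form m.+1) (rho : 'I_m -> hterm n).

HB.instance Definition _ n := gen_eqMixin (hterm n).
HB.instance Definition _ n := gen_choiceMixin (hterm n).

(** A formula with a delayed substitution: formulas about epsilon terms need no enlarged syntax of
    their own. *)
Record clo (n : nat) : Type := Clo {
  clo_size : nat;
  clo_form : form clo_size;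
  clo_env : 'I_clo_size -> hterm n }.
Arguments clo_env {n} c i.
Arguments clo_form {n} c.

Section Henkin.
Variables (T : theory) (n : nat).
Notation hterm := (hterm n).
Notation clo := (clo n).

(* Epsilon terms are replaced as a whole: [a] is not applied below them. *)
Fixpoint hval N (a : hterm -> term N) (h : hterm) : term N :=
  match h with
  | HApp m f ts => App f (fun j => hval a (ts j))
  | _ => a h
  end.

Definition cinst N (a : hterm -> term N) (c : clo) : form N :=
  fsubst (fun i => hval a (clo_env c i)) (clo_form c).

Definition henkin (h : hterm) : clo :=
  match h with
  | HEps m A rho => Clo (Imp (fshift (Ex A)) A) (tcons h rho)
  | _ => Clo Top tnil
  end.

Fixpoint hdepth (h : hterm) : nat :=
  match h with
  | HVar _ => 0
  | HApp m f ts => \max_(j < m) hdepth (ts j)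
  | HEps m A rho => (\max_(j < m) hdepth (rho j)).+1
  end.

(** A term of smaller depth than [e] cannot contain [e], so reading [e] as a fresh variable merely
    shifts its value. *)
Lemma hval_fresh N (a : hterm -> term N) e h : hdepth h < hdepth e ->
  hval (fun h' => if h' == e then x0 else tshift (a h')) h = tshift (hval a h).
Proof.
elim: h => [i|m f ts IH|m A rho _] /= lt_e.
- by case: eqP lt_e => // <-.
- congr App; apply/funext => j; apply: IH; apply: leq_ltn_trans lt_e.
  exact: (leq_bigmax (F := fun j => hdepth (ts j))).
- by case: eqP lt_e => // <-; rewrite ltnn.
Qed.

(** If [Ex A --> A(x)] is refuted for a fresh x, then its premise [Ex A] is provable; but a witness
    of [Ex A] makes the implication true, so the other hypotheses are already inconsistent. *)
Lemma prv_henkin_axiom N (G : seq (form N)) (A : form N.+1) :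
  prv T (Imp (fshift (Ex A)) A :: map fshift G) Bot -> prv T G Bot.
Proof.
move=> prB; have prN := prv_impI prB.
have prE : prv T G (Ex A).
  apply: prv_raa; have := prv_allE t0 (prv_allI prN).
  move/(prv_wk1 (Imp (Ex A) Bot)) => pr0; apply: prv_impE pr0 _.
  rewrite /inst /= -/(inst _ _) -/(fsubst _ (Ex A)).
  apply: prv_impI; apply: (prv_contra (prv_hyp2 _ _ _ _)).
  rewrite -[X in prv _ _ X](inst_fshift t0); exact: prv_hyp1.
apply: (prv_exE prE); apply: (prv_impE (prv_wk1 _ prN)).
exact/prv_impI/prv_hyp2.
Qed.

(** Henkin axioms are discharged one at a time, starting from an epsilon term of greatest depth,
    which is visible in none of the other axioms. *)
Lemma henkin_conservative (c0 : clo) (E : seq hterm) :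
  (forall i, hdepth (clo_env c0 i) = 0) ->
  (forall N (a : hterm -> term N),
     prv T (cinst a c0 :: map (cinst a) (map henkin E)) Bot) ->
  forall N (a : hterm -> term N), prv T [:: cinst a c0] Bot.
Proof.
move=> c0P.
(* Sorted by decreasing depth and without repetitions: the head of the list can then be made fresh
   for everything behind it. *)
wlog /andP[uE sE] : E / uniq E && sorted (fun x y => hdepth y <= hdepth x) E.
  move=> main prE.
  set r := fun x y : hterm => hdepth y <= hdepth x in main.
  apply: (main (sort r (undup E))).
    by rewrite sort_uniq undup_uniq sort_sorted // => x y; exact: leq_total.
  move=> N a; apply: prv_wk (prE N a) => B [->|]; first by left.
  rewrite -!map_comp => /List.in_map_iff [h [<- hE]]; right.
  apply/List.in_map_iff; exists h; split=> //.
  have inE (s : seq hterm) y : List.In y s <-> y \in s.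
    elim: s => //= z s ->; rewrite in_cons eq_sym.
    by split=> [[->|->]|/orP[/eqP->|]]; rewrite ?eqxx ?orbT; auto.
  by apply/inE; rewrite mem_sort mem_undup; apply/inE.
elim: E uE sE => [|e E IH] /= uE sE prE; first exact: prE.
case/andP: uE => eE uE.
have le_e : all (fun x => hdepth x <= hdepth e) E.
  by apply: order_path_min sE => x y z /= xy yz; apply: leq_trans xy.
apply: (IH uE (path_sorted sE)) => N a.
case: e => [i|m f ts|m A rho] in eE le_e prE sE *.
- by have := prE N a; apply: prv_cuts => B [<-|[<-|EB]];
    [exact: prv_hyp1 | exact/prv_impI/prv_hyp1 | by apply: prv_hyp; right].
- by have := prE N a; apply: prv_cuts => B [<-|[<-|EB]];
    [exact: prv_hyp1 | exact/prv_impI/prv_hyp1 | by apply: prv_hyp; right].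
set e := HEps A rho in eE le_e prE sE.
(* The refutation exists for every interpretation of epsilon terms, in particular with [e] read as a
   fresh variable. Then [c0] and the remaining axioms are merely shifted, and the axiom of [e] takes
   the shape treated in [prv_henkin_axiom]. *)
pose a' h := if h == e then x0 else tshift (a h).
have rhoP j : hval a' (rho j) = tshift (hval a (rho j)).
  apply: hval_fresh; rewrite ltnS.
  exact: (leq_bigmax (F := fun j => hdepth (rho j))).
have c0E : cinst a' c0 = fshift (cinst a c0).
  rewrite /cinst fshift_fsubst; congr fsubst; apply/funext => i.
  by apply: hval_fresh; rewrite c0P.
have EE : map (cinst a') (map henkin E) =
          map fshift (map (cinst a) (map henkin E)).
  rewrite -!map_comp; apply/eq_in_map => h hE /=.
  rewrite /cinst fshift_fsubst; congr fsubst; apply/funext.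
  case: h hE => [i|p f ts|p B mu] hE; [by case | by case |].
  elim/ordS_ind => [|j].
    have : HEps B mu != e by apply: contraNneq eE => <-.
    by rewrite /= /a' => /negbTE ->.
  rewrite /= tconsS; apply: hval_fresh; apply: leq_trans (allP le_e _ hE).
  exact: (leq_bigmax (F := fun j => hdepth (mu j))).
pose B := fsubst (up (fun j => hval a (rho j))) A.
have eP : cinst a' (henkin e) = Imp (fshift (Ex B)) B.
  have sE' : (fun i => hval a' (tcons e rho i)) =
             up (fun j => hval a (rho j)).
    apply: tconsP => [|i]; first by rewrite /= /a' eqxx.
    by rewrite tconsS rhoP.
  transitivity (fsubst (up (fun j => hval a (rho j))) (Imp (fshift (Ex A)) A)).
    by rewrite -sE'.
  transitivity (Imp (fsubst (up (fun j => hval a (rho j))) (fshift (Ex A))) B).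
    by [].
  congr Imp; rewrite fsubst_tcons_fshift -[Ex B]/(fsubst _ (Ex A)).
  by rewrite fshift_fsubst.
apply: (@prv_henkin_axiom _ _ B); have := prE _ a'.
rewrite /= EE eP c0E; apply: prv_wk => C [<-|[<-|EC]].
- by right; left.
- by left.
- by right; right.
Qed.

(** One finite set of premisses must serve all interpretations [a], so epsilon terms behave as
    uninterpreted constants. *)
Definition derives (S : set clo) (c : clo) : Prop :=
  exists2 G : seq clo, forall x, List.In x G -> S x &
    forall N (a : hterm -> term N), prv T (map (cinst a) G) (cinst a c).

Definition cneg (c : clo) : clo := Clo (Imp (clo_form c) Bot) (clo_env c).

Lemma derives_rule S L c : (forall x, List.In x L -> derives S x) ->
  (forall N (a : hterm -> term N), prv T (map (cinst a) L) (cinst a c)) ->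
  derives S c.
Proof.
move=> SL prc.
have [G SG prG] : exists2 G : seq clo, forall x, List.In x G -> S x &
    forall x, List.In x L -> forall N (a : hterm -> term N),
      prv T (map (cinst a) G) (cinst a x).
  elim: L SL {prc} => [|x L IH] SL; first by exists [::].
  have [G SG prx] : derives S x by apply: SL; left.
  have [|G' SG' prG'] := IH; first by move=> y Ly; apply: SL; right.
  exists (G ++ G') => [y /List.in_app_iff [/SG|/SG']|y] //.
  move=> [<-|/prG' pry] N a; rewrite map_cat.
    by apply: prv_wk (prx N a) => B GB; apply/List.in_app_iff; left.
  by apply: prv_wk (pry N a) => B GB; apply/List.in_app_iff; right.
exists G => // N a; apply: prv_cuts (prc N a) => B /List.in_map_iff [x [<- Lx]].
exact: prG.
Qed.

Lemma derives_mem S c : S c -> derives S c.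
Proof. by exists [:: c] => [x [<-|[]]|N a] //; exact: prv_hyp1. Qed.

Lemma derives_setU1 S c d : derives (S `|` [set c])%classic d ->
  exists2 G : seq clo, forall x, List.In x G -> S x &
    forall N (a : hterm -> term N), prv T (map (cinst a) (c :: G)) (cinst a d).
Proof.
move=> [G SG prd].
have [G' SG' GG'] : exists2 G' : seq clo, forall x, List.In x G' -> S x &
    forall x, List.In x G -> List.In x (c :: G').
  elim: G SG {prd} => [|x G IH] SG; first by exists [::].
  have [|G' SG' GG'] := IH; first by move=> y Gy; apply: SG; right.
  have [Sx|->] := SG x (or_introl erefl).
    exists (x :: G') => [y [<-|/SG']|y [<-|/GG' [<-|]]] //=; by auto.
  by exists G' => [|y [<-|/GG']]; [exact: SG' | left |].
exists G' => // N a; apply: prv_wk (prd N a) => B /List.in_map_iff [x [<- /GG' ?]].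
by apply/(List.in_map_iff _ (c :: G')); exists x.
Qed.

(** Zorn's lemma is applied to the sets whose union with [S0] is consistent; a derivation uses
    finitely many premisses, so consistency passes to unions of chains. *)
Lemma lindenbaum (S0 : set clo) (bot : clo) : clo_form bot = Bot ->
  ~ derives S0 bot ->
  exists S : set clo, [/\ (S0 `<=` S)%classic, ~ derives S bot,
    (forall L c, (forall x, List.In x L -> S x) ->
      (forall N (a : hterm -> term N), prv T (map (cinst a) L) (cinst a c)) ->
      S c) &
    (forall c, S c \/ S (cneg c))].
Proof.
move=> botE con0.
have botP N (a : hterm -> term N) : cinst a bot = Bot.
  by rewrite /cinst; case: bot botE {con0} => m A rho /= ->.
have [F sF chF|S1 [con1 max1]] :=
    @Zorn_bigcup clo [set S | ~ derives (S0 `|` S)%classic bot]%classic.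
  move=> [G SG prb].
  (* The empty chain is a separate case: then all premisses lie in [S0], which is consistent by
     assumption. *)
  have [[X FX]|nF] := pselect (exists X, F X); last first.
    apply: con0; exists G => // x /SG [|[X FX]] //.
    by case: nF; exists X.
  suff [Y FY GY] : exists2 Y, F Y & forall x, List.In x G -> (S0 `|` Y)%classic x.
    by apply: (sF _ FY); exists G.
  elim: G SG {prb} => [|x G IH] SG; first by exists X.
  have [|Y FY GY] := IH; first by move=> y Gy; apply: SG; right.
  have [S0x|[Z FZ Zx]] := SG x (or_introl erefl).
    by exists Y => [|y [<-|/GY]]; [exact: FY | left |].
  have [YZ|ZY] := chF _ _ FY FZ.
    exists Z => // y [<-|/GY]; first by right.
    by move=> [|/YZ]; [left | right].
  by exists Y => [|y [<-|/GY]]; [exact: FY | right; apply: ZY |].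
pose S := (S0 `|` S1)%classic.
have memS c : ~ derives (S `|` [set c])%classic bot -> S c.
  move=> conc; have [//|nSc] := pselect (S c).
  case: (max1 (S1 `|` [set c])%classic); last by rewrite /= setUA.
  split=> [x|sub]; first by left.
  by apply: nSc; right; apply: sub; right.
have ruleS L c : (forall x, List.In x L -> S x) ->
    (forall N (a : hterm -> term N), prv T (map (cinst a) L) (cinst a c)) -> S c.
  move=> SL prc; apply: memS => /derives_setU1 [G SG prb]; apply: con1.
  apply: (@derives_rule _ (c :: G)) => // x [<-|/SG] //; last exact: derives_mem.
  by apply: (derives_rule _ prc) => y /SL; exact: derives_mem.
exists S; split=> // [x|c]; first by left.
have [//|nSc] := pselect (S c); [by left | right].
have /contrapT /derives_setU1 [G SG prb] : ~ ~ derives (S `|` [set c])%classic bot.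
  by move/memS.
apply: (ruleS G) => // N a; apply: prv_impI.
by have := prb N a; rewrite botP.
Qed.

(** * The term model of a complete set with Henkin witnesses *)

Section Model.
Variables (S : set clo) (bot : clo).
Hypothesis botE : clo_form bot = Bot.
Hypothesis conS : ~ S bot.
Hypothesis ruleS : forall L c, (forall x, List.In x L -> S x) ->
  (forall N (a : hterm -> term N), prv T (map (cinst a) L) (cinst a c)) -> S c.
Hypothesis complS : forall c, S c \/ S (cneg c).
Hypothesis henkinS : forall h, S (henkin h).

Lemma ruleS1 c d : S c ->
  (forall N (a : hterm -> term N), prv T [:: cinst a c] (cinst a d)) -> S d.
Proof. by move=> Sc; apply: (ruleS (L := [:: c])) => x [<-|[]]. Qed.

Lemma ruleS2 c1 c2 d : S c1 -> S c2 ->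
  (forall N (a : hterm -> term N),
     prv T [:: cinst a c1; cinst a c2] (cinst a d)) -> S d.
Proof. by move=> Sc1 Sc2; apply: (ruleS (L := [:: c1; c2])) => x [<-|[<-|[]]]. Qed.

Lemma negS c : S (cneg c) <-> ~ S c.
Proof.
split=> [Sn Sc|nSc]; last by case: (complS c).
apply: conS; apply: (ruleS2 Sn Sc) => N a.
by rewrite {3}/cinst botE; apply: prv_impE (prv_hyp1 _ _ _) (prv_hyp2 _ _ _ _).
Qed.

Definition ceq (d e : hterm) : clo :=
  Clo (Eq (Var ord0) (Var (lift ord0 ord0))) (tcons d (tcons e tnil)).

Lemma cinst_ceq N (a : hterm -> term N) d e :
  cinst a (ceq d e) = Eq (hval a d) (hval a e).
Proof. by rewrite /cinst /= tconsS. Qed.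

Lemma ceq_refl d : S (ceq d d).
Proof.
by apply: (ruleS (L := [::])) => // N a; rewrite cinst_ceq; apply: prv_eqI.
Qed.

Lemma ceq_sym d e : S (ceq d e) -> S (ceq e d).
Proof.
move=> de; apply: (ruleS1 de) => N a; rewrite !cinst_ceq.
exact/prv_eq_sym/prv_hyp1.
Qed.

Lemma ceq_trans d e f : S (ceq d e) -> S (ceq e f) -> S (ceq d f).
Proof.
move=> de ef; apply: (ruleS2 de ef) => N a; rewrite !cinst_ceq.
exact: prv_eq_trans (prv_hyp1 _ _ _) (prv_hyp2 _ _ _ _).
Qed.

(** The representative depends only on the class of [d] (see [hrep_eq]), so its fixed points form
    the quotient, and equality in the model is identity. *)
Definition hrep (d : hterm) : hterm :=
  xget (HApp Zero tnil) [set e | S (ceq d e)]%classic.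

Lemma hrepP d : S (ceq d (hrep d)).
Proof.
have P : exists e, [set e | S (ceq d e)]%classic e by exists d; apply: ceq_refl.
exact: (xgetPex (HApp Zero tnil) P).
Qed.

Lemma hrep_eq d e : S (ceq d e) -> hrep d = hrep e.
Proof.
move=> de; congr xget; apply/seteqP; split=> f /=; apply: ceq_trans.
  exact: ceq_sym.
exact: de.
Qed.

Lemma hrepK d : hrep (hrep d) = hrep d.
Proof. by apply/esym/hrep_eq/hrepP. Qed.

Definition hdom := {d : hterm | hrep d = d}.
Definition toh (d : hterm) : hdom := exist _ (hrep d) (hrepK d).

Lemma hdom_eq (x y : hdom) : S (ceq (sval x) (sval y)) -> x = y.
Proof.
case: x y => [d dP] [e eP] /= /hrep_eq; rewrite dP eP => de.
by subst e; congr exist; apply: Prop_irrelevance.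
Qed.

Definition hmodel : structure := @Structure hdom
  (fun m f v => toh (HApp f (fun j => sval (v j))))
  (fun x y => S (Clo (Le (Var ord0) (Var (lift ord0 ord0)))
                     (tcons (sval x) (tcons (sval y) tnil)))).

Lemma congS m (A : form m) (u v : 'I_m -> hterm) :
  (forall j, S (ceq (u j) (v j))) -> S (Clo A u) -> S (Clo A v).
Proof.
move=> uv SA; pose L := [seq ceq (u j) (v j) | j <- enum 'I_m].
apply: (ruleS (L := Clo A u :: L)) => [x [<-|]|N a] //.
  by move/List.in_map_iff => [j [<- _]].
apply: (@prv_fsubst_eq _ _ _ _ _ (fun j => hval a (u j))); last exact: prv_hyp1.
move=> j; apply: prv_hyp; right; rewrite -map_comp.
apply/List.in_map_iff; exists j; rewrite /= cinst_ceq; split=> //.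
have: j \in enum 'I_m by rewrite mem_enum.
elim: (enum _) => //= k s IH; rewrite in_cons => /orP[/eqP->|/IH]; by auto.
Qed.

Fixpoint hsub m (rho : 'I_m -> hterm) (t : term m) : hterm :=
  match t with
  | Var i => rho i
  | App p f ts => HApp f (fun j => hsub rho (ts j))
  end.

Lemma hval_hsub N (a : hterm -> term N) m (rho : 'I_m -> hterm) t :
  hval a (hsub rho t) = tsubst (fun i => hval a (rho i)) t.
Proof. by elim: t => //= p f ts IH; congr App; apply/funext => j. Qed.

Lemma ceq_eval m (t : term m) (rho : 'I_m -> hmodel) :
  S (ceq (sval (eval rho t)) (hsub (fun i => sval (rho i)) t)).
Proof.
elim: t => [i|p f ts IH] /=; first exact: ceq_refl.
apply: ceq_trans (ceq_sym (hrepP _)) _.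
(* The equation d = f(v) is written as one fixed formula under an environment, so that [congS] can
   replace all arguments of f at once. *)
pose A : form p.+1 := Eq x0 (App f wk).
pose h := HApp f (fun j => sval (eval rho (ts j))).
have E (d : hterm) (v : 'I_p -> hterm) : S (ceq d (HApp f v)) <->
    S (Clo A (tcons d v)).
  have Ecl N (a : hterm -> term N) : cinst a (ceq d (HApp f v)) =
      cinst a (Clo A (tcons d v)).
    rewrite cinst_ceq /cinst /=; congr Eq; congr App; apply/funext => j.
    by rewrite tconsS.
  by split=> h1; apply: (ruleS1 h1) => N a; rewrite Ecl; apply: prv_hyp1.
apply/E; apply: (@congS _ _ (tcons h (fun j => sval (eval rho (ts j))))).
  by elim/ordS_ind => [|j]; [exact: ceq_refl | rewrite !tconsS].
exact/E/ceq_refl.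
Qed.

Lemma henkin_witness m (A : form m.+1) (rho : 'I_m -> hterm) :
  S (Clo (Ex A) rho) -> exists d : hdom, S (Clo A (tcons (sval d) rho)).
Proof.
move=> SE; exists (toh (HEps A rho)).
have : S (Clo A (tcons (HEps A rho) rho)).
  apply: (ruleS2 SE (henkinS (HEps A rho))) => N a.
  apply: (prv_impE (prv_hyp2 _ _ _ _)).
  rewrite -/(fsubst _ (fshift (Ex A))) /= -/(fsubst _ (Ex A)).
  rewrite comp_tcons -[X in prv _ _ X]/(fsubst _ (fshift (Ex A))).
  by rewrite fsubst_tcons_fshift; exact: prv_hyp1.
apply: congS; elim/ordS_ind => [|j]; first exact: hrepP.
by rewrite !tconsS; exact: ceq_refl.
Qed.

Lemma truth m (A : form m) (rho : 'I_m -> hmodel) :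
  sat A rho <-> S (Clo A (fun i => sval (rho i))).
Proof.
have cE p (B : form p.+1) (d : hdom) (mu : 'I_p -> hmodel) N (a : hterm -> term N) :
    cinst a (Clo B (fun i => sval (tcons d mu i))) =
    inst (fsubst (up (fun i => hval a (sval (mu i)))) B) (hval a (sval d)).
  rewrite inst_fsubst_up /cinst; congr fsubst.
  by apply: tconsP => // i; rewrite /= tconsS.
elim: A rho => {m} /=.
- move=> m rho; split=> // SB; apply: conS; apply: (ruleS1 SB) => N a.
  by rewrite [X in prv _ _ X]/cinst botE; exact: prv_hyp1.
- move=> m s t rho; split=> [st|SE].
    have := ceq_trans (ceq_sym (ceq_eval s rho)).
    rewrite st => /(_ _ (ceq_eval t rho)) /ruleS1; apply=> N a.
    by rewrite cinst_ceq !hval_hsub; exact: prv_hyp1.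
  apply: hdom_eq; apply: ceq_trans (ceq_eval s rho) _.
  apply: ceq_trans (ceq_sym (ceq_eval t rho)); apply: (ruleS1 SE) => N a.
  by rewrite cinst_ceq !hval_hsub; exact: prv_hyp1.
- move=> m s t rho.
  have E : S (Clo (Le s t) (fun i => sval (rho i))) <->
      S (Clo (Le (Var ord0) (Var (lift ord0 ord0)))
        (tcons (hsub (fun i => sval (rho i)) s)
        (tcons (hsub (fun i => sval (rho i)) t) tnil))).
    have Ecl N (a : hterm -> term N) : cinst a (Clo (Le s t) (fun i => sval (rho i))) =
      cinst a (Clo (Le (Var ord0) (Var (lift ord0 ord0)))
        (tcons (hsub (fun i => sval (rho i)) s)
        (tcons (hsub (fun i => sval (rho i)) t) tnil))).
      by rewrite /cinst /= tconsS !hval_hsub.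
    by split=> h1; apply: (ruleS1 h1) => N a; rewrite Ecl; apply: prv_hyp1.
  rewrite E; split; apply: congS; elim/ordS_ind => [|i]; rewrite ?tconsS //.
  + exact: ceq_eval.
  + by elim/ordS_ind: i => [|[]] //; exact: ceq_eval.
  + exact/ceq_sym/ceq_eval.
  + by elim/ordS_ind: i => [|[]] //; exact/ceq_sym/ceq_eval.
- move=> m A IHA B IHB rho; rewrite IHA IHB; split=> [[SA SB]|SAB].
    apply: (ruleS2 SA SB) => N a.
    exact: prv_andI (prv_hyp1 _ _ _) (prv_hyp2 _ _ _ _).
  split; apply: (ruleS1 SAB) => N a.
    exact: prv_andE1 (prv_hyp1 _ _ _).
  exact: prv_andE2 (prv_hyp1 _ _ _).
- move=> m A IHA B IHB rho; rewrite IHA IHB; split=> [[SA|SB]|SAB].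
  + by apply: (ruleS1 SA) => N a; exact: prv_orI1 (prv_hyp1 _ _ _).
  + by apply: (ruleS1 SB) => N a; exact: prv_orI2 (prv_hyp1 _ _ _).
  + have [|/negS SA] := pselect (S (Clo A (fun i => sval (rho i)))); first by left.
    right; apply: (ruleS2 SAB SA) => N a.
    apply: (prv_orE (prv_hyp1 _ _ _)); last exact: prv_hyp1.
    apply: (prv_contra _ (prv_hyp1 _ _ _)).
    by apply: prv_hyp; right; right; left.
- move=> m A IHA B IHB rho; rewrite IHA IHB; split=> [SAB|SAB SA].
    have [/SAB SB|/negS SA] := pselect (S (Clo A (fun i => sval (rho i)))).
      by apply: (ruleS1 SB) => N a; exact/prv_impI/prv_hyp2.
    apply: (ruleS1 SA) => N a; apply: prv_impI.
    exact: prv_contra (prv_hyp2 _ _ _ _) (prv_hyp1 _ _ _) _.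
  by apply: (ruleS2 SAB SA) => N a;
    exact: prv_impE (prv_hyp1 _ _ _) (prv_hyp2 _ _ _ _).
- move=> m A IH rho; split=> [all_A|SA d]; last first.
    apply/IH; apply: (ruleS1 SA) => N a; rewrite cE.
    exact: prv_allE (prv_hyp1 _ _ _).
  (* By completeness of [S] an absent universal formula is negated in [S], whence [Ex (~ A)] lies
     there, and its epsilon witness contradicts [all_A]. *)
  apply: contrapT => /negS SN.
  have : S (Clo (Ex (Imp A Bot)) (fun i => sval (rho i))).
    by apply: (ruleS1 SN) => N a; exact: prv_not_all (prv_hyp1 _ _ _).
  move=> /henkin_witness [d]; rewrite -comp_tcons => /(negS (Clo _ _)); apply.
  exact/IH.
- move=> m A IH rho; split=> [[d /IH SA]|/henkin_witness [d]].
    apply: (ruleS1 SA) => N a; rewrite cE => //.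
    exact: prv_exI (prv_hyp1 _ _ _).
  by rewrite -comp_tcons => /IH; exists d.
Qed.

Lemma hmodel_models : models hmodel T.
Proof.
move=> m A TA rho; apply/truth.
by apply: (ruleS (L := [::])) => // N a; apply: prv_ax.
Qed.

End Model.
End Henkin.

(** The free variables of [A] are frozen as the constants [HVar]; if [~ A] is consistent with all
    Henkin axioms, the term model refutes [A] under the assignment of these constants to
    themselves. *)
Theorem completeness (T : theory) n (A : form n) :
  (forall M, models M T -> forall rho : 'I_n -> M, sat A rho) -> proves T A.
Proof.
move=> valA; apply: contrapT => nprA.
pose c0 : clo n := Clo (Imp A Bot) (@HVar n).
pose S0 : set (clo n) := [set c | c = c0 \/ exists h, c = henkin h]%classic.
pose bot : clo n := Clo Bot tnil.
have con0 : ~ derives T S0 bot.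
  move=> [G SG prb].
  have [E GE] : exists E, forall x, List.In x G -> List.In x (c0 :: map (@henkin n) E).
    elim: G SG {prb} => [|x G IH] SG; first by exists [::].
    have [|E GE] := IH; first by move=> y Gy; apply: SG; right.
    have [->|[h ->]] := SG x (or_introl erefl).
      by exists E => y [<-|/GE]; [left |].
    by exists (h :: E) => y [<-|/GE [<-|]] /=; auto.
  have h0 i : hdepth (clo_env c0 i) = 0 by [].
  have prH N (a : hterm n -> term N) :
      prv T (cinst a c0 :: map (cinst a) (map (@henkin n) E)) Bot.
    apply: prv_wk (prb N a) => B /List.in_map_iff [x [<- /GE Ex]].
    by apply/(List.in_map_iff _ (c0 :: _)); exists x.
  (* Reading each constant as its own variable recovers [~ A] literally; no epsilon term is visible
     in [c0] any more, so the default [t0] is harmless. *)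
  have := henkin_conservative h0 prH (fun h => if h is HVar i then Var i else t0).
  by rewrite /cinst /= fsubst_Var => prc; apply/nprA/prv_raa.
have [|S [S0S conS ruleS complS]] := lindenbaum _ con0; first by [].
have SHenkin h : S (henkin h) by apply: S0S; right; exists h.
have nSb : ~ S bot by move/(derives_mem T).
have botE : clo_form bot = Bot by [].
have MT := @hmodel_models T n S bot botE nSb ruleS complS SHenkin.
pose rho i : hmodel ruleS := toh ruleS (HVar i).
have /(@truth T n S bot botE nSb ruleS complS SHenkin) SA := valA _ MT rho.
have : S (Clo A (@HVar n)).
  by apply: (congS ruleS _ SA) => j; exact/(ceq_sym ruleS)/(hrepP ruleS).
by apply/(@negS T n S bot botE nSb ruleS complS (Clo _ _)); apply: S0S; left.
Qed.

(** * Arithmetic in models of PV *)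

Record PVmodel := { pv_str :> structure; pv_models : models pv_str PV }.

Section Operations.
Variable M : PVmodel.

Definition m0 : M := fint Zero tnil.
Definition mS (x : M) : M := fint Succ (tcons x tnil).
Definition mhalf (x : M) : M := fint Half (tcons x tnil).
Definition mlen (x : M) : M := fint Len (tcons x tnil).
Definition madd (x y : M) : M := fint Add (tcons x (tcons y tnil)).
Definition mmul (x y : M) : M := fint Mul (tcons x (tcons y tnil)).
Definition msmash (x y : M) : M := fint Smash (tcons x (tcons y tnil)).

Lemma eval_tnil n (rho : 'I_n -> M) : (fun i => eval rho (tnil i)) = tnil.
Proof. exact: tnilP. Qed.

Lemma eval_tcons n (rho : 'I_n -> M) m s (sg : 'I_m -> term n) :
  (fun i => eval rho (tcons s sg i)) = tcons (eval rho s) (fun i => eval rho (sg i)).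
Proof. exact: comp_tcons. Qed.

Lemma eval_0 n (rho : 'I_n -> M) : eval rho t0 = m0.
Proof. by rewrite /= eval_tnil. Qed.

Lemma eval_S n (rho : 'I_n -> M) s : eval rho (tS s) = mS (eval rho s).
Proof. by rewrite /= eval_tcons eval_tnil. Qed.

Lemma eval_half n (rho : 'I_n -> M) s : eval rho (thalf s) = mhalf (eval rho s).
Proof. by rewrite /= eval_tcons eval_tnil. Qed.

Lemma eval_len n (rho : 'I_n -> M) s : eval rho (len s) = mlen (eval rho s).
Proof. by rewrite /= eval_tcons eval_tnil. Qed.

Lemma eval_add n (rho : 'I_n -> M) s t :
  eval rho (tadd s t) = madd (eval rho s) (eval rho t).
Proof. by rewrite /= !eval_tcons eval_tnil. Qed.

Lemma eval_mul n (rho : 'I_n -> M) s t :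
  eval rho (tmul s t) = mmul (eval rho s) (eval rho t).
Proof. by rewrite /= !eval_tcons eval_tnil. Qed.

Lemma eval_smash n (rho : 'I_n -> M) s t :
  eval rho (smash s t) = msmash (eval rho s) (eval rho t).
Proof. by rewrite /= !eval_tcons eval_tnil. Qed.

Definition evalE := (eval_0, eval_S, eval_half, eval_len, eval_add, eval_mul,
  eval_smash, eval_tshift).

Lemma basic i x y z w : i < 32 ->
  sat (nth Bot BASIC i) (tcons x (tcons y (tcons z (tcons w (@tnil M))))).
Proof.
move=> i32; apply: (@pv_models M); apply: PV_basic.
by do 32?[case: i i32 => [_|i i32]; [by do ?[by left | right] |]].
Qed.

End Operations.

Declare Scope model_scope.
Delimit Scope model_scope with M.
Bind Scope model_scope with dom.
Local Notation "x + y" := (madd x y) : model_scope.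
Local Notation "x * y" := (mmul x y) : model_scope.
Local Notation "x <= y" := (leint x y) : model_scope.
Local Notation "x < y" := (leint (mS x) y) : model_scope.

Ltac use_basic i x y z w :=
  have := @basic _ i x y z w isT;
  rewrite /BASIC /=; rewrite ?(evalE, eval_tcons, eval_tnil) /=;
  rewrite ?(evalE, eval_tcons, eval_tnil) /=;
  rewrite ?(evalE, eval_tcons, eval_tnil) /=;
  rewrite ?(evalE, eval_tcons, eval_tnil) /=.

Section Arith.
Variable M : PVmodel.
Implicit Types x y z : M.
Local Notation "0" := (m0 M) : model_scope.
Local Open Scope model_scope.

Lemma mle_S x y : y <= x -> y <= mS x.
Proof. by use_basic 0%N x y x x. Qed.
Lemma mle0 x : 0 <= x.
Proof. by use_basic 2 x x x x. Qed.
Lemma mlt_neqAle x y : (x <= y /\ x <> y) <-> x < y.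
Proof. by use_basic 3 x y x x. Qed.
Lemma mle_total x y : y <= x \/ x <= y.
Proof. by use_basic 5 x y x x. Qed.
Lemma mle_anti x y : x <= y -> y <= x -> x = y.
Proof. by use_basic 6 x y x x => H *; apply: H. Qed.
Lemma mle_trans y x z : x <= y -> y <= z -> x <= z.
Proof. by use_basic 7 x y z x => H *; apply: H. Qed.
Lemma mlen0 : mlen 0 = 0.
Proof. by use_basic 8 0 0 0 0. Qed.
Lemma mlen_le x y : x <= y -> mlen x <= mlen y.
Proof. by use_basic 11 x y x x. Qed.
Lemma mlen_smash x y : mlen (msmash x y) = mS (mlen x * mlen y).
Proof. by use_basic 12 x y x x. Qed.
Lemma mle_addr x y : x <= x + y.
Proof. by use_basic 18 x y x x. Qed.
Lemma maddC x y : x + y = y + x.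
Proof. by use_basic 20 x y x x. Qed.
Lemma madd0 x : x + 0 = x.
Proof. by use_basic 21 x x x x. Qed.
Lemma maddS x y : x + mS y = mS (x + y).
Proof. by use_basic 22 x y x x. Qed.
Lemma maddA x y z : x + y + z = x + (y + z).
Proof. by use_basic 23 x y z x. Qed.
Lemma mle_add2l x y z : x + y <= x + z <-> y <= z.
Proof. by use_basic 24 x y z x. Qed.
Lemma mmul0 x : x * 0 = 0.
Proof. by use_basic 25 x x x x. Qed.
Lemma mmulS x y : x * mS y = x * y + x.
Proof. by use_basic 26 x y x x. Qed.
Lemma mmulC x y : x * y = y * x.
Proof. by use_basic 27 x y x x. Qed.
Lemma mmulDr x y z : x * (y + z) = x * y + x * z.
Proof. by use_basic 28 x y z x. Qed.
Lemma mle_mul2l x y z : mS 0 <= x -> (x * y <= x * z <-> y <= z).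
Proof. by use_basic 29 x y z x. Qed.
Lemma mlen_half x : x <> 0 -> mlen x = mS (mlen (mhalf x)).
Proof. by use_basic 30 x x x x. Qed.
Lemma mhalf_def x y : x = mhalf y <-> (mS (mS 0) * x = y \/ mS (mS (mS 0) * x) = y).
Proof. by use_basic 31 x y x x. Qed.

Lemma mle_refl x : x <= x.
Proof. by case: (mle_total x x). Qed.

Lemma madd0l x : 0 + x = x.
Proof. by rewrite maddC madd0. Qed.

Lemma maddSl x y : mS x + y = mS (x + y).
Proof. by rewrite maddC maddS maddC. Qed.

Lemma mmulSl x y : mS x * y = x * y + y.
Proof. by rewrite mmulC mmulS mmulC. Qed.

Lemma mmul2 x : mS (mS 0) * x = x + x.
Proof. by rewrite mmulC !mmulS mmul0 madd0l. Qed.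

Lemma mle_succ x : x <= mS x.
Proof. exact/mle_S/mle_refl. Qed.

Lemma mltW x y : x < y -> x <= y.
Proof. by move/mlt_neqAle => []. Qed.

Lemma mle_eqVlt x y : x <= y -> x = y \/ x < y.
Proof. by move=> xy; have [->|ne] := pselect (x = y); [left | right; apply/mlt_neqAle]. Qed.

Lemma mltn x : ~ x < x.
Proof. by move/mlt_neqAle => []. Qed.

Lemma mle_ltF x y : x <= y -> ~ y < x.
Proof. by move=> xy yx; apply: (@mltn y); apply: mle_trans yx xy. Qed.

Lemma mleP x y : x <= y \/ y < x.
Proof.
have [yx|] := mle_total x y; last by left.
by case: (mle_eqVlt yx) => [->|]; [left; exact: mle_refl | right].
Qed.

Lemma mleSS x y : mS x <= mS y <-> x <= y.
Proof.
have e (a : M) : mS a = mS 0 + a by rewrite maddSl madd0l.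
by rewrite (e x) (e y) mle_add2l.
Qed.

Lemma mS_inj x y : mS x = mS y -> x = y.
Proof.
by move=> e; apply: mle_anti; apply/mleSS; rewrite e; exact: mle_refl.
Qed.

Lemma mle_0 x : x <= 0 -> x = 0.
Proof. by move=> x0; apply: mle_anti x0 (mle0 _). Qed.

Lemma mS_neq0 x : mS x <> 0.
Proof. by move=> e; apply: (@mle_ltF 0 x (mle0 x)); rewrite e; exact: mle0. Qed.

Lemma mlt0 x : x <> 0 -> 0 < x.
Proof. by move=> ne; apply/mlt_neqAle; split; [exact: mle0 | exact/nesym]. Qed.

Lemma mle_add x y z w : x <= z -> y <= w -> x + y <= z + w.
Proof.
move=> xz yw; apply: (@mle_trans (x + w)); first exact/mle_add2l.
by rewrite !(maddC _ w); apply/mle_add2l.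
Qed.

Lemma mle_addl x y : x <= y + x.
Proof. by rewrite maddC; exact: mle_addr. Qed.

Lemma maddI x y z : x + y = x + z -> y = z.
Proof.
by move=> e; apply: mle_anti; apply/(mle_add2l x); rewrite e; exact: mle_refl.
Qed.

Lemma mle_mul x y z w : x <= z -> y <= w -> x * y <= z * w.
Proof.
have main (a b c : M) : b <= c -> a * b <= a * c.
  move=> bc; have [->|/mlt0 a0] := pselect (a = 0).
    by rewrite !(mmulC 0) !mmul0; exact: mle_refl.
  exact/(mle_mul2l _ _ a0).
move=> xz yw; apply: mle_trans (main _ _ _ yw) _.
by rewrite !(mmulC _ w); apply: main.
Qed.

Lemma mhalfP x : x = mhalf x + mhalf x \/ x = mS (mhalf x + mhalf x).
Proof. by have [/(_ erefl)] := mhalf_def (mhalf x) x; rewrite mmul2 => -[]; auto. Qed.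

Lemma mhalf_double x : mhalf (x + x) = x.
Proof. by apply/esym/mhalf_def; rewrite mmul2; left. Qed.

Lemma mhalf_doubleS x : mhalf (mS (x + x)) = x.
Proof. by apply/esym/mhalf_def; rewrite mmul2; right. Qed.

Lemma mhalf0 : mhalf 0 = 0.
Proof. by rewrite -[X in mhalf X](madd0 0) mhalf_double. Qed.

Lemma mhalf_le x : mhalf x <= x.
Proof.
by case: (mhalfP x) => {2}->; [|apply: mle_S]; exact: mle_addr.
Qed.

Lemma mlen_eq0 x : mlen x = 0 -> x = 0.
Proof.
move=> l0; apply: contrapT => /mlen_half; rewrite l0 => /esym; exact: mS_neq0.
Qed.

Lemma mlen_doubleS x : mlen (mS (x + x)) = mS (mlen x).
Proof.
by have := @mlen_half (mS (x + x)) (@mS_neq0 _); rewrite mhalf_doubleS.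
Qed.

Lemma mlen_double_le x : mlen (x + x) <= mS (mlen x).
Proof. by rewrite -mlen_doubleS; apply: mlen_le; exact: mle_succ. Qed.

Lemma mlen_leD x y : mlen x <= mlen y -> x <= y + y.
Proof.
move=> xy; case: (mleP x (y + y)) => // /mlen_le; rewrite mlen_doubleS => yx.
by case: (mle_ltF xy).
Qed.

Lemma fint_proj n (i : 'I_n) (v : 'I_n -> M) : fint (Proj i) v = v i.
Proof. exact: (pv_models (PV_proj i) v). Qed.

Lemma fint_comp m n (f : sym m) (g : 'I_m -> sym n) (v : 'I_n -> M) :
  fint (Comp f g) v = fint f (fun j => fint (g j) v).
Proof. exact: (pv_models (PV_comp f g) v). Qed.

Definition mmin (r s t : M) : Prop := (s <= t -> r = s) /\ (t <= s -> r = t).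

Lemma mmin_le r s t : mmin r s t -> r <= t.
Proof.
move=> [h1 h2]; case: (mle_total t s) => [st|ts].
  by rewrite (h1 st).
by rewrite (h2 ts); exact: mle_refl.
Qed.

Section Rec.
Variables (n : nat) (g : sym n) (h0 h1 : sym n.+2) (k : sym n.+1).
Let R := Rec g h0 h1 k.

Lemma fint_rec0 (v : 'I_n -> M) :
  mmin (fint R (tcons 0 v)) (fint g v) (fint k (tcons 0 v)).
Proof.
by have := pv_models (PV_rec0 g h0 h1 k) v; rewrite /= !eval_tcons evalE.
Qed.

Lemma fint_rec_even x (v : 'I_n -> M) : x <> 0 ->
  mmin (fint R (tcons (x + x) v))
    (fint h0 (tcons x (tcons (fint R (tcons x v)) v))) (fint k (tcons (x + x) v)).
Proof.
have := pv_models (PV_rec_even g h0 h1 k) (tcons x v).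
by rewrite /= !eval_tcons ?evalE mmul2 /= !eval_tcons !eval_wk ?eval_tnil.
Qed.

Lemma fint_rec_odd x (v : 'I_n -> M) :
  mmin (fint R (tcons (mS (x + x)) v))
    (fint h1 (tcons x (tcons (fint R (tcons x v)) v)))
    (fint k (tcons (mS (x + x)) v)).
Proof.
have := pv_models (PV_rec_odd g h0 h1 k) (tcons x v).
by rewrite /= !eval_tcons ?evalE mmul2 /= !eval_tcons !eval_wk ?eval_tnil.
Qed.

Lemma fint_rec_le (v : 'I_n.+1 -> M) : fint R v <= fint k v.
Proof.
rewrite -[v]tconsK; move: (v ord0) (fun i => v _) => x w {v}.
case: (mhalfP x) => ->; last exact: mmin_le (fint_rec_odd _ _).
(* The even equation excludes 0, so the double of 0 falls under the initial case of the
   recursion. *)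
have [->|x0] := pselect (mhalf x = 0); last exact: mmin_le (fint_rec_even _ x0).
by rewrite madd0; exact: mmin_le (fint_rec0 _).
Qed.

End Rec.

End Arith.

Lemma pv_complete n (A : form n) :
  (forall (M : PVmodel) (rho : 'I_n -> M), sat A rho) -> proves PV A.
Proof. by move=> valA; apply: completeness => M MPV; exact: (valA (Build_PVmodel MPV)). Qed.

Lemma pv_sound n (A : form n) : proves PV A ->
  forall (M : PVmodel) (rho : 'I_n -> M), sat A rho.
Proof. by move=> prA M rho; apply: (soundness (@pv_models M) prA). Qed.

(** Induction in [PV] is a rule on theorems. The premisses therefore range over all models, and
    completeness turns them into the derivations that the rule demands. *)
Lemma pv_induct n (A : form n.+1) : qf A ->
  (forall (M : PVmodel) (rho : 'I_n -> M), sat A (tcons (m0 M) rho)) ->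
  (forall (M : PVmodel) (rho : 'I_n -> M) x,
     sat A (tcons (mhalf x) rho) -> sat A (tcons x rho)) ->
  forall (M : PVmodel) (rho : 'I_n -> M) x, sat A (tcons x rho).
Proof.
move=> qfA A0 AS M rho x; apply: (@pv_models M); apply: PV_induct => //.
  by apply: pv_complete => M' mu; rewrite sat_inst evalE.
apply: pv_complete => M' mu; rewrite -(tconsK mu) /= sat_repl evalE; exact: AS.
Qed.

(** * Two functions defined by limited recursion: predecessor and iterated halving *)

Section Functions.
Local Open Scope model_scope.

Lemma fintE1 (M : PVmodel) (f : sym 1) n (g : 'I_1 -> sym n) (v : 'I_n -> M) :
  fint f (fun j => fint (g j) v) = fint f (tcons (fint (g ord0) v) tnil).
Proof. by congr fint; apply: tconsP => // -[]. Qed.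

Lemma fintE2 (M : PVmodel) (f : sym 2) n (g : 'I_2 -> sym n) (v : 'I_n -> M) :
  fint f (fun j => fint (g j) v) =
  fint f (tcons (fint (g ord0) v) (tcons (fint (g (lift ord0 ord0)) v) tnil)).
Proof. by congr fint; apply: tconsP => //; elim/ordS_ind => [|[]]. Qed.

(** Predecessor by recursion on notation: pred(2x) = 2 pred(x) + 1 and pred(2x+1) = 2x, limited by
    the argument. It supplies the fact that every nonzero element is a successor, on which the case
    analyses on clock values rest. *)
Definition Pred_even : sym 2 :=
  Comp Succ (fun _ : 'I_1 => Comp Add (fun _ : 'I_2 => Proj (lift ord0 ord0))).
Definition Pred_odd : sym 2 := Comp Add (fun _ : 'I_2 => Proj ord0).
Definition Pred : sym 1 := Rec Zero Pred_even Pred_odd (Proj ord0).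

Definition mpred (M : PVmodel) (x : M) : M := fint Pred (tcons x tnil).

Lemma mpred_odd (M : PVmodel) (x : M) : mpred (mS (x + x)) = x + x.
Proof.
have [h _] : mmin (mpred (mS (x + x))) (fint Pred_odd (tcons x (tcons (mpred x) tnil)))
    (fint (Proj ord0) (tcons (mS (x + x)) tnil)) by exact: fint_rec_odd.
by move: h; rewrite fint_comp fintE2 !fint_proj; apply; exact: mle_succ.
Qed.

Lemma mpred_even (M : PVmodel) (x : M) : x <> m0 M -> mS (mpred x) = x ->
  mpred (x + x) = mS (mpred x + mpred x).
Proof.
move=> x_neq0 Sx.
have [h _] : mmin (mpred (x + x)) (fint Pred_even (tcons x (tcons (mpred x) tnil)))
    (fint (Proj ord0) (tcons (x + x) tnil)) by exact: fint_rec_even.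
move: h; rewrite fint_comp fintE1 fint_comp fintE2 !fint_proj tconsS; apply.
by rewrite -[X in _ <= X + _]Sx -[X in _ <= _ + X]Sx maddSl maddS; exact: mle_succ.
Qed.

Lemma mpredK (M : PVmodel) (x : M) : x <> m0 M -> mS (mpred x) = x.
Proof.
pose A : form 1 := Imp (Imp (Eq x0 t0) Bot)
  (Eq (tS (App Pred (tcons x0 tnil))) x0).
have satA (M' : PVmodel) (y : M') : sat A (tcons y tnil) =
    (y <> m0 M' -> mS (mpred y) = y).
  by rewrite /A /= !eval_tcons /= !eval_tcons !eval_tnil.
rewrite -satA; apply: pv_induct => {M x} // M rho => [|x]; rewrite (tnilP rho) !satA //.
move=> IH x_neq0; case: (mhalfP x) => xE; rewrite xE; last by rewrite mpred_odd.
have h0 : mhalf x <> m0 M by move=> h0; apply: x_neq0; rewrite xE h0 madd0.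
by rewrite mpred_even ?IH // -maddS -maddSl IH.
Qed.

Lemma m_predP (M : PVmodel) (x : M) : x <> m0 M -> exists y, x = mS y.
Proof. by move/mpredK => <-; exists (mpred x). Qed.

(* [mshift z x] is [x] halved [|z|] times. *)
Definition Shift_step : sym 3 := Comp Half (fun _ : 'I_1 => Proj (lift ord0 ord0)).
Definition Shift : sym 2 :=
  Rec (Proj ord0) Shift_step Shift_step (Proj (lift ord0 ord0)).

Definition mshift (M : PVmodel) (z x : M) : M := fint Shift (tcons z (tcons x tnil)).

Lemma mshift_le (M : PVmodel) (z x : M) : mshift z x <= x.
Proof.
have : mshift z x <= fint (Proj (lift ord0 ord0)) (tcons z (tcons x tnil)).
  exact: fint_rec_le.
by rewrite fint_proj tconsS.
Qed.

Lemma mshift0 (M : PVmodel) (x : M) : mshift (m0 M) x = x.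
Proof.
have [h _] : mmin (mshift (m0 M) x) (fint (Proj ord0) (tcons x tnil))
    (fint (Proj (lift ord0 ord0)) (tcons (m0 M) (tcons x tnil))).
  exact: fint_rec0.
by move: h; rewrite !fint_proj tconsS; apply; exact: mle_refl.
Qed.

Lemma mshift_odd (M : PVmodel) (z x : M) :
  mshift (mS (z + z)) x = mhalf (mshift z x).
Proof.
have [h _] : mmin (mshift (mS (z + z)) x)
    (fint Shift_step (tcons z (tcons (mshift z x) (tcons x tnil))))
    (fint (Proj (lift ord0 ord0)) (tcons (mS (z + z)) (tcons x tnil))).
  exact: fint_rec_odd.
move: h; rewrite fint_comp fintE1 !fint_proj !tconsS; apply.
exact: mle_trans (mhalf_le _) (mshift_le _ _).
Qed.

Lemma mshift_even (M : PVmodel) (z x : M) : z <> m0 M ->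
  mshift (z + z) x = mhalf (mshift z x).
Proof.
move=> z0; have [h _] : mmin (mshift (z + z) x)
    (fint Shift_step (tcons z (tcons (mshift z x) (tcons x tnil))))
    (fint (Proj (lift ord0 ord0)) (tcons (z + z) (tcons x tnil))).
  exact: fint_rec_even.
move: h; rewrite fint_comp fintE1 !fint_proj !tconsS; apply.
exact: mle_trans (mhalf_le _) (mshift_le _ _).
Qed.

(** Each halving lowers the length by one until 0 is reached. Consequently a shift by some z with
    |z| = |x| yields 0, the starting point of length induction. *)
Lemma mlen_mshift (M : PVmodel) (z x : M) :
  mshift z x = m0 M \/ mlen (mshift z x) + mlen z = mlen x.
Proof.
pose y : term 2 := Var (lift ord0 ord0).
pose A : form 2 := Or (Eq (App Shift (tcons x0 (tcons y tnil))) t0)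
  (Eq (tadd (len (App Shift (tcons x0 (tcons y tnil)))) (len x0)) (len y)).
have satA (M' : PVmodel) (rho : 'I_1 -> M') w : sat A (tcons w rho) =
    (mshift w (rho ord0) = m0 M' \/
     mlen (mshift w (rho ord0)) + mlen w = mlen (rho ord0)).
  rewrite /A -[sat _ _]/(_ \/ _) /= !eval_tcons !eval_tnil /= !eval_tcons.
  by rewrite !eval_tnil /= !eval_tcons !eval_tnil /= tconsS.
suff : sat A (tcons z (tcons x tnil)) by rewrite satA.
apply: pv_induct => {M x z} // M rho => [|z]; rewrite !satA.
  by right; rewrite mshift0 mlen0 madd0.
move: (rho ord0) => x IH.
have [->|z0] := pselect (z = m0 M); first by right; rewrite mshift0 mlen0 madd0.
have -> : mshift z x = mhalf (mshift (mhalf z) x).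
  case: (mhalfP z) => zE; rewrite {1}zE; last exact: mshift_odd.
  by apply: mshift_even => h0; apply: z0; rewrite zE h0 madd0.
case: IH => [->|IH]; first by left; exact: mhalf0.
have [->|s0] := pselect (mshift (mhalf z) x = m0 M); first by left; exact: mhalf0.
by right; rewrite -IH (mlen_half z0) (mlen_half s0) maddS maddSl.
Qed.
End Functions.

(** * Polynomial bounds *)

Section Bounds.
Local Open Scope model_scope.

Lemma mlen_le_id (M : PVmodel) (x : M) : mlen x <= x.
Proof.
pose A : form 1 := Le (len x0) x0.
have satA (M' : PVmodel) (y : M') : sat A (tcons y tnil) = (mlen y <= y).
  by rewrite /A /= !eval_tcons !eval_tnil.
rewrite -satA; apply: pv_induct => {M x} // M rho => [|x]; rewrite (tnilP rho) !satA.
  by rewrite mlen0; exact: mle_refl.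
move=> IH; have [->|x_neq0] := pselect (x = m0 M).
  by rewrite mlen0; exact: mle_refl.
rewrite (mlen_half x_neq0); have /mleSS/mle_trans := IH; apply.
case: (mhalfP x) => xE; rewrite [X in _ <= X]xE.
  have h0 : mhalf x <> m0 M by move=> h0; apply: x_neq0; rewrite xE h0 madd0.
  by rewrite -[X in mS X]madd0 -maddS; apply/mle_add2l/mlt0.
by apply/mleSS; exact: mle_addr.
Qed.

Lemma mlen_add (M : PVmodel) (x y : M) : mlen (x + y) <= mS (mlen x + mlen y).
Proof.
case: (mle_total x y) => xy.
  apply: mle_trans (mlen_le (mle_add (mle_refl x) xy)) _.
  apply: mle_trans (mlen_double_le _) _; apply/mleSS; exact: mle_addr.
apply: mle_trans (mlen_le (mle_add xy (mle_refl y))) _.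
apply: mle_trans (mlen_double_le _) _; apply/mleSS; exact: mle_addl.
Qed.

(** The successor makes the induction on notation work: with h the half of x, x + 1 <= 2(h + 1), so
    passing from h to x costs a single doubling. *)
Lemma mlen_mulS (M : PVmodel) (x y : M) :
  mlen (mS x * y) <= mS (mlen x + mlen y).
Proof.
pose v : term 2 := Var (lift ord0 ord0).
pose A : form 2 := Le (len (tmul (tS x0) v)) (tS (tadd (len x0) (len v))).
have satA (M' : PVmodel) (rho : 'I_1 -> M') w : sat A (tcons w rho) =
    (mlen (mS w * rho ord0) <= mS (mlen w + mlen (rho ord0))).
  by rewrite /A -[sat _ _]/(leint _ _) !evalE /= tconsS.
suff : sat A (tcons x (tcons y tnil)) by rewrite satA.
apply: pv_induct => {M x y} // M rho => [|x]; rewrite !satA; move: (rho ord0) => y.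
  by rewrite mmulSl mmulC mmul0 madd0l mlen0 madd0l; exact: mle_succ.
move=> IH; have [->|x_neq0] := pselect (x = m0 M).
  by rewrite mmulSl mmulC mmul0 madd0l mlen0 madd0l; exact: mle_succ.
rewrite (mlen_half x_neq0) maddSl; have /mleSS := IH; apply: mle_trans.
apply: mle_trans (mlen_double_le _); apply: mlen_le.
rewrite !(mmulC _ y) -mmulDr; apply: mle_mul; first exact: mle_refl.
rewrite maddSl maddS; apply/mleSS.
case: (mhalfP x) => xE; rewrite [X in X <= _]xE; last exact: mle_refl.
exact: mle_succ.
Qed.

Lemma mlen_mul (M : PVmodel) (x y : M) : mlen (x * y) <= mS (mlen x + mlen y).
Proof.
apply: mle_trans (mlen_mulS x y); apply: mlen_le.
exact: mle_mul (mle_succ x) (mle_refl y).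
Qed.

(** [P] relates an assignment to one obtained from it; the two uses are applying a substitution and
    adjoining an element below a term. The bounds must be uniform in all models. *)
Definition poly_bounded n m (P : forall M : PVmodel, ('I_n -> M) -> ('I_m -> M) -> Prop) :=
  forall i, exists2 q, len_poly q & forall (M : PVmodel) (rho : 'I_n -> M) v,
    P M rho v -> mlen (v i) <= eval rho q.

Lemma len_poly_bound n m P (q : term m) : @poly_bounded n m P -> len_poly q ->
  exists2 r, len_poly r & forall (M : PVmodel) (rho : 'I_n -> M) v,
    P M rho v -> eval v q <= eval rho r.
Proof.
move=> bP; elim => [|{}q _ [r pr rP]|i|p1 q1 _ [r1 pr1 rP1] _ [r2 pr2 rP2]
  |p1 q1 _ [r1 pr1 rP1] _ [r2 pr2 rP2]].
- exists t0; first exact: len_poly0.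
  by move=> M rho v _; rewrite !evalE; exact: mle_refl.
- exists (tS r); first exact: len_polyS.
  by move=> M rho v /rP; rewrite !evalE => /mleSS.
- have [r pr rP] := bP i; exists r => // M rho v /rP.
  by rewrite evalE.
- exists (tadd r1 r2); first exact: len_polyD.
  by move=> M rho v Pv; rewrite !evalE; apply: mle_add; [exact: rP1 | exact: rP2].
- exists (tmul r1 r2); first exact: len_polyM.
  by move=> M rho v Pv; rewrite !evalE; apply: mle_mul; [exact: rP1 | exact: rP2].
Qed.

(** For [Rec] the built-in limit [k] bounds the value outright, so no analysis of the recursion is
    required. *)
Lemma sym_bound m (f : sym m) : exists2 q, len_poly q &
  forall (M : PVmodel) (v : 'I_m -> M), mlen (fint f v) <= eval v q.
Proof.
have E1 (M : PVmodel) (v : 'I_1 -> M) : tcons (v ord0) tnil = v.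
  by apply/esym/tconsP => // -[].
have E2 (M : PVmodel) (v : 'I_2 -> M) :
    tcons (v ord0) (tcons (v (lift ord0 ord0)) tnil) = v.
  by apply/esym/tconsP => //; elim/ordS_ind => [|[]].
pose x m' : term m'.+1 := len x0.
pose y : term 2 := len (Var (lift ord0 ord0)).
have px m' : len_poly (x m') by exact: len_polyX.
have py : len_poly y by exact: len_polyX.
elim: f => {m}.
- exists t0; first exact: len_poly0.
  move=> M v; rewrite (tnilP v) -/(m0 M) mlen0; exact: mle0.
- exists (tS (x 0)); first exact/len_polyS.
  move=> M v; rewrite -{1}(E1 M v) !evalE -/(mS _).
  by rewrite -mlen_doubleS; apply: mlen_le; apply/mleSS; exact: mle_addr.
- exists (x 0) => // M v; rewrite -{1}(E1 M v) !evalE.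
  exact: mlen_le (mhalf_le _).
- exists (x 0) => // M v; rewrite -{1}(E1 M v) !evalE.
  exact: mlen_le (mlen_le_id _).
- exists (tS (tadd (x 1) y)); first exact/len_polyS/len_polyD.
  by move=> M v; rewrite -{1}(E2 M v) !evalE; exact: mlen_add.
- exists (tS (tadd (x 1) y)); first exact/len_polyS/len_polyD.
  by move=> M v; rewrite -{1}(E2 M v) !evalE; exact: mlen_mul.
- exists (tS (tmul (x 1) y)); first exact/len_polyS/len_polyM.
  by move=> M v; rewrite -{1}(E2 M v) !evalE -/(msmash _ _) mlen_smash; exact: mle_refl.
- move=> n i; exists (len (Var i)); first exact: len_polyX.
  by move=> M v; rewrite fint_proj evalE; exact: mle_refl.
- move=> m n f [q pq qP] g IHg.
  have [|r pr rP] := @len_poly_bound n m (fun M v w => w = fun j => fint (g j) v) q _ pq.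
    by move=> j; have [r pr rP] := IHg j; exists r => // M rho v ->.
  exists r => // M v; rewrite fint_comp; apply: mle_trans (qP _ _) _.
  exact: rP.
- move=> n g _ h0 _ h1 _ k [q pq qP]; exists q => // M v.
  exact: mle_trans (mlen_le (fint_rec_le _ _ _ _ _)) (qP _ _).
Qed.

Lemma term_bound n m P (s : term m) : @poly_bounded n m P ->
  exists2 r, len_poly r & forall (M : PVmodel) (rho : 'I_n -> M) v,
    P M rho v -> mlen (eval v s) <= eval rho r.
Proof.
move=> bP; elim: s => [i|p f ts IH]; first exact: bP.
have [q pq qP] := sym_bound f.
pose P' (M : PVmodel) (rho : 'I_n -> M) (w : 'I_p -> M) :=
  exists2 v, P M rho v & w = fun j => eval v (ts j).
have [|r pr rP] := @len_poly_bound n p P' q _ pq.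
  by move=> j; have [r pr rP] := IH j; exists r => // M rho w [v Pv ->]; exact: rP.
exists r => // M rho v Pv; apply: mle_trans (qP _ _) _; apply: rP.
by exists v.
Qed.

Lemma poly_bounded_id n : @poly_bounded n n (fun M rho v => v = rho).
Proof.
move=> i; exists (len (Var i)); first exact: len_polyX.
by move=> M rho v ->; rewrite evalE; exact: mle_refl.
Qed.

Lemma poly_bounded_tsubst n m (sg : 'I_m -> term n) :
  @poly_bounded n m (fun M rho v => v = fun i => eval rho (sg i)).
Proof.
move=> i; have [r pr rP] := term_bound (sg i) (@poly_bounded_id n).
by exists r => // M rho v ->; exact: rP.
Qed.

Lemma poly_bounded_le n (t : term n) :
  @poly_bounded n n.+1 (fun M rho v => exists2 y, y <= eval rho t & v = tcons y rho).
Proof.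
elim/ordS_ind => [|i].
  have [r pr rP] := term_bound t (@poly_bounded_id n).
  exists r => // M rho v [y yt ->]; apply: mle_trans (mlen_le yt) _; exact: rP.
exists (len (Var i)); first exact: len_polyX.
by move=> M rho v [y _ ->]; rewrite tconsS evalE; exact: mle_refl.
Qed.

(** Lengths imitate polynomial arithmetic: 2Z + 1 adds one to the length, and smash multiplies
    lengths up to one. *)
Lemma len_poly_code n (q : term n) : len_poly q ->
  exists Z : term n, forall (M : PVmodel) (rho : 'I_n -> M),
    eval rho q <= mlen (eval rho Z).
Proof.
elim => [|{}q _ [Z ZP]|i|p1 q1 _ [Z1 ZP1] _ [Z2 ZP2]|p1 q1 _ [Z1 ZP1] _ [Z2 ZP2]].
- by exists t0 => M rho; rewrite evalE; exact: mle0.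
- exists (tS (tadd Z Z)) => M rho; rewrite !evalE mlen_doubleS; exact/mleSS.
- by exists (Var i) => M rho; rewrite evalE; exact: mle_refl.
(* For |Z1| = a and |Z2| = b this has length (a + 1)(b + 1) + 1, which exceeds a + b; the length of
   a sum of terms would not grow fast enough. *)
- exists (smash (tS (tadd Z1 Z1)) (tS (tadd Z2 Z2))) => M rho.
  rewrite !evalE mlen_smash !mlen_doubleS; apply: mle_S.
  apply: mle_trans (mle_add (ZP1 _ _) (ZP2 _ _)) _.
  move: (mlen _) (mlen _) => a b.
  rewrite mmulS maddS mmulSl maddC; apply: mle_S; apply: mle_add (mle_refl _).
  exact: mle_addl.
- exists (smash Z1 Z2) => M rho.
  rewrite !evalE mlen_smash; apply: mle_S; exact: mle_mul.
Qed.

(** The flag [b] distinguishes the polynomial calculus ([true], for [S2]) from the unrestricted one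
    ([false], for [T2]). *)
Definition lenOK (b : bool) n (t : term n) : Prop := b -> len_poly t.

(** Terms need not be monotone, so an arbitrary length is bounded through its own length: |t| <= q
    <= |Z| implies t <= 2Z. A polynomial length is monotone, and bounds are inserted for its
    arguments. *)
Lemma lenOK_bound b n m P (t : term m) : @poly_bounded n m P -> lenOK b t ->
  exists2 r, lenOK b r & forall (M : PVmodel) (rho : 'I_n -> M) v,
    P M rho v -> eval v t <= eval rho r.
Proof.
case: b => bP tOK.
  by have [r pr rP] := len_poly_bound bP (tOK isT); exists r.
have [q pq qP] := term_bound t bP.
have [Z ZP] := len_poly_code pq.
exists (tadd Z Z) => // M rho v Pv; rewrite evalE; apply: mlen_leD.
exact: mle_trans (qP _ _ _ Pv) (ZP _ _).
Qed.

End Bounds.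

(** * The bounded hierarchy *)

Scheme hSigma_mut := Minimality for hSigma Sort Prop
with hPi_mut := Minimality for hPi Sort Prop.
Combined Scheme hSigma_hPi_ind from hSigma_mut, hPi_mut.

Lemma fsubst_AllB n m (sg : 'I_n -> term m) t B :
  fsubst sg (AllB t B) = AllB (tsubst sg t) (fsubst (up sg) B).
Proof. by rewrite /AllB /= tsubst_up. Qed.

Lemma fsubst_ExB n m (sg : 'I_n -> term m) t B :
  fsubst sg (ExB t B) = ExB (tsubst sg t) (fsubst (up sg) B).
Proof. by rewrite /ExB /= tsubst_up. Qed.

Lemma sat_AllB (M : structure) n (t : term n) B (rho : 'I_n -> M) :
  sat (AllB t B) rho <-> forall d, leint d (eval rho t) -> sat B (tcons d rho).
Proof.
by split=> h d; have := h d; rewrite /= eval_tshift.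
Qed.

Lemma sat_ExB (M : structure) n (t : term n) B (rho : 'I_n -> M) :
  sat (ExB t B) rho <-> exists2 d, leint d (eval rho t) & sat B (tcons d rho).
Proof.
split=> [[d] /= [] | [d dt Bd]]; first by rewrite eval_tshift => dt Bd; exists d.
by exists d; split=> //=; rewrite eval_tshift.
Qed.

Lemma qf_fsubst n (A : form n) m (sg : 'I_n -> term m) : qf (fsubst sg A) = qf A.
Proof.
by elim: A m sg => //= {}n A IHA B IHB m sg; rewrite IHA IHB.
Qed.

Lemma hSigma_hPi_fsubst :
  (forall k n (A : form n), hSigma k A ->
     forall m (sg : 'I_n -> term m), hSigma k (fsubst sg A)) /\
  (forall k n (A : form n), hPi k A ->
     forall m (sg : 'I_n -> term m), hPi k (fsubst sg A)).
Proof.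
apply: hSigma_hPi_ind; intros; rewrite ?fsubst_AllB ?fsubst_ExB /=;
by [ apply: hSigma_qf; rewrite qf_fsubst | apply: hSigma_up; auto
   | apply: hSigma_and; auto | apply: hSigma_or; auto
   | apply: hSigma_ex; auto | apply: hSigma_ex_hPi; auto
   | apply: hPi_qf; rewrite qf_fsubst | apply: hPi_up; auto
   | apply: hPi_and; auto | apply: hPi_or; auto
   | apply: hPi_all; auto | apply: hPi_all_hSigma; auto ].
Qed.

(** The classes are not syntactically closed under negation; de Morgan's laws give a dual formula
    that is equivalent in every structure. *)
Lemma hSigma_hPi_neg :
  (forall k n (A : form n), hSigma k A -> exists2 A', hPi k A' &
     forall (M : structure) (rho : 'I_n -> M), sat A' rho <-> ~ sat A rho) /\
  (forall k n (A : form n), hPi k A -> exists2 A', hSigma k A' &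
     forall (M : structure) (rho : 'I_n -> M), sat A' rho <-> ~ sat A rho).
Proof.
apply: hSigma_hPi_ind.
- by move=> n A qfA; exists (Imp A Bot) => //; apply: hPi_qf; rewrite /= qfA.
- by move=> k n A _ [A' pA' A'P]; exists A' => //; apply: hPi_up.
- move=> k n A B _ [A' pA' A'P] _ [B' pB' B'P].
  exists (Or A' B') => [|M rho]; first exact: hPi_or.
  by rewrite /= A'P B'P not_andP.
- move=> k n A B _ [A' pA' A'P] _ [B' pB' B'P].
  exists (And A' B') => [|M rho]; first exact: hPi_and.
  by rewrite /= A'P B'P not_orP.
- move=> k n t B _ [B' pB' B'P]; exists (AllB t B') => [|M rho]; first exact: hPi_all.
  rewrite sat_AllB sat_ExB; split=> [h [d dt Bd]|h d dt]; first exact/(B'P _ _).1/Bd/h.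
  by apply/B'P => Bd; apply: h; exists d.
- move=> k n t B _ [B' pB' B'P]; exists (AllB t B') => [|M rho]; first exact: hPi_all_hSigma.
  rewrite sat_AllB sat_ExB; split=> [h [d dt Bd]|h d dt]; first exact/(B'P _ _).1/Bd/h.
  by apply/B'P => Bd; apply: h; exists d.
- by move=> n A qfA; exists (Imp A Bot) => //; apply: hSigma_qf; rewrite /= qfA.
- by move=> k n A _ [A' pA' A'P]; exists A' => //; apply: hSigma_up.
- move=> k n A B _ [A' pA' A'P] _ [B' pB' B'P].
  exists (Or A' B') => [|M rho]; first exact: hSigma_or.
  by rewrite /= A'P B'P not_andP.
- move=> k n A B _ [A' pA' A'P] _ [B' pB' B'P].
  exists (And A' B') => [|M rho]; first exact: hSigma_and.
  by rewrite /= A'P B'P not_orP.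
- move=> k n t B _ [B' pB' B'P]; exists (ExB t B') => [|M rho]; first exact: hSigma_ex.
  rewrite sat_AllB sat_ExB; split=> [[d dt /B'P nB] h|h]; first exact/nB/h.
  apply: contrapT => nE; apply: h => d dt; apply: contrapT => nB.
  by apply: nE; exists d => //; apply/B'P.
- move=> k n t B _ [B' pB' B'P]; exists (ExB t B') => [|M rho]; first exact: hSigma_ex_hPi.
  rewrite sat_AllB sat_ExB; split=> [[d dt /B'P nB] h|h]; first exact/nB/h.
  apply: contrapT => nE; apply: h => d dt; apply: contrapT => nB.
  by apply: nE; exists d => //; apply/B'P.
Qed.

Lemma hPi_mono j k n (A : form n) : j <= k -> hPi j A -> hPi k A.
Proof. by move=> /subnK <-; elim: (k - j) => // i IH /IH; apply: hPi_up. Qed.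

Lemma hPi_qf_any k n (A : form n) : qf A -> hPi k A.
Proof. by move=> qfA; apply: hPi_mono (hPi_qf qfA). Qed.

(** * Predicates definable by [hPi k] formulas uniformly in all models of PV *)

Definition spred n := forall M : PVmodel, ('I_n -> M) -> Prop.

(** Definability up to equivalence allows running formulas to be described by what they mean,
    without regard to their syntactic form. *)
Definition PiDef k n (P : spred n) : Prop :=
  exists2 A : form n, hPi k A & forall (M : PVmodel) rho, P M rho <-> sat A rho.

Section PiDef.
Variable k : nat.
Hypothesis k_gt0 : 0 < k.

Lemma PiDef_ext n (P Q : spred n) :
  (forall (M : PVmodel) rho, P M rho <-> Q M rho) -> PiDef k P -> PiDef k Q.
Proof. by move=> PQ [A pA AP]; exists A => // M rho; rewrite -PQ. Qed.

Lemma PiDef_qf n (A : form n) : qf A -> PiDef k (fun M : PVmodel => @sat M n A).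
Proof. by move=> qfA; exists A => //; apply: hPi_qf_any. Qed.

Lemma PiDef_hPi n (A : form n) j : j <= k -> hPi j A ->
  PiDef k (fun M : PVmodel => @sat M n A).
Proof. by move=> jk pA; exists A => //; apply: hPi_mono pA. Qed.

Lemma PiDef_hSigma n (A : form n) j : j < k -> hSigma j A ->
  PiDef k (fun M : PVmodel => @sat M n A).
Proof.
(* A dummy quantifier bounded by 0 lifts a [hSigma] formula into the next [hPi] class, which
   contains it only up to equivalence. *)
move=> jk sA; exists (AllB t0 (fshift A)) => [|M rho].
  by apply: hPi_mono jk _; apply: hPi_all_hSigma; apply: hSigma_hPi_fsubst.1.
rewrite sat_AllB; split=> [satA d _|]; first by rewrite sat_fshift.
by move/(_ (m0 M)); rewrite sat_fshift; apply; exact: mle0.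
Qed.

Lemma PiDef_neg_hSigma n (A : form n) j : j < k -> hSigma j A ->
  PiDef k (fun M : PVmodel => fun rho => ~ @sat M n A rho).
Proof.
move=> jk /hSigma_hPi_neg.1 [A' pA' A'P]; exists A' => [|M rho].
  by apply: hPi_mono pA'; apply: ltnW.
by rewrite A'P.
Qed.

Lemma PiDef_and n (P Q : spred n) : PiDef k P -> PiDef k Q ->
  PiDef k (fun M rho => P M rho /\ Q M rho).
Proof.
move=> [A pA AP] [B pB BP]; exists (And A B) => [|M rho]; first exact: hPi_and.
by rewrite AP BP.
Qed.

Lemma PiDef_or n (P Q : spred n) : PiDef k P -> PiDef k Q ->
  PiDef k (fun M rho => P M rho \/ Q M rho).
Proof.
move=> [A pA AP] [B pB BP]; exists (Or A B) => [|M rho]; first exact: hPi_or.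
by rewrite AP BP.
Qed.

Lemma PiDef_imp n (A : form n) (Q : spred n) : qf A -> PiDef k Q ->
  PiDef k (fun M rho => sat A rho -> Q M rho).
Proof.
move=> qfA pQ; apply: PiDef_ext (PiDef_or (@PiDef_qf _ (Imp A Bot) _) pQ) => [M rho|].
  split=> [[nA /nA|]|AQ] //.
  by have [/AQ|] := pselect (sat A rho); [right | left].
by rewrite /= qfA.
Qed.

Lemma PiDef_all n (t : term n) (P : spred n.+1) : PiDef k P ->
  PiDef k (fun M rho => forall d, leint d (eval rho t) -> P M (tcons d rho)).
Proof.
move=> [A pA AP]; exists (AllB t A) => [|M rho].
  by case: k k_gt0 pA => // j _; apply: hPi_all.
by rewrite sat_AllB; split=> h d /h /AP.
Qed.

Lemma PiDef_subst n m (sg : 'I_n -> term m) (P : spred n) : PiDef k P ->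
  PiDef k (fun M rho => P M (fun i => eval rho (sg i))).
Proof.
move=> [A pA AP]; exists (fsubst sg A) => [|M rho]; first exact: hSigma_hPi_fsubst.2.
by rewrite sat_fsubst.
Qed.

Lemma PiDef_shift n (P : spred n) : PiDef k P ->
  PiDef k (fun M (rho : 'I_n.+1 -> M) => P M (fun i => rho (lift ord0 i))).
Proof. exact: (PiDef_subst wk). Qed.

(** * The calculus of flows *)

Local Open Scope model_scope.
Variable b : bool.

(* A flow that may be continued beyond its length [t], so that lengths can be
   increased at will. *)
Definition Flow n (P Q : spred n) : Prop :=
  exists (H : spred n.+1) (t : term n), [/\ PiDef k H, lenOK b t &
    forall (M : PVmodel) (rho : 'I_n -> M),
    [/\ P M rho -> H M (tcons (m0 M) rho),
        (forall u, H M (tcons u rho) -> H M (tcons (mS u) rho)) &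
        forall u, eval rho t <= u -> H M (tcons u rho) -> Q M rho]].

Lemma lenOK_0 n : lenOK b (@t0 n).
Proof. by move=> _; exact: len_poly0. Qed.

Lemma lenOK_S n (t : term n) : lenOK b t -> lenOK b (tS t).
Proof. by move=> tOK /tOK; exact: len_polyS. Qed.

Lemma lenOK_add n (s t : term n) : lenOK b s -> lenOK b t -> lenOK b (tadd s t).
Proof. by move=> sOK tOK bT; apply: len_polyD; [apply: sOK | apply: tOK]. Qed.

Lemma lenOK_mul n (s t : term n) : lenOK b s -> lenOK b t -> lenOK b (tmul s t).
Proof. by move=> sOK tOK bT; apply: len_polyM; [apply: sOK | apply: tOK]. Qed.

Lemma eval_tshiftE (M : structure) n (t : term n) (rho : 'I_n.+1 -> M) :
  eval rho (tshift t) = eval (fun i => rho (lift ord0 i)) t.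
Proof. by rewrite /tshift eval_tsubst. Qed.

(** A flow of exact length [t] becomes open-ended by running [H] up to [t] and holding [Q]
    afterwards. The larger [r] is announced as length because [t] may fail to be a polynomial in the
    lengths of the variables. *)
Lemma flow_intro n (P Q : spred n) (H : spred n.+1) (t r : term n) :
  PiDef k Q -> PiDef k H -> lenOK b r ->
  (forall (M : PVmodel) (rho : 'I_n -> M), eval rho t <= eval rho r) ->
  (forall (M : PVmodel) (rho : 'I_n -> M), [/\ P M rho -> H M (tcons (m0 M) rho),
    (forall u, u < eval rho t -> H M (tcons u rho) -> H M (tcons (mS u) rho)) &
    H M (tcons (eval rho t) rho) -> Q M rho]) -> Flow P Q.
Proof.
move=> pQ pH rOK tr HP.
pose A : form n.+1 := Le x0 (tshift t).
exists (fun M rho => (sat A rho -> H M rho) /\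
    (sat (Imp A Bot) rho -> Q M (fun i => rho (lift ord0 i)))), r; split=> //.
  by apply: PiDef_and; apply: PiDef_imp => //; exact: PiDef_shift.
move=> M rho; have [H0 HS Ht] := HP M rho.
have wkE u : (fun i => tcons u rho (lift ord0 i)) = rho.
  by apply/funext => i; rewrite tconsS.
have AE u : sat A (tcons u rho) = (u <= eval rho t) by rewrite /A /= eval_tshift.
have nAE u : sat (Imp A Bot) (tcons u rho) = ~ (u <= eval rho t).
  by rewrite /A /= eval_tshift.
split=> [/H0 h0|u|u].
- by split=> [//|]; rewrite nAE => /(_ (mle0 _)).
- rewrite !wkE !AE !nAE => -[h1 h2]; split=> [lt_u|nle_u].
    by apply: HS => //; apply: h1; exact: mltW.
  have [le_u|lt_u] := mleP u (eval rho t); last first.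
    by apply: h2 => /mle_ltF /(_ lt_u).
  have /mle_eqVlt [ut|//] := le_u.
  by apply: Ht; rewrite -ut; apply: h1.
- rewrite wkE AE nAE => /(mle_trans (tr _ _)) tu [h1 h2].
  have [le_u|lt_u] := mleP u (eval rho t); last first.
    by apply: h2 => /mle_ltF /(_ lt_u).
  by apply: Ht; rewrite (mle_anti tu le_u); apply: h1.
Qed.

Lemma flow_imp n (P Q : spred n) : PiDef k Q ->
  (forall (M : PVmodel) (rho : 'I_n -> M), P M rho -> Q M rho) -> Flow P Q.
Proof.
move=> pQ PQ; exists (fun M rho => Q M (fun i => rho (lift ord0 i))), t0.
split; [exact: PiDef_shift | exact: lenOK_0 | move=> M rho].
have wkE u : (fun i => tcons u rho (lift ord0 i)) = rho.
  by apply/funext => i; rewrite tconsS.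
by split=> [|u|u _]; rewrite !wkE //; exact: PQ.
Qed.

(** Times up to t1 run [H1], and time d + t1 + 1 runs [H2] at d; the extra tick between them passes
    through [Q]. Subtraction is avoided by quantifying over all d <= u with d + t1 + 1 = u. *)
Lemma flow_trans n (P Q R : spred n) : PiDef k R -> Flow P Q -> Flow Q R -> Flow P R.
Proof.
move=> pR [H1 [t1 [pH1 t1OK H1P]]] [H2 [t2 [pH2 t2OK H2P]]].
pose A : form n.+1 := Le x0 (tshift t1).
pose B : form n.+2 := Eq (tadd x0 (tS (tshift (tshift t1)))) (Var (lift ord0 ord0)).
pose sg : 'I_n.+1 -> term n.+2 := tcons x0 (fun i => Var (lift ord0 (lift ord0 i))).
apply: (@flow_intro _ _ _ (fun M rho => (sat A rho -> H1 M rho) /\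
    forall d, d <= eval rho x0 -> sat B (tcons d rho) ->
      H2 M (fun i => eval (tcons d rho) (sg i)))
  (tadd (tS t1) t2) (tadd (tS t1) t2)) => //.
- apply: PiDef_and; first exact: PiDef_imp.
  apply: (@PiDef_all _ x0 (fun M rho => sat B rho -> H2 M (fun i => eval rho (sg i)))).
  by apply: PiDef_imp => //; apply: PiDef_subst.
- by apply: lenOK_add => //; apply: lenOK_S.
- by move=> M rho; exact: mle_refl.
move=> M rho; have [P0 PS Pt] := H1P M rho; have [Q0 QS Qt] := H2P M rho.
have AE u : sat A (tcons u rho) = (u <= eval rho t1) by rewrite /A /= eval_tshift.
have BE u d : sat B (tcons d (tcons u rho)) = (d + mS (eval rho t1) = u).
  by rewrite /B -[sat _ _]/(_ = _) !evalE /= tconsS.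
have sgE u d : (fun i => eval (tcons d (tcons u rho)) (sg i)) = tcons d rho.
  by apply: tconsP => // i; rewrite /sg tconsS /= !tconsS.
split.
- move=> /P0 h0; split=> // d _; rewrite BE maddS => /mS_neq0 //.
- move=> u _ [h1 h2]; split=> [|d _].
    by rewrite AE => lt_u; apply: PS; apply: h1; rewrite AE; exact: mltW.
  rewrite BE sgE => dE.
  have [d0|/m_predP [e de]] := pselect (d = m0 M).
    move: dE; rewrite d0 madd0l => /mS_inj t1u; apply: Q0.
    by apply: (Pt u); [rewrite t1u; exact: mle_refl
      | apply: h1; rewrite AE t1u; exact: mle_refl].
  move: dE; rewrite de maddSl => /mS_inj eu; apply: QS; rewrite -(sgE u).
  by apply: h2; [rewrite /= -eu; exact: mle_addr | rewrite BE].
- move=> [_ h2]; apply: (Qt (eval rho t2)); first exact: mle_refl.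
  rewrite -(sgE (eval rho (tadd (tS t1) t2))); apply: h2.
    rewrite -[eval _ x0]/(eval rho (tadd (tS t1) t2)) evalE; exact: mle_addl.
  by rewrite BE !evalE maddC.
Qed.

Lemma flow_and n (P Q C : spred n) : PiDef k C -> Flow P Q ->
  Flow (fun M rho => P M rho /\ C M rho) (fun M rho => Q M rho /\ C M rho).
Proof.
move=> pC [H [t [pH tOK HP]]].
exists (fun M rho => H M rho /\ C M (fun i => rho (lift ord0 i))), t; split=> //.
  by apply: PiDef_and => //; exact: PiDef_shift.
move=> M rho; have [H0 HS Ht] := HP M rho.
have wkE u : (fun i => tcons u rho (lift ord0 i)) = rho.
  by apply/funext => i; rewrite tconsS.
by split=> [[/H0]|u|u tu]; rewrite !wkE // => -[Hu Cr]; split=> //;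
  [exact: HS | exact: Ht Hu].
Qed.

Lemma flow_or n (P Q C : spred n) : PiDef k C -> Flow P Q ->
  Flow (fun M rho => P M rho \/ C M rho) (fun M rho => Q M rho \/ C M rho).
Proof.
move=> pC [H [t [pH tOK HP]]].
exists (fun M rho => H M rho \/ C M (fun i => rho (lift ord0 i))), t; split=> //.
  by apply: PiDef_or => //; exact: PiDef_shift.
move=> M rho; have [H0 HS Ht] := HP M rho.
have wkE u : (fun i => tcons u rho (lift ord0 i)) = rho.
  by apply/funext => i; rewrite tconsS.
split=> [[/H0|]|u [/HS|]|u tu [/(Ht _ tu)|]]; rewrite ?wkE; by auto.
Qed.

(** Substituting into a polynomial in the lengths |x| destroys its form, so the length is replaced
    by a larger admissible one. *)
Lemma flow_subst n m (sg : 'I_n -> term m) (P Q : spred n) : Flow P Q ->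
  Flow (fun M rho => P M (fun i => eval rho (sg i)))
       (fun M rho => Q M (fun i => eval rho (sg i))).
Proof.
move=> [H [t [pH tOK HP]]].
have [r rOK rP] := lenOK_bound (poly_bounded_tsubst sg) tOK.
exists (fun M rho => H M (fun i => eval rho (up sg i))), r; split=> //.
  exact: PiDef_subst.
move=> M rho; have [H0 HS Ht] := HP M (fun i => eval rho (sg i)).
split=> [|u|u ru]; rewrite !eval_up; [exact: H0 | exact: HS |].
by apply: Ht; apply: mle_trans ru; exact: rP.
Qed.

(** The flows for all d <= t run in parallel under one bounded quantifier. They share a clock, so
    their lengths are first bounded independently of d. *)
Lemma flow_all n (t : term n) (P : spred n) (Q : spred n.+1) : PiDef k Q ->
  Flow (fun M rho => rho ord0 <= eval rho (tshift t) /\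
                     P M (fun i => rho (lift ord0 i))) Q ->
  Flow P (fun M rho => forall d, d <= eval rho t -> Q M (tcons d rho)).
Proof.
move=> pQ [H [s [pH sOK HP]]].
have [r rOK rP] := lenOK_bound (poly_bounded_le t) sOK.
pose sg : 'I_n.+2 -> term n.+2 :=
  tcons (Var (lift ord0 ord0)) (tcons x0 (fun i => Var (lift ord0 (lift ord0 i)))).
exists (fun M rho => forall d, d <= eval rho (tshift t) ->
  H M (fun i => eval (tcons d rho) (sg i))), r; split=> //.
  apply: (@PiDef_all _ _ (fun M rho => H M (fun i => eval rho (sg i)))).
  exact: PiDef_subst.
have sgE (M : PVmodel) (rho : 'I_n -> M) u d :
    (fun i => eval (tcons d (tcons u rho)) (sg i)) = tcons u (tcons d rho).
  apply: tconsP => [|i]; first by rewrite /= tconsS.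
  by elim/ordS_ind: i => [|i]; rewrite /sg !tconsS //= !tconsS.
have wkE (M : PVmodel) (rho : 'I_n -> M) u : (fun i => tcons u rho (lift ord0 i)) = rho.
  by apply/funext => i; rewrite tconsS.
move=> M rho; split=> [Pr d|u Hu d|u ru Hu d dt].
- rewrite eval_tshift sgE => dt; have [H0 _ _] := HP M (tcons d rho); apply: H0.
  by rewrite wkE eval_tshift.
- rewrite eval_tshift sgE => dt; have [_ HS _] := HP M (tcons d rho); apply: HS.
  by rewrite -sgE; apply: Hu; rewrite eval_tshift.
- have [_ _ Ht] := HP M (tcons d rho); apply: (Ht u).
    by apply: mle_trans ru; apply: rP; exists d.
  by rewrite -sgE; apply: Hu; rewrite eval_tshift.
Qed.

(* Time [w] of the composite flow is at time [u] of the [i]-th given flow, where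
   [w = i * (m + 1) + u] and [u <= m]. *)
Lemma flow_chain n (N r : term n) (D : spred n.+1) : PiDef k D -> lenOK b r ->
  (forall (M : PVmodel) (rho : 'I_n -> M), eval rho N <= eval rho r) ->
  Flow (fun M rho => rho ord0 < eval rho (tshift N) /\ D M rho)
       (fun M rho => D M (tcons (mS (rho ord0)) (fun i => rho (lift ord0 i)))) ->
  Flow (fun M rho => D M (tcons (m0 M) rho)) (fun M rho => D M (tcons (eval rho N) rho)).
Proof.
move=> pD rOK Nr [G [s [pG sOK GP]]].
have [m mOK mP] := lenOK_bound (poly_bounded_le N) sOK.
pose i : term n.+3 := Var (lift ord0 ord0).
pose w : term n.+3 := Var (lift ord0 (lift ord0 ord0)).
pose v (j : 'I_n) : term n.+3 := Var (lift ord0 (lift ord0 (lift ord0 j))).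
pose sh (t : term n) : term n.+3 := tshift (tshift (tshift t)).
pose B1 : form n.+3 := Eq w (tadd (tmul i (tS (sh m))) x0).
pose B2 : form n.+3 := Eq i (sh N).
pose B3 : form n.+3 := Le (tS i) (sh N).
(* The variables are (u, i, w). Division with remainder is replaced by quantifying over all i <= N
   and u <= m with w = i(m + 1) + u. At i = N no further flow is available, and [D] itself is
   kept. *)
pose K (M : PVmodel) (mu : 'I_n.+3 -> M) : Prop := sat B1 mu ->
  (sat B2 mu -> D M (fun j => eval mu (tcons i v j))) /\
  (sat B3 mu -> G M (fun j => eval mu (tcons x0 (tcons i v) j))).
have pK : PiDef k K.
  apply: PiDef_imp => //; apply: PiDef_and; apply: PiDef_imp => //;
  exact: PiDef_subst.
pose F (M : PVmodel) (mu : 'I_n.+1 -> M) : Prop := forall d, d <= eval mu (tshift N) ->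
  forall e, e <= eval (tcons d mu) (tshift (tshift m)) -> K M (tcons e (tcons d mu)).
have pF : PiDef k F.
  apply: (@PiDef_all _ _ (fun M mu => forall e, e <= eval mu (tshift (tshift m)) ->
    K M (tcons e mu))).
  exact: PiDef_all.
have KE (M : PVmodel) (rho : 'I_n -> M) x y z : K M (tcons x (tcons y (tcons z rho))) =
    (z = y * mS (eval rho m) + x ->
     (y = eval rho N -> D M (tcons y rho)) /\
     (y < eval rho N -> G M (tcons x (tcons y rho)))).
  have vE : (fun j => eval (tcons x (tcons y (tcons z rho))) (v j)) = rho.
    by apply/funext => j; rewrite /= !tconsS.
  rewrite /K /B1 /B2 /B3 !eval_tcons vE.
  rewrite -[sat (Eq w _) _]/(_ = _) -[sat (Eq i _) _]/(_ = _) -[sat (Le _ _) _]/(_ <= _).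
  by rewrite /sh !evalE /= !tconsS.
have FE (M : PVmodel) (rho : 'I_n -> M) z : F M (tcons z rho) =
    (forall y, y <= eval rho N -> forall x, x <= eval rho m ->
      z = y * mS (eval rho m) + x ->
     (y = eval rho N -> D M (tcons y rho)) /\
     (y < eval rho N -> G M (tcons x (tcons y rho)))).
  apply/propext; split=> h y yN x xm.
    by have := h y; rewrite eval_tshift => /(_ yN x); rewrite !eval_tshift KE => /(_ xm).
  by move: yN xm; rewrite !eval_tshift KE => yN; exact: h.
apply: (@flow_intro _ _ _ F (tmul N (tS m)) (tmul r (tS m))) => //.
- by apply: PiDef_ext (PiDef_subst (tcons N Var) pD) => M rho; rewrite eval_tcons.
- by apply: lenOK_mul => //; apply: lenOK_S.
- by move=> M rho; rewrite !evalE; apply: mle_mul (mle_refl _).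
move=> M rho; rewrite !evalE !FE.
(* A block shows the times 0 to m only; the tick into the next block takes the flow to time m + 1,
   which is beyond its length. *)
have stepD y x : y < eval rho N -> x = mS (eval rho m) ->
    G M (tcons x (tcons y rho)) -> D M (tcons (mS y) rho).
  move=> yN -> Gx; have [_ _ Gt] := GP M (tcons y rho).
  have -> : tcons (mS y) rho = tcons (mS (tcons y rho ord0))
      (fun i => tcons y rho (lift ord0 i)).
    by congr tcons; apply/funext => j; rewrite tconsS.
  apply: Gt Gx; apply: mle_S; apply: mP; exists y => //; exact: mltW.
have start y : y < eval rho N -> D M (tcons y rho) -> G M (tcons (m0 M) (tcons y rho)).
  move=> yN Dy; have [G0 _ _] := GP M (tcons y rho); apply: G0.
  by rewrite eval_tshift.
split.
- move=> D0 y yN x xm /esym e0.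
  have x_0 : x = m0 M by apply: mle_0; rewrite -e0; exact: mle_addl.
  have y_0 : y = m0 M.
    apply: mle_0; rewrite -e0 mmulS maddA; apply: mle_trans (mle_addl _ _).
    by rewrite maddC; exact: mle_addl.
  by rewrite y_0 x_0; split=> // yN'; apply: start.
- move=> z _; rewrite !FE => h y yN x xm zE.
  (* Either the new time lies inside a block, and the current flow advances, or it opens block y,
     and the flow of the preceding block has just delivered [D] at y. *)
  have [x_0|/m_predP [x' xE]] := pselect (x = m0 M); last first.
    have zE' : z = y * mS (eval rho m) + x'.
      by apply: mS_inj; rewrite zE xE maddS.
    have x'm : x' <= eval rho m by apply: mltW; rewrite -xE.
    have [h1 h2] := h y yN x' x'm zE'; split=> // lt_y; rewrite xE.
    by have [_ GS _] := GP M (tcons y rho); apply/GS/h2.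
  have [y_0|/m_predP [y' yE]] := pselect (y = m0 M).
    by move: zE; rewrite x_0 y_0 mmulC mmul0 madd0 => /mS_neq0.
  have zE' : z = y' * mS (eval rho m) + eval rho m.
    by apply: mS_inj; rewrite zE x_0 yE madd0 mmulSl maddS.
  have lt_y' : y' < eval rho N by rewrite -yE.
  have [_ /(_ lt_y') Gm] := h y' (mltW lt_y') _ (mle_refl _) zE'.
  have Dy : D M (tcons y rho).
    rewrite yE; apply: (stepD _ _ lt_y' erefl).
    by have [_ GS _] := GP M (tcons y' rho); apply: GS.
  by split=> // lt_y; rewrite x_0; exact: start.
- move=> /(_ _ (mle_refl _) _ (mle0 _)); rewrite madd0 => /(_ erefl) [h _].
  exact: h.
Qed.

End PiDef.

Section Forcing.
Variables (k : nat) (b : bool).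
Hypothesis k_gt0 : 0 < k.
Notation PiDef := (PiDef k).
Notation Flow := (Flow k b).

Lemma flow_mono n (P P' Q Q' : spred n) :
  (forall (M : PVmodel) (rho : 'I_n -> M), P' M rho -> P M rho) ->
  (forall (M : PVmodel) (rho : 'I_n -> M), Q M rho -> Q' M rho) ->
  Flow P Q -> Flow P' Q'.
Proof.
move=> sP sQ [H [t [pH tOK HP]]]; exists H, t; split=> // M rho.
have [H0 HS Ht] := HP M rho; split=> [/sP /H0|//|u tu /(Ht _ tu) /sQ] //.
Qed.

(** [G] is carried along the first flow and [D] along the second: G leads to (G and A) or D, and
    from there to D. *)
Lemma flow_cut n (G D A : spred n) : PiDef G -> PiDef D ->
  Flow G (fun M rho => D M rho \/ A M rho) ->
  Flow (fun M rho => G M rho /\ A M rho) D -> Flow G D.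
Proof.
move=> pG pD f1 f2.
apply: (@flow_trans _ k_gt0 _ _ _ (fun M rho => (G M rho /\ A M rho) \/ D M rho)) => //.
  by apply: flow_mono (flow_and pG f1) => M rho; tauto.
by apply: flow_mono (flow_or pD f2) => M rho; tauto.
Qed.

Lemma flow_mp n (G D X Y Z : spred n) : PiDef G -> PiDef D -> PiDef X -> PiDef Z ->
  (forall (M : PVmodel) (rho : 'I_n -> M), X M rho -> Y M rho -> Z M rho) ->
  Flow G (fun M rho => D M rho \/ X M rho) ->
  Flow G (fun M rho => D M rho \/ Y M rho) ->
  Flow G (fun M rho => D M rho \/ Z M rho).
Proof.
move=> pG pD pX pZ XYZ fX fY; apply: (flow_cut (A := X)) => //.
- exact: PiDef_or.
- by apply: flow_mono fX => M rho; tauto.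
by apply: flow_mono (flow_and pX fY) => M rho //; have := XYZ M rho; tauto.
Qed.

(* [~ B] is moved to the right, where it can be quantified universally. *)
Lemma flow_exl n (t : term n) (G D : spred n) (B : spred n.+1) :
  PiDef G -> PiDef D -> PiDef (fun M rho => ~ B M rho) ->
  PiDef (fun M rho => exists2 d, leint d (eval rho t) & B M (tcons d rho)) ->
  Flow (fun M rho => (leint (rho ord0) (eval rho (tshift t)) /\ B M rho) /\
                     G M (fun i => rho (lift ord0 i)))
       (fun M rho => D M (fun i => rho (lift ord0 i))) ->
  Flow (fun M rho => G M rho /\ exists2 d, leint d (eval rho t) & B M (tcons d rho)) D.
Proof.
move=> pG pD pnB pE f.
have wkE (M : PVmodel) (rho : 'I_n -> M) u : (fun i => tcons u rho (lift ord0 i)) = rho.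
  by apply/funext => i; rewrite tconsS.
have f1 : Flow G (fun M rho => forall d, leint d (eval rho t) ->
    (fun M rho => D M (fun i => rho (lift ord0 i)) \/ ~ B M rho) M (tcons d rho)).
  apply: (@flow_all k k_gt0 b n t G
    (fun M rho => D M (fun i => rho (lift ord0 i)) \/ ~ B M rho)).
    by apply: PiDef_or => //; exact: PiDef_shift.
  apply: flow_mono (flow_or pnB f) => M rho //.
  by have := EM (B M rho); tauto.
apply: flow_mono (flow_and pE f1) => M rho // [allD [d dt Bd]].
by case: (allD d dt) => //; rewrite wkE.
Qed.

(** * Forcing *)

(** An extension may live over other variables, with [sg] interpreting the old ones; generic
    elements enter through [sg := wk]. It strengthens [G] and weakens [D], so flows persist. *)
Definition ext n (G D : spred n) m (sg : 'I_n -> term m) (G' D' : spred m) : Prop :=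
  [/\ PiDef G', PiDef D',
    (forall (M : PVmodel) (rho : 'I_m -> M),
       G' M rho -> G M (fun i => eval rho (sg i))) &
    (forall (M : PVmodel) (rho : 'I_m -> M),
       D M (fun i => eval rho (sg i)) -> D' M rho)].

Definition tr m (A : form m) n (G D : spred n) (tau : 'I_m -> term n) : Prop :=
  Flow G (fun M rho => D M rho \/ sat A (fun i => eval rho (tau i))).

(* A condition is a pair [(G, D)] of predicates in [n] variables; it decides [A]
   positively when a flow leads from [G] to [D \/ A].  Disjunctions and
   existentials are read through their double negations. *)
Fixpoint frc m (A : form m) n (G D : spred n) (tau : 'I_m -> term n) {struct A} : Prop :=
  match A with
  | Bot => Flow G D
  | Eq s t => tr (Eq s t) G D tau
  | Le s t => tr (Le s t) G D tau
  | And A B => frc A G D tau /\ frc B G D tau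
  | Or A B => forall n1 (sg1 : 'I_n -> term n1) G1 D1, ext G D sg1 G1 D1 ->
      (forall n2 (sg2 : 'I_n1 -> term n2) G2 D2, ext G1 D1 sg2 G2 D2 ->
        frc A G2 D2 (fun i => tsubst sg2 (tsubst sg1 (tau i))) -> Flow G2 D2) ->
      (forall n2 (sg2 : 'I_n1 -> term n2) G2 D2, ext G1 D1 sg2 G2 D2 ->
        frc B G2 D2 (fun i => tsubst sg2 (tsubst sg1 (tau i))) -> Flow G2 D2) ->
      Flow G1 D1
  | Imp A B => forall n1 (sg1 : 'I_n -> term n1) G1 D1, ext G D sg1 G1 D1 ->
      frc A G1 D1 (fun i => tsubst sg1 (tau i)) ->
      frc B G1 D1 (fun i => tsubst sg1 (tau i))
  | All A => forall n1 (sg1 : 'I_n -> term n1) G1 D1, ext G D sg1 G1 D1 ->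
      forall s, frc A G1 D1 (tcons s (fun i => tsubst sg1 (tau i)))
  | Ex A => forall n1 (sg1 : 'I_n -> term n1) G1 D1, ext G D sg1 G1 D1 ->
      (forall n2 (sg2 : 'I_n1 -> term n2) G2 D2, ext G1 D1 sg2 G2 D2 ->
        forall s, frc A G2 D2 (tcons s (fun i => tsubst sg2 (tsubst sg1 (tau i)))) ->
        Flow G2 D2) ->
      Flow G1 D1
  end.

Lemma ext_refl n (G D : spred n) : PiDef G -> PiDef D -> ext G D Var G D.
Proof. by []. Qed.

Lemma ext_comp n m p (sg : 'I_n -> term m) (sg' : 'I_m -> term p) G D G1 D1 G2 D2 :
  ext G D sg G1 D1 -> ext G1 D1 sg' G2 D2 ->
  ext G D (fun i => tsubst sg' (sg i)) G2 D2.
Proof.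
move=> [_ _ sG sD] [pG2 pD2 sG' sD']; split=> // M rho.
  move/sG'/sG; congr (G M); apply/funext => i; by rewrite eval_tsubst.
move=> h; apply/sD'/sD; move: h; congr (D M); apply/funext => i.
by rewrite eval_tsubst.
Qed.

Lemma ext_flow n m (sg : 'I_n -> term m) G D G' D' :
  ext G D sg G' D' -> Flow G D -> Flow G' D'.
Proof. by move=> [_ _ sG sD] /(flow_subst sg); apply: flow_mono. Qed.

Lemma ext_tr p (A : form p) n m (sg : 'I_n -> term m) G D G' D' tau :
  ext G D sg G' D' -> tr A G D tau -> tr A G' D' (fun i => tsubst sg (tau i)).
Proof.
move=> [_ _ sG sD] /(flow_subst sg); apply: flow_mono => // M rho.
move=> [/sD|h]; [by left | right].
by move: h; congr sat; apply/funext => i; rewrite eval_tsubst.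
Qed.

Lemma subst_assoc p n m q (tau : 'I_p -> term n) (sg : 'I_n -> term m)
    (sg' : 'I_m -> term q) :
  (fun i => tsubst sg' (tsubst sg (tau i))) =
  (fun i => tsubst (fun j => tsubst sg' (sg j)) (tau i)).
Proof. by apply/funext => i; rewrite tsubst_comp. Qed.

Lemma subst_id p n (tau : 'I_p -> term n) : (fun i => tsubst Var (tau i)) = tau.
Proof. by apply/funext => i; rewrite tsubst_Var. Qed.

Ltac same_env := congr frc; apply/funext => ?; rewrite -?tsubst_comp ?tsubst_Var //.

Lemma frc_mono p (A : form p) n m (sg : 'I_n -> term m) G D G' D' tau :
  ext G D sg G' D' -> frc A G D tau -> frc A G' D' (fun i => tsubst sg (tau i)).
Proof.
elim: A n m sg G D G' D' tau => {p}
  [p|p s t|p s t|p A IHA B IHB|p A IHA B IHB|p A IHA B IHB|p A IH|p A IH]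
  n m sg G D G' D' tau e /=.
- exact: ext_flow e.
- exact: ext_tr e.
- exact: ext_tr e.
- by move=> [fA fB]; split; [exact: IHA e fA | exact: IHB e fB].
- move=> f n1 sg1 G1 D1 e1 hA hB; apply: (f _ _ _ _ (ext_comp e e1)) => n2 sg2 G2 D2 e2.
    by move=> fA; apply: hA e2 _; move: fA; same_env.
  by move=> fB; apply: hB e2 _; move: fB; same_env.
- by move=> f n1 sg1 G1 D1 e1; rewrite subst_assoc; apply: f (ext_comp e e1).
- by move=> f n1 sg1 G1 D1 e1; rewrite subst_assoc; apply: f (ext_comp e e1).
- move=> f n1 sg1 G1 D1 e1 h; apply: (f _ _ _ _ (ext_comp e e1)) => n2 sg2 G2 D2 e2.
  by move=> s fA; apply: (h _ _ _ _ e2 s); move: fA; congr (frc _ _ _ (tcons _ _));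
    apply/funext => i; rewrite -!tsubst_comp.
Qed.

Lemma tr_fsubst p q (sg : 'I_p -> term q) (A : form p) n G D (tau : 'I_q -> term n) :
  tr (fsubst sg A) G D tau = tr A G D (fun i => tsubst tau (sg i)).
Proof.
rewrite /tr; apply: (f_equal (Flow _)); apply: functional_extensionality_dep => M.
apply/funext => rho.
rewrite sat_fsubst; congr (_ \/ sat _ _); apply/funext => i.
by rewrite eval_tsubst.
Qed.

Lemma frc_fsubst p q (sg : 'I_p -> term q) (A : form p) n G D (tau : 'I_q -> term n) :
  frc (fsubst sg A) G D tau = frc A G D (fun i => tsubst tau (sg i)).
Proof.
have upE p' q' (sg' : 'I_p' -> term q') n' (s : term n') tau' :
    (fun i => tsubst (tcons s tau') (up sg' i)) =
    tcons s (fun i => tsubst tau' (sg' i)).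
  apply: tconsP => // i; rewrite upS tsubst_tshift; congr tsubst.
  by apply/funext => j; rewrite tconsS.
elim: A q sg n G D tau => {p}
  [p|p s t|p s t|p A IHA B IHB|p A IHA B IHB|p A IHA B IHB|p A IH|p A IH]
  q sg n G D tau /=.
- by [].
- exact: (tr_fsubst sg (Eq s t)).
- exact: (tr_fsubst sg (Le s t)).
- by rewrite IHA IHB.
- apply/propext; split=> f n1 sg1 G1 D1 e1 hA hB;
  apply: (f _ _ _ _ e1) => n2 sg2 G2 D2 e2 fA; [apply: hA e2 _|apply: hB e2 _
    |apply: hA e2 _|apply: hB e2 _]; move: fA; rewrite ?IHA ?IHB;
  by congr frc; apply/funext => i; rewrite -?tsubst_comp.
- apply/propext; split=> f n1 sg1 G1 D1 e1; move: (f _ _ _ _ e1);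
  by rewrite IHA IHB !subst_assoc.
- apply/propext; split=> f n1 sg1 G1 D1 e1 s; move: (f _ _ _ _ e1 s);
  by rewrite IH upE !subst_assoc.
- apply/propext; split=> f n1 sg1 G1 D1 e1 h;
  apply: (f _ _ _ _ e1) => n2 sg2 G2 D2 e2 s fA; apply: (h _ _ _ _ e2 s);
  move: fA; rewrite IH upE; congr (frc _ _ _ (tcons _ _));
  by apply/funext => i; rewrite -?tsubst_comp.
Qed.

Lemma PiDef_sat p (A : form p) n (tau : 'I_p -> term n) :
  PiDef (fun M : PVmodel => @sat M p A) ->
  PiDef (fun (M : PVmodel) rho => sat A (fun i => eval rho (tau i))).
Proof. exact: (@PiDef_subst k p n tau (fun M : PVmodel => @sat M p A)). Qed.

(** Stability under double negation makes proof by contradiction sound for forcing. *)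
Lemma frc_stable p (A : form p) n G D (tau : 'I_p -> term n) :
  PiDef G -> PiDef D ->
  (forall n1 (sg1 : 'I_n -> term n1) G1 D1, ext G D sg1 G1 D1 ->
    (forall n2 (sg2 : 'I_n1 -> term n2) G2 D2, ext G1 D1 sg2 G2 D2 ->
      frc A G2 D2 (fun i => tsubst sg2 (tsubst sg1 (tau i))) -> Flow G2 D2) ->
    Flow G1 D1) ->
  frc A G D tau.
Proof.
have atom p' (B : form p') n' G' D' (tau' : 'I_p' -> term n') : qf B ->
    PiDef G' -> PiDef D' ->
    (forall n1 (sg1 : 'I_n' -> term n1) G1 D1, ext G' D' sg1 G1 D1 ->
      (forall n2 (sg2 : 'I_n1 -> term n2) G2 D2, ext G1 D1 sg2 G2 D2 ->
        tr B G2 D2 (fun i => tsubst sg2 (tsubst sg1 (tau' i))) -> Flow G2 D2) ->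
      Flow G1 D1) -> tr B G' D' tau'.
  (* The hypothesis is tested at the condition (G, D or B): there forcing [B] is already
     inconsistency, and inconsistency of this condition is the flow sought. *)
  move=> qfB pG pD nn; apply: (nn _ Var) => [|n2 sg2 G2 D2 [_ _ _ sD]].
    split=> // [|M rho h]; last by left.
    by apply: PiDef_or => //; apply: PiDef_sat; exact: PiDef_qf.
  apply: flow_mono => // M rho [//|h]; apply: sD; right.
  move: h; congr sat; apply/funext => i.
  by rewrite tsubst_Var eval_tsubst.
elim: A n G D tau => {p}
  [p|p s t|p s t|p A IHA B IHB|p A IHA B IHB|p A IHA B IHB|p A IH|p A IH]
  n G D tau pG pD h /=.
- by apply: (h _ _ _ _ (ext_refl pG pD)) => n2 sg2 G2 D2 e2.
- exact: atom.
- exact: atom.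
- split; [apply: IHA | apply: IHB] => // n1 sg1 G1 D1 e1 h1;
  apply: h e1 _ => n2 sg2 G2 D2 e2 [fA fB]; exact: h1 e2 _.
- move=> n1 sg1 G1 D1 e1 hA hB; apply: h e1 _ => n2 sg2 G2 D2 e2 /= f.
  have [pG2 pD2 _ _] := e2; apply: (f _ _ _ _ (ext_refl pG2 pD2)) => n3 sg3 G3 D3 e3.
    by move=> fA; apply: (hA _ _ _ _ (ext_comp e2 e3)); move: fA; same_env.
  by move=> fB; apply: (hB _ _ _ _ (ext_comp e2 e3)); move: fB; same_env.
- move=> n1 sg1 G1 D1 e1 fA; have [pG1 pD1 _ _] := e1; apply: IHB => //.
  move=> n2 sg2 G2 D2 e2 hB; apply: (h _ _ _ _ (ext_comp e1 e2)) => n3 sg3 G3 D3 e3 /= f.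
  have [pG3 pD3 _ _] := e3; apply: (hB _ _ _ _ e3).
  have := f _ _ _ _ (ext_refl pG3 pD3).
  have -> : (fun i => tsubst Var (tsubst sg3 (tsubst (fun i => tsubst sg2 (sg1 i)) (tau i))))
    = (fun i => tsubst sg3 (tsubst sg2 (tsubst sg1 (tau i)))).
    by apply/funext => i; rewrite tsubst_Var -!tsubst_comp.
  apply; exact: frc_mono e3 (frc_mono e2 fA).
- move=> n1 sg1 G1 D1 e1 s; have [pG1 pD1 _ _] := e1; apply: IH => //.
  move=> n2 sg2 G2 D2 e2 hB; apply: (h _ _ _ _ (ext_comp e1 e2)) => n3 sg3 G3 D3 e3 /= f.
  have [pG3 pD3 _ _] := e3; apply: (hB _ _ _ _ e3).
  have := f _ _ _ _ (ext_refl pG3 pD3) (tsubst sg3 (tsubst sg2 s)).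
  by congr frc; apply/esym/tconsP => // i; rewrite tconsS tsubst_Var -!tsubst_comp.
- move=> n1 sg1 G1 D1 e1 hA; apply: h e1 _ => n2 sg2 G2 D2 e2 /= f.
  have [pG2 pD2 _ _] := e2; apply: (f _ _ _ _ (ext_refl pG2 pD2)) => n3 sg3 G3 D3 e3 s.
  move=> fA; apply: (hA _ _ _ _ (ext_comp e2 e3) s); move: fA.
  congr (frc _ _ _ (tcons _ _)); apply/funext => i.
  by rewrite tsubst_Var -!tsubst_comp.
Qed.

(** An equation forced at a condition is known only behind a flow to [D] or [E], so atoms are
    rewritten by [flow_mp]. For implications the symmetric equations serve the antecedent. *)
Lemma frc_congr p (A : form p) n G D (E : spred n) (tau tau' : 'I_p -> term n) :
  PiDef G -> PiDef D -> PiDef E -> Flow G (fun M rho => D M rho \/ E M rho) ->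
  (forall (M : PVmodel) (rho : 'I_n -> M), E M rho ->
     forall i, eval rho (tau i) = eval rho (tau' i)) ->
  frc A G D tau -> frc A G D tau'.
Proof.
have atom p' (B : form p') n' G' D' (E' : spred n') (mu mu' : 'I_p' -> term n') :
    qf B -> PiDef G' -> PiDef D' -> PiDef E' ->
    Flow G' (fun M rho => D' M rho \/ E' M rho) ->
    (forall (M : PVmodel) (rho : 'I_n' -> M), E' M rho ->
       forall i, eval rho (mu i) = eval rho (mu' i)) ->
    tr B G' D' mu -> tr B G' D' mu'.
  move=> qfB pG pD pE fE Emu; apply: flow_mp (fE) => //.
    by apply: PiDef_sat; exact: PiDef_qf.
  by move=> M rho /Emu e; congr sat; apply/funext.
have extE n0 G0 D0 (E0 : spred n0) m (sg : 'I_n0 -> term m) G1 D1 :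
    ext G0 D0 sg G1 D1 -> Flow G0 (fun M rho => D0 M rho \/ E0 M rho) ->
    Flow G1 (fun M rho => D1 M rho \/ E0 M (fun i => eval rho (sg i))).
  move=> [_ _ sG sD] /(flow_subst sg); apply: flow_mono => // M rho [/sD|]; by auto.
have extEq n0 m (E0 : spred n0) (sg : 'I_n0 -> term m) p' (mu mu' : 'I_p' -> term n0) :
    (forall (M : PVmodel) (rho : 'I_n0 -> M), E0 M rho ->
       forall i, eval rho (mu i) = eval rho (mu' i)) ->
    forall (M : PVmodel) (rho : 'I_m -> M), E0 M (fun i => eval rho (sg i)) ->
       forall i, eval rho (tsubst sg (mu i)) = eval rho (tsubst sg (mu' i)).
  by move=> Emu M rho /Emu e i; rewrite !eval_tsubst.
have consEq m (E0 : spred m) s p' (mu mu' : 'I_p' -> term m) :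
    (forall (M : PVmodel) (rho : 'I_m -> M), E0 M rho ->
       forall i, eval rho (mu i) = eval rho (mu' i)) ->
    forall (M : PVmodel) (rho : 'I_m -> M), E0 M rho ->
       forall i, eval rho (tcons s mu i) = eval rho (tcons s mu' i).
  by move=> Emu M rho Er; elim/ordS_ind => // i; rewrite !tconsS; exact: Emu.
have symE m (E0 : spred m) p' (mu mu' : 'I_p' -> term m) :
    (forall (M : PVmodel) (rho : 'I_m -> M), E0 M rho ->
       forall i, eval rho (mu i) = eval rho (mu' i)) ->
    forall (M : PVmodel) (rho : 'I_m -> M), E0 M rho ->
       forall i, eval rho (mu' i) = eval rho (mu i).
  by move=> Emu M rho Er i; rewrite (Emu M rho Er).
elim: A n G D E tau tau' => {p}
  [p|p s t|p s t|p A IHA B IHB|p A IHA B IHB|p A IHA B IHB|p A IH|p A IH]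
  n G D E tau tau' pG pD pE fE Et /=.
- by [].
- exact: atom fE Et.
- exact: atom fE Et.
- by move=> [fA fB]; split; [exact: IHA fE Et fA | exact: IHB fE Et fB].
- move=> f n1 sg1 G1 D1 e1 hA hB; apply: (f _ _ _ _ e1) => n2 sg2 G2 D2 e2 fA.
    have [pG2 pD2 _ _] := e2; apply: (hA _ _ _ _ e2).
    apply: IHA (extE _ _ _ _ _ _ _ _ e2 (extE _ _ _ _ _ _ _ _ e1 fE)) _ fA => //.
      exact: (PiDef_subst sg2 (PiDef_subst sg1 pE)).
    exact: (extEq _ _ _ sg2 _ _ _ (extEq _ _ _ sg1 _ _ _ Et)).
  have [pG2 pD2 _ _] := e2; apply: (hB _ _ _ _ e2).
  apply: IHB (extE _ _ _ _ _ _ _ _ e2 (extE _ _ _ _ _ _ _ _ e1 fE)) _ fA => //.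
    exact: (PiDef_subst sg2 (PiDef_subst sg1 pE)).
  exact: (extEq _ _ _ sg2 _ _ _ (extEq _ _ _ sg1 _ _ _ Et)).
- move=> f n1 sg1 G1 D1 e1 fA; have [pG1 pD1 _ _] := e1.
  have pE1 := PiDef_subst sg1 pE.
  apply: (IHB _ _ _ _ _ _ pG1 pD1 pE1 (extE _ _ _ _ _ _ _ _ e1 fE) (extEq _ _ _ _ _ _ _ Et)).
  apply: (f _ _ _ _ e1).
  exact: (IHA _ _ _ _ _ _ pG1 pD1 pE1 (extE _ _ _ _ _ _ _ _ e1 fE)
    (symE _ _ _ _ _ (extEq _ _ _ _ _ _ _ Et)) fA).
- move=> f n1 sg1 G1 D1 e1 s; have [pG1 pD1 _ _] := e1.
  have pE1 := PiDef_subst sg1 pE.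
  exact: (IH _ _ _ _ _ _ pG1 pD1 pE1 (extE _ _ _ _ _ _ _ _ e1 fE)
    (consEq _ _ _ _ _ _ (extEq _ _ _ _ _ _ _ Et)) (f _ _ _ _ e1 s)).
- move=> f n1 sg1 G1 D1 e1 h; apply: (f _ _ _ _ e1) => n2 sg2 G2 D2 e2 s fA.
  have [pG2 pD2 _ _] := e2; apply: (h _ _ _ _ e2 s).
  apply: IH (extE _ _ _ _ _ _ _ _ e2 (extE _ _ _ _ _ _ _ _ e1 fE)) _ fA => //.
    exact: (PiDef_subst sg2 (PiDef_subst sg1 pE)).
  exact: (consEq _ _ _ _ _ _ (extEq _ _ _ sg2 _ _ _ (extEq _ _ _ sg1 _ _ _ Et))).
Qed.

(** Induction on derivations, with the condition and the assignment kept general so that discharged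
    hypotheses and eigenvariables can be met by extensions. *)
Lemma frc_sound (T : theory) p (L : seq (form p)) A :
  (forall m (B : form m), T m B -> forall n (G D : spred n) tau,
     PiDef G -> PiDef D -> frc B G D tau) ->
  prv T L A -> forall n (G D : spred n) (tau : 'I_p -> term n),
  PiDef G -> PiDef D -> (forall B, List.In B L -> frc B G D tau) -> frc A G D tau.
Proof.
move=> FT prA; elim: prA => {p L A}
  [p L m A sg TA|p L A LA|p L A _ IH|p L A B _ IHA _ IHB|p L A B _ IH
  |p L A B _ IH|p L A B _ IH|p L A B _ IH|p L A B C _ IHAB _ IHA _ IHB
  |p L A B _ IH|p L A B _ IHAB _ IHA|p L A _ IH|p L A t _ IH|p L A t _ IH
  |p L A B _ IHA _ IHB|p L t|p L A s t _ IHe _ IHA] n G D tau pG pD LS.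
all: have LE n1 (sg1 : 'I_n -> term n1) G1 D1 : ext G D sg1 G1 D1 ->
  forall K, List.In K L -> frc K G1 D1 (fun i => tsubst sg1 (tau i))
  by move=> e1 K LK; apply: frc_mono e1 (LS K LK).
- by rewrite frc_fsubst; exact: FT.
- exact: LS.
- apply: frc_stable => // n1 sg1 G1 D1 e1 h; have [pG1 pD1 _ _] := e1.
  by apply: (IH _ G1 D1 (fun i => tsubst sg1 (tau i))) => // K [<-|/(LE _ _ _ _ e1)].
- by split; [exact: IHA | exact: IHB].
- by case: (IH _ _ _ _ pG pD LS).
- by case: (IH _ _ _ _ pG pD LS).
- move=> n1 sg1 G1 D1 e1 hA _; have [pG1 pD1 _ _] := e1.
  apply: (hA _ _ _ _ (ext_refl pG1 pD1)); rewrite subst_id.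
  exact: frc_mono e1 (IH _ _ _ _ pG pD LS).
- move=> n1 sg1 G1 D1 e1 _ hB; have [pG1 pD1 _ _] := e1.
  apply: (hB _ _ _ _ (ext_refl pG1 pD1)); rewrite subst_id.
  exact: frc_mono e1 (IH _ _ _ _ pG pD LS).
(* The clause for disjunction yields only inconsistency, while the eliminated conclusion [C] is
   arbitrary; stability bridges the gap. Elimination of the existential quantifier follows the same
   pattern. *)
- apply: frc_stable => // n1 sg1 G1 D1 e1 h; have [pG1 pD1 _ _] := e1.
  apply: (IHAB _ _ _ _ pG pD LS _ _ _ _ e1) => n2 sg2 G2 D2 e2 fK;
  have [pG2 pD2 _ _] := e2; apply: (h _ _ _ _ e2); [apply: IHA | apply: IHB] => //;
  move=> K [<- //|LK]; exact: frc_mono e2 (LE _ _ _ _ e1 _ LK).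
- move=> n1 sg1 G1 D1 e1 fA; have [pG1 pD1 _ _] := e1.
  by apply: IH => // K [<-|/(LE _ _ _ _ e1)].
- have := IHAB _ _ _ _ pG pD LS _ _ _ _ (ext_refl pG pD).
  by rewrite subst_id; apply; exact: IHA.
- move=> n1 sg1 G1 D1 e1 s; have [pG1 pD1 _ _] := e1; apply: IH => // K.
  move=> /List.in_map_iff [K' [<- LK']]; rewrite frc_fsubst.
  move: (LE _ _ _ _ e1 _ LK'); congr frc; apply/funext => i.
  by rewrite /wk /= tconsS.
- have := IH _ _ _ _ pG pD LS _ _ _ _ (ext_refl pG pD) (tsubst tau t).
  by rewrite subst_id /inst frc_fsubst comp_tcons.
- move=> n1 sg1 G1 D1 e1 h; have [pG1 pD1 _ _] := e1.
  apply: (h _ _ _ _ (ext_refl pG1 pD1) (tsubst sg1 (tsubst tau t))).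
  have := frc_mono e1 (IH _ _ _ _ pG pD LS).
  rewrite /inst frc_fsubst; congr frc; apply: tconsP => [|i].
    by rewrite -[tcons t Var ord0]/t -tsubst_comp.
  by rewrite tconsS tsubst_Var.
- apply: frc_stable => // n1 sg1 G1 D1 e1 h; have [pG1 pD1 _ _] := e1.
  apply: (IHA _ _ _ _ pG pD LS _ _ _ _ e1) => n2 sg2 G2 D2 e2 s fA.
  have [pG2 pD2 _ _] := e2; apply: (h _ _ _ _ e2).
  set tau2 := (fun i => tsubst sg2 (tsubst sg1 (tau i))) in fA *.
  have shE K : frc (fshift K) G2 D2 (tcons s tau2) = frc K G2 D2 tau2.
    by rewrite frc_fsubst; congr frc; apply/funext => i; rewrite /= tconsS.
  rewrite -shE; apply: IHB => // K [<- //|/List.in_map_iff [K' [<- LK']]].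
  rewrite shE; exact: frc_mono e2 (LE _ _ _ _ e1 _ LK').
- apply: flow_imp => [|M rho _]; last by right.
  by apply: PiDef_or => //; apply: (@PiDef_sat _ (Eq t t)); exact: PiDef_qf.
- move: (IHA _ _ _ _ pG pD LS); rewrite /inst !frc_fsubst !comp_tcons.
  apply: (frc_congr (E := fun M rho => sat (Eq s t) (fun i => eval rho (tau i)))) => //.
  + by apply: PiDef_sat; exact: PiDef_qf.
  + exact: (IHe _ _ _ _ pG pD LS).
  + by move=> M rho /= e; elim/ordS_ind => [|i]; rewrite ?tconsS // !eval_tsubst.
Qed.

(** * Formulas that are forced exactly when a flow leads to them *)

Definition truthful m (A : form m) : Prop :=
  forall n (G D : spred n) tau, PiDef G -> PiDef D -> (frc A G D tau <-> tr A G D tau).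

Lemma tr_hyp m (A : form m) n (G D : spred n) tau : PiDef D ->
  PiDef (fun M : PVmodel => @sat M m A) ->
  (forall (M : PVmodel) rho, G M rho -> sat A (fun i => eval rho (tau i))) ->
  tr A G D tau.
Proof.
move=> pD pA GA; apply: flow_imp => [|M rho /GA]; last by right.
by apply: PiDef_or => //; exact: PiDef_sat.
Qed.

Lemma truthful_and m (A B : form m) : PiDef (fun M : PVmodel => @sat M m A) ->
  PiDef (fun M : PVmodel => @sat M m B) ->
  truthful A -> truthful B -> truthful (And A B).
Proof.
move=> pA pB tA tB n G D tau pG pD /=; rewrite (tA _ _ _ _ pG pD) (tB _ _ _ _ pG pD).
split=> [[fA fB]|f].
  apply: flow_mp fA fB => //; first exact: PiDef_sat.
  exact: (@PiDef_sat _ (And A B) _ tau (PiDef_and pA pB)).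
by split; apply: flow_mono f => // M rho /=; tauto.
Qed.

(* A false disjunct may be added to [D], and a true one to [G]. *)
Lemma truthful_or m (A B : form m) : PiDef (fun M : PVmodel => @sat M m A) ->
  PiDef (fun M : PVmodel => @sat M m B) ->
  truthful A -> truthful B -> truthful (Or A B).
Proof.
move=> pA pB tA tB n G D tau pG pD /=; split=> [f|f].
  apply: (f _ Var) => [|n2 sg2 G2 D2 e2|n2 sg2 G2 D2 e2].
  - split=> // [|M rho h]; last by left.
    apply: PiDef_or => //.
    exact: (@PiDef_sat _ (Or A B) _ tau (PiDef_or pA pB)).
  - have [pG2 pD2 _ sD] := e2; move/(tA _ _ _ _ pG2 pD2).
    apply: flow_mono => // M rho [//|h]; apply: sD; right; left.
    by move: h; congr sat; apply/funext => i; rewrite tsubst_Var eval_tsubst.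
  - have [pG2 pD2 _ sD] := e2; move/(tB _ _ _ _ pG2 pD2).
    apply: flow_mono => // M rho [//|h]; apply: sD; right; right.
    by move: h; congr sat; apply/funext => i; rewrite tsubst_Var eval_tsubst.
move=> n1 sg1 G1 D1 e1 hA hB; have [pG1 pD1 _ _] := e1.
have {}f := ext_tr e1 f; set tau1 := (fun i => _) in f hA hB.
pose XA (M : PVmodel) rho := @sat M m A (fun i => eval rho (tau1 i)).
pose XB (M : PVmodel) rho := @sat M m B (fun i => eval rho (tau1 i)).
have pXA : PiDef XA by exact: PiDef_sat.
have pXB : PiDef XB by exact: PiDef_sat.
have fA : Flow (fun M rho => G1 M rho /\ XA M rho) D1.
  have pGA := PiDef_and pG1 pXA.
  apply: (hA _ Var) => [|]; first by split=> // M rho [].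
  rewrite subst_id; apply/(tA _ _ _ _ pGA pD1); apply: tr_hyp => // M rho [] //.
have fB : Flow (fun M rho => G1 M rho /\ XB M rho) D1.
  have pGB := PiDef_and pG1 pXB.
  apply: (hB _ Var) => [|]; first by split=> // M rho [].
  rewrite subst_id; apply/(tB _ _ _ _ pGB pD1); apply: tr_hyp => // M rho [] //.
apply: (flow_cut (A := XA)) => //; apply: (flow_cut (A := XB)) => //.
- exact: PiDef_or.
- by apply: flow_mono f => // M rho; rewrite /XA /XB /=; tauto.
- by apply: flow_mono fB => // M rho; left.
Qed.

(** Forward, the antecedent is adjoined to [G] and cut against the tautology that it or the
    implication holds; the quantifier-free antecedent keeps the implication inside [hPi k]. *)
Lemma truthful_imp m (A B : form m) : qf A -> qf B ->
  truthful A -> truthful B -> truthful (Imp A B).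
Proof.
move=> qfA qfB tA tB n G D tau pG pD /=.
have pA := PiDef_qf k qfA; have pB := PiDef_qf k qfB.
have pAB : PiDef (fun M : PVmodel => @sat M m (Imp A B)).
  by apply: PiDef_qf; rewrite /= qfA.
split=> [f|f n1 sg1 G1 D1 e1].
  pose XA (M : PVmodel) rho := @sat M m A (fun i => eval rho (tau i)).
  have pXA : PiDef XA by exact: PiDef_sat.
  have pGA := PiDef_and pG pXA.
  have e : ext G D Var (fun M rho => G M rho /\ XA M rho) D by split=> // M rho [].
  have := f _ _ _ _ e; rewrite subst_id => fB.
  have {}fB : tr B (fun M rho => G M rho /\ XA M rho) D tau.
    by apply/(tB _ _ _ _ pGA pD); apply: fB; apply/(tA _ _ _ _ pGA pD);
      apply: tr_hyp => // M rho [].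
  have pD' := PiDef_or pD (PiDef_sat tau pAB).
  apply: (flow_cut (A := XA)) => //.
    apply: flow_imp => [|M rho _]; first exact: PiDef_or.
    by rewrite /XA /=; have := EM (sat A (fun i => eval rho (tau i))); tauto.
  by apply: flow_mono fB => // M rho /=; tauto.
have [pG1 pD1 _ _] := e1.
move/(tA _ _ _ _ pG1 pD1) => fA; apply/(tB _ _ _ _ pG1 pD1).
apply: flow_mp fA (ext_tr e1 f) => //; [exact: PiDef_sat | exact: PiDef_sat |].
by move=> M rho Ar /=; apply.
Qed.

Lemma truthful_qf m (A : form m) : qf A -> truthful A.
Proof.
elim: A => {m} //.
- by move=> m _ n G D tau pG pD; split; apply: flow_mono => // M rho; [left | case].
- move=> m A IHA B IHB /andP[qfA qfB].
  by apply: truthful_and; auto; apply: PiDef_qf.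
- move=> m A IHA B IHB /andP[qfA qfB].
  by apply: truthful_or; auto; apply: PiDef_qf.
- by move=> m A IHA B IHB /andP[qfA qfB]; apply: truthful_imp; auto.
Qed.

(** Forward, the generic condition adds a fresh variable below the bound to [G], and [flow_all]
    collects the resulting flow. Backward, the forced guard is combined with the given flow by modus
    ponens. *)
Lemma truthful_AllB m (t : term m) (B : form m.+1) :
  PiDef (fun M : PVmodel => @sat M m.+1 B) -> truthful B -> truthful (AllB t B).
Proof.
move=> pB tB n G D tau pG pD; split=> [f|f n1 sg1 G1 D1 e1 s n2 sg2 G2 D2 e2].
  pose r := tsubst tau t.
  pose G1 : spred n.+1 := fun M rho => leint (rho ord0) (eval rho (tshift r)) /\
    G M (fun i => rho (lift ord0 i)).
  pose D1 : spred n.+1 := fun M rho => D M (fun i => rho (lift ord0 i)).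
  have pG1 : PiDef G1.
    apply: PiDef_and; last exact: PiDef_shift.
    exact: (@PiDef_qf k _ (Le x0 (tshift r))).
  have pD1 : PiDef D1 by exact: PiDef_shift.
  have e : ext G D wk G1 D1 by split=> // M rho [].
  have e' := ext_refl pG1 pD1.
  have := f _ _ _ _ e x0 _ _ _ _ e'; rewrite subst_id => fB.
  set tau1 := tcons _ _ in fB.
  have {}fB : tr B G1 D1 tau1.
    apply/(tB _ _ _ _ pG1 pD1); apply: fB; apply: tr_hyp => //.
      exact: (@PiDef_qf k _ (Le x0 (tshift t))).
    move=> M rho [+ _]; rewrite /tau1 /= eval_tcons eval_tshift /tshift !eval_tsubst /=.
    by congr leint; congr eval; apply/funext => i; rewrite eval_tsubst.
  have pQ : PiDef (fun M rho => D1 M rho \/ sat B (fun i => eval rho (tau1 i))).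
    by apply: PiDef_or => //; exact: PiDef_sat.
  apply: flow_mono (flow_all k_gt0 pQ fB) => // M rho h.
  have [|nD] := pselect (D M rho); first by left.
  right; apply/sat_AllB => d; rewrite -eval_tsubst -/r => /h [].
    rewrite /D1 (_ : (fun i => _) = rho) //.
    by apply/funext => i; rewrite tconsS.
  congr sat; rewrite /tau1 eval_tcons; congr tcons; apply/funext => i.
  exact: eval_tshift.
have [pG2 pD2 _ _] := e2; move=> fL; apply/(tB _ _ _ _ pG2 pD2).
apply: flow_mp fL (ext_tr e2 (ext_tr e1 f)) => //.
- by apply: PiDef_sat; exact: (@PiDef_qf k _ (Le x0 (tshift t))).
- exact: PiDef_sat.
move=> M rho; rewrite sat_AllB /= (comp_tcons (fun s => eval rho (tsubst sg2 s))).
rewrite eval_tshift => h1 h2; exact: h2.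
Qed.

(** Forward, the existential formula is adjoined to [D], which makes every forced instance
    inconsistent. Backward, a generic witness is added to [G] and removed by [flow_exl], which
    requires the negation of [B] to be definable as well. *)
Lemma truthful_ExB m (t : term m) (B : form m.+1) :
  PiDef (fun M : PVmodel => @sat M m.+1 B) ->
  PiDef (fun (M : PVmodel) rho => ~ @sat M m.+1 B rho) ->
  PiDef (fun M : PVmodel => @sat M m (ExB t B)) ->
  truthful B -> truthful (ExB t B).
Proof.
move=> pB pnB pE tB n G D tau pG pD.
have tL : truthful (Le x0 (tshift t)) by exact: truthful_qf.
have pL : PiDef (fun M : PVmodel => @sat M _ (Le x0 (tshift t))) by exact: PiDef_qf.
have tLB := truthful_and pL pB tL tB.
split=> [f|f n1 sg1 G1 D1 e1 h].
  have pX := PiDef_sat tau pE.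
  apply: (f _ Var) => [|n2 sg2 G2 D2 e2 s].
    split=> // [|M rho h]; last by left.
    exact: PiDef_or.
  have [pG2 pD2 _ sD] := e2.
  move/(tLB _ _ _ _ pG2 pD2); apply: flow_mono => // M rho [//|[]].
  rewrite /= eval_tcons eval_tshift => ht hB; apply: sD; right.
  apply/sat_ExB; exists (eval rho s).
    by move: ht; congr leint; congr eval; apply/funext => i; rewrite tsubst_Var eval_tsubst.
  suff -> : (fun i => eval (fun j => eval rho (sg2 j)) (tau i)) =
      (fun i => eval rho (tsubst sg2 (tsubst Var (tau i)))) by exact: hB.
  by apply/funext => i; rewrite tsubst_Var eval_tsubst.
have [pG1 pD1 _ _] := e1; have {}f := ext_tr e1 f.
set tau1 := (fun i => _) in f; pose r := tsubst tau1 t.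
pose mu : 'I_m.+1 -> term n1.+1 := up tau1.
pose B1 : spred n1.+1 := fun M rho => sat B (fun i => eval rho (mu i)).
have pB1 : PiDef B1 by exact: PiDef_sat.
have pnB1 : PiDef (fun M rho => ~ B1 M rho).
  exact: (@PiDef_subst k _ _ mu (fun (M : PVmodel) rho => ~ @sat M _ B rho)).
have XE (M : PVmodel) (rho : 'I_n1 -> M) : sat (ExB t B) (fun i => eval rho (tau1 i)) <->
    exists2 d, leint d (eval rho r) & B1 M (tcons d rho).
  rewrite sat_ExB /B1 /r eval_tsubst.
  by split=> -[d dt Bd]; exists d => //; move: Bd; rewrite eval_up.
have pX := PiDef_ext XE (PiDef_sat tau1 pE).
apply: (flow_cut (A := fun M rho => exists2 d, leint d (eval rho r) & B1 M (tcons d rho))) => //.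
  by apply: flow_mono f => // M rho [|/XE]; [left | right].
apply: flow_exl => //.
set G2 := (fun M rho => _); set D2 := (fun M rho => _).
have pG2 : PiDef G2.
  apply: PiDef_and; last exact: PiDef_shift.
  by apply: PiDef_and => //; exact: (@PiDef_qf k _ (Le x0 (tshift r))).
have pD2 : PiDef D2 by exact: PiDef_shift.
have e2 : ext G1 D1 wk G2 D2 by split=> // M rho [].
apply: (h _ _ _ _ e2 x0); apply/(tLB _ _ _ _ pG2 pD2); apply: tr_hyp => //.
  exact: (PiDef_and pL pB).
move=> M rho [[h1 h2] _]; split; last exact: h2.
move: h1; rewrite /= eval_tcons eval_tshift /tshift !eval_tsubst /=.
by congr leint; congr eval; apply/funext => i; rewrite eval_tsubst.
Qed.

(** [hSigma] formulas are treated strictly below [k], where they and their negations are both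
    definable in [hPi k], as the existential case demands. *)
Lemma truthful_bounded :
  (forall j n (A : form n), hSigma j A -> j < k -> truthful A) /\
  (forall j n (A : form n), hPi j A -> j <= k -> truthful A).
Proof.
apply: hSigma_hPi_ind.
- by move=> n A qfA _; exact: truthful_qf.
- by move=> j n A _ IH jk; apply: IH; apply: ltnW.
- move=> j n A B sA IHA sB IHB jk.
  by apply: truthful_and; auto; apply: PiDef_hSigma jk _.
- move=> j n A B sA IHA sB IHB jk.
  by apply: truthful_or; auto; apply: PiDef_hSigma jk _.
- move=> j n t B sB IH jk; apply: truthful_ExB; auto.
  + exact: PiDef_hSigma jk _.
  + exact: PiDef_neg_hSigma jk _.
  + by apply: PiDef_hSigma jk _; exact: hSigma_ex.
- move=> j n t B pB IH jk; apply: truthful_ExB.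
  + by apply: PiDef_hPi pB; apply: ltnW; apply: ltnW.
  (* The negation of an [hPi j] formula is equivalent to an [hSigma j] one, and j < k leaves room
     for the dummy quantifier. *)
  + have [B' sB' B'P] := hSigma_hPi_neg.2 _ _ _ pB.
    apply: PiDef_ext (PiDef_hSigma (ltnW jk) sB') => M rho; exact: B'P.
  + by apply: PiDef_hSigma jk _; exact: hSigma_ex_hPi.
  + by apply: IH; apply: ltnW; apply: ltnW.
- by move=> n A qfA _; exact: truthful_qf.
- by move=> j n A _ IH jk; apply: IH; apply: ltnW.
- move=> j n A B pA IHA pB IHB jk.
  by apply: truthful_and; auto; apply: PiDef_hPi jk _.
- move=> j n A B pA IHA pB IHB jk.
  by apply: truthful_or; auto; apply: PiDef_hPi jk _.
- by move=> j n t B pB IH jk; apply: truthful_AllB; auto; apply: PiDef_hPi jk _.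
- by move=> j n t B sB IH jk; apply: truthful_AllB; auto; apply: PiDef_hSigma jk _.
Qed.
End Forcing.

(** * From proofs to flows *)

Lemma sat_step (M : PVmodel) n (H : form n.+1) (t : term n) (rho : 'I_n -> M) :
  sat (All (Imp (Lt x0 (tshift t)) (Imp H (repl H (tS x0))))) rho <->
  forall u, leint (mS u) (eval rho t) -> sat H (tcons u rho) -> sat H (tcons (mS u) rho).
Proof.
have E u : sat (Lt x0 (tshift t)) (tcons u rho) <-> leint (mS u) (eval rho t).
  rewrite -[sat _ _]/(leint _ _ /\ (_ = _ -> False)) eval_tshift; exact: mlt_neqAle.
have R u : sat (repl H (tS x0)) (tcons u rho) = sat H (tcons (mS u) rho).
  by rewrite sat_repl evalE.
split=> h u lt_u Hu; first by rewrite -R; apply: h => //; apply/E.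
by have := h u ((E u).1 lt_u) Hu; rewrite -R.
Qed.

Lemma PV_qf n (A : form n) : PV A -> qf A.
Proof.
case=> {n A} //= A; do 32?[case=> [<-|] //]; by case.
Qed.

Section ForcedTheories.
Variables (k : nat) (b : bool).
Hypothesis k_gt0 : 0 < k.
Notation PiDef := (PiDef k).
Notation Flow := (Flow k b).
Notation frc := (frc k b).
Local Open Scope model_scope.

Lemma frc_PV m (A : form m) : PV A -> forall n (G D : spred n) tau,
  PiDef G -> PiDef D -> frc A G D tau.
Proof.
move=> PVA n G D tau pG pD; have qfA := PV_qf PVA.
apply/(truthful_qf b k_gt0 qfA) => //; apply: tr_hyp => //; first exact: PiDef_qf.
by move=> M rho _; exact: (@pv_models M).
Qed.

(** * Forcing the induction axioms by iterating the flow of the induction step *)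

Section Induction.
Variables (p : nat) (A : form p.+1) (hA : hPi k A).
Variables (n : nat) (G D : spred n) (tau : 'I_p -> term n).
Hypotheses (pG : PiDef G) (pD : PiDef D).

Let pA : PiDef (fun M : PVmodel => @sat M p.+1 A) := PiDef_hPi (leqnn k) hA.
Let tA : truthful k b A := (truthful_bounded b k_gt0).2 _ _ _ hA (leqnn k).

Definition val_at (M : PVmodel) (rho : 'I_n -> M) (d : M) : Prop :=
  sat A (tcons d (fun i => eval rho (tau i))).

(** The iterated invariant is not [A(d)] alone: [G] must survive for use in every later step, and
    [D] is the escape of a step that fails to reach the next instance. *)
Definition invar (M : PVmodel) (rho : 'I_n -> M) (d : M) : Prop :=
  (@G M rho /\ val_at rho d) \/ @D M rho.

Let tl (M : PVmodel) (rho : 'I_n.+1 -> M) : 'I_n -> M := fun i => rho (lift ord0 i).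

Lemma PiDef_val_at (s : term n.+1) :
  PiDef (fun M rho => val_at (tl rho) (eval rho s)).
Proof.
apply: PiDef_ext (PiDef_sat (tcons s (fun i => tshift (tau i))) pA) => M rho.
rewrite eval_tcons /val_at (_ : (fun i => eval rho (tshift (tau i))) =
  (fun i => eval (tl rho) (tau i))) //.
by apply/funext => i; rewrite eval_tshiftE.
Qed.

Lemma PiDef_invar (s : term n.+1) :
  PiDef (fun M rho => invar (tl rho) (eval rho s)).
Proof.
apply: PiDef_or; last exact: PiDef_shift.
by apply: PiDef_and; [exact: PiDef_shift | exact: PiDef_val_at].
Qed.

(* The induction hypothesis is forced at the condition extended by a fresh
   variable [y] satisfying [A(s(y))]. *)
Lemma step_flow (s t : term p.+1) (s' t' : term n.+1) :
  (forall (M : PVmodel) (rho : 'I_n.+1 -> M),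
    eval (tcons (rho ord0) (fun i => eval (tl rho) (tau i))) s = eval rho s') ->
  (forall (M : PVmodel) (rho : 'I_n.+1 -> M),
    eval (tcons (rho ord0) (fun i => eval (tl rho) (tau i))) t = eval rho t') ->
  frc (All (Imp (repl A s) (repl A t))) G D tau ->
  Flow (fun M rho => invar (tl rho) (eval rho s'))
       (fun M rho => invar (tl rho) (eval rho t')).
Proof.
move=> sE tE f.
pose G1 : spred n.+1 := fun M rho => @G M (tl rho) /\ val_at (tl rho) (eval rho s').
pose D1 : spred n.+1 := fun M rho => @D M (tl rho).
have pG1 : PiDef G1 by apply: PiDef_and; [exact: PiDef_shift | exact: PiDef_val_at].
have pD1 : PiDef D1 by exact: PiDef_shift.
have e1 : ext k G D wk G1 D1 by split=> // M rho [].
pose tau1 : 'I_p.+1 -> term n.+1 := tcons x0 (fun i => tshift (tau i)).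
have : frc (repl A s) G1 D1 tau1 -> frc (repl A t) G1 D1 tau1.
  by have := f _ _ _ _ e1 x0 _ _ _ _ (ext_refl pG1 pD1); rewrite subst_id.
rewrite /repl !frc_fsubst.
have env (M : PVmodel) (rho : 'I_n.+1 -> M) r :
    (fun i => eval rho (tsubst tau1 (tcons r wk i))) =
    tcons (eval (tcons (rho ord0) (fun i => eval (tl rho) (tau i))) r)
          (fun i => eval (tl rho) (tau i)).
  apply: tconsP => [|i].
    rewrite -[tcons r wk ord0]/r eval_tsubst; congr eval; rewrite /tau1.
    by rewrite eval_tcons; congr tcons; apply/funext => i; rewrite eval_tshiftE.
  by rewrite tconsS /= /tau1 tconsS eval_tshiftE.
move=> h; have {h} : tr k b A G1 D1 (fun i => tsubst tau1 (tcons t wk i)).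
  apply/(tA _ pG1 pD1); apply: h; apply/(tA _ pG1 pD1); apply: tr_hyp => //.
  by move=> M rho [_]; rewrite env sE.
move=> f1; have {f1} : Flow G1 (fun M rho => @D M (tl rho) \/ val_at (tl rho) (eval rho t')).
  by apply: flow_mono f1 => // M rho; rewrite env tE.
move/(flow_and (PiDef_shift pG))/(flow_or (PiDef_shift pD)).
apply: flow_mono => M rho; rewrite /G1 /invar -/(tl rho); tauto.
Qed.

Lemma flow_invar0 : frc (inst A t0) G D tau ->
  Flow G (fun M rho => invar rho (m0 M)).
Proof.
rewrite /inst frc_fsubst => /(tA _ pG pD) f.
apply: flow_mono (flow_and pG f) => // M rho.
have -> : (fun i => eval rho (tsubst tau (tcons t0 Var i))) =
    tcons (m0 M) (fun i => eval rho (tau i)).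
  apply: tconsP => [|i]; last by rewrite tconsS.
  by rewrite -[tcons t0 Var ord0]/t0 eval_tsubst eval_0.
by rewrite /invar /val_at; tauto.
Qed.

Lemma frc_of_invar (s : term n) :
  Flow G (fun M rho => invar rho (eval rho s)) -> frc A G D (tcons s tau).
Proof.
move=> f; apply/(tA _ pG pD); apply: flow_mono f => // M rho.
by rewrite eval_tcons /invar /val_at; tauto.
Qed.

Lemma PiDef_invar_term (s : term n) : PiDef (fun M rho => invar rho (eval rho s)).
Proof.
apply: PiDef_or => //; apply: PiDef_and => //.
by apply: PiDef_ext (PiDef_sat (tcons s tau) pA) => M rho; rewrite eval_tcons.
Qed.

Lemma frc_ind (s : term n) : b = false ->
  frc (inst A t0) G D tau -> frc (All (Imp A (repl A (tS x0)))) G D tau ->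
  frc A G D (tcons s tau).
Proof.
move=> b0 f0 fS; apply: frc_of_invar.
have {}fS : Flow (fun M rho => invar (tl rho) (eval rho x0))
                 (fun M rho => invar (tl rho) (eval rho (tS x0))).
  apply: (@step_flow x0 (tS x0)) => [//|M rho|]; first by rewrite !evalE.
  by rewrite {1}/repl (_ : tcons x0 wk = Var) ?fsubst_Var //; exact: up_Var.
have tlE (M : PVmodel) (rho : 'I_n -> M) d : tl (tcons d rho) = rho.
  by apply/funext => i; rewrite /tl tconsS.
(* The number of iterations is the arbitrary term [s], admissible as a length only in the
   unrestricted calculus. *)
have sOK : lenOK b s by rewrite b0.
have := @flow_chain k k_gt0 b n s s (fun M rho => invar (tl rho) (eval rho x0))
  (PiDef_invar x0) sOK (fun M rho => mle_refl _).
case=> [|H [t [pH tOK HP]]].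
  apply: flow_mono fS => M rho; first by case.
  by rewrite evalE /= (_ : tl (tcons _ _) = tl rho).
apply: (flow_trans k_gt0 (PiDef_invar_term s) (flow_invar0 f0)).
exists H, t; split=> // M rho; have [] := HP M rho.
by rewrite /= !tlE.
Qed.

(** The chain climbs from 0 to [s] through the initial segments of its binary notation, |s| steps in
    all. Stage i concerns [s] halved |s| - i times. *)
Lemma frc_pind (s : term n) :
  frc (inst A t0) G D tau -> frc (All (Imp (repl A (thalf x0)) A)) G D tau ->
  frc A G D (tcons s tau).
Proof.
move=> f0 fS; apply: frc_of_invar.
have {}fS : Flow (fun M rho => invar (tl rho) (eval rho (thalf x0)))
                 (fun M rho => invar (tl rho) (eval rho x0)).
  apply: (@step_flow (thalf x0) x0) => [M rho|//|]; first by rewrite !evalE.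
  by rewrite {2}/repl (_ : tcons x0 wk = Var) ?fsubst_Var //; exact: up_Var.
have tlE (M : PVmodel) (rho : 'I_n -> M) d : tl (tcons d rho) = rho.
  by apply/funext => i; rewrite /tl tconsS.
pose sh (t : term n) : term n.+2 := tshift (tshift t).
pose v (i : 'I_n) : term n.+2 := Var (lift ord0 (lift ord0 i)).
(* [mu] sends [(z, i)] to the [|z|]-fold half of [s] *)
pose mu : 'I_n.+1 -> term n.+2 := tcons (App Shift (tcons x0 (tcons (sh s) tnil))) v.
pose E (t : term n.+1) : spred n.+2 := fun M rho =>
  invar (tl (fun i => eval rho (mu i))) (eval (fun i => eval rho (mu i)) t).
have pE t : PiDef (E t).
  exact: (@PiDef_subst k _ _ mu (fun M rho => invar (tl rho) (eval rho t)) (PiDef_invar t)).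
have EE (M : PVmodel) (rho : 'I_n -> M) z i t : E t M (tcons z (tcons i rho)) =
    invar rho (eval (tcons (mshift z (eval rho s)) rho) t).
  have envE : (fun j => eval (tcons z (tcons i rho)) (mu j)) =
      tcons (mshift z (eval rho s)) rho.
    apply: tconsP => [|j]; last by rewrite /mu tconsS /= !tconsS.
    rewrite /mu -[tcons _ v ord0]/(App Shift (tcons x0 (tcons (sh s) tnil))) /=.
    by rewrite !eval_tcons eval_tnil /sh !evalE.
  by rewrite /E envE tlE.
pose C : form n.+2 := Eq (tadd (len x0) (Var (lift ord0 ord0))) (len (sh s)).
pose C' : form n.+2 := Eq (tadd (len x0) (tS (Var (lift ord0 ord0)))) (len (sh s)).
have CE (M : PVmodel) (rho : 'I_n -> M) z i : sat C (tcons z (tcons i rho)) =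
    (mlen z + i = mlen (eval rho s)).
  by rewrite /C -[sat _ _]/(_ = _) /sh !evalE /= tconsS.
have C'E (M : PVmodel) (rho : 'I_n -> M) z i : sat C' (tcons z (tcons i rho)) =
    (mlen z + mS i = mlen (eval rho s)).
  by rewrite /C' -[sat _ _]/(_ = _) /sh !evalE /= tconsS.
(* Stage i: the invariant at [mshift z s] for every z with |z| + i = |s|. Quantifying over z is
   needed because halving iterates along the notation of z while the chain counts with a number.
   Every such z is at most 2s. *)
pose Dc : spred n.+1 := fun M rho => forall z, z <= eval rho (tshift (tadd s s)) ->
  sat C (tcons z rho) -> E x0 M (tcons z rho).
have DcE (M : PVmodel) (rho : 'I_n -> M) i : Dc M (tcons i rho) <->
    forall z, z <= eval rho s + eval rho s -> mlen z + i = mlen (eval rho s) ->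
      invar rho (mshift z (eval rho s)).
  split=> h z; have := h z; rewrite eval_tshift evalE CE EE //.
have pDc : PiDef Dc.
  apply: (@PiDef_all k k_gt0 _ _ (fun M rho => sat C rho -> E x0 M rho)).
  exact: PiDef_imp.
have fE : Flow (fun M rho => rho ord0 < eval rho (tshift (len s)) /\ Dc M rho)
    (fun M rho => Dc M (tcons (mS (rho ord0)) (fun i => rho (lift ord0 i)))).
  have pQ : PiDef (fun M rho => sat C' rho -> E x0 M rho) by exact: PiDef_imp.
  have pnC : PiDef (fun M : PVmodel => @sat M _ (Imp C' Bot)) by exact: PiDef_qf.
  have fall : Flow (fun M rho => Dc M rho) (fun M rho =>
      forall d, d <= eval rho (tshift (tadd s s)) ->
        (fun M rho => sat C' rho -> E x0 M rho) M (tcons d rho)).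
    apply: (@flow_all k k_gt0 b _ _ Dc (fun M rho => sat C' rho -> E x0 M rho)) => //.
    have fmu : Flow (E (thalf x0)) (E x0) := flow_subst mu fS.
    apply: flow_mono (flow_or pnC fmu) => M rho; last first.
      by move=> [Er _ //|nC /nC].
    have [z [i [nu ->]]] : exists z i nu, rho = tcons z (tcons i nu).
      exists (rho ord0), (rho (lift ord0 ord0)), (fun j => rho (lift ord0 (lift ord0 j))).
      by apply: tconsP => //; elim/ordS_ind => // j; rewrite tconsS.
    rewrite (_ : (fun j => tcons z (tcons i nu) (lift ord0 j)) = tcons i nu); last first.
      by apply/funext => j; rewrite tconsS.
    move=> [_ /DcE h]; have [c|c] := pselect (mlen z + mS i = mlen (eval nu s)); last first.
      by right=> hC; apply: c; rewrite -C'E.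
    (* To reach stage i + 1 at z, stage i is used at 2z + 1, which is one bit longer and halves once
       more. *)
    left; rewrite EE evalE -[eval _ x0]/(mshift z (eval nu s)) -mshift_odd; apply: h.
      apply: mlen_leD; rewrite mlen_doubleS -c maddS; apply/mleSS; exact: mle_addr.
    by rewrite mlen_doubleS maddSl -maddS.
  apply: flow_mono fall => M rho; first by case.
  rewrite -(tconsK rho); move: (rho ord0) (fun i => rho _) => i nu h.
  rewrite (_ : (fun j => tcons i nu (lift ord0 j)) = nu); last first.
    by apply/funext => j; rewrite tconsS.
  apply/DcE => z zs c; have := h z; rewrite eval_tshift evalE C'E EE.
  exact.
(* The chain has |s| links, but the length of a compound term is not a polynomial in the lengths of
   the variables; [q] bounds it. *)
have [q pq qP] := term_bound s (@poly_bounded_id n).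
have := @flow_chain k k_gt0 b n (len s) q Dc pDc (fun _ => pq).
case=> [M rho|//|H [t [pH tOK HP]]]; first by rewrite evalE; exact: qP.
have f1 : Flow G (fun M rho => Dc M (tcons (m0 M) rho)).
  apply: flow_mono (flow_invar0 f0) => // M rho inv0; apply/DcE => z _.
  rewrite madd0 => zs; suff -> : mshift z (eval rho s) = m0 M by [].
  case: (mlen_mshift z (eval rho s)) => // ls; apply: mlen_eq0.
  by apply: (@maddI _ (mlen z)); rewrite madd0 maddC ls.
apply: (flow_trans k_gt0 (PiDef_invar_term s) f1).
exists H, t; split=> // M rho; have [H0 HS Ht] := HP M rho; split=> // u tu.
move=> /(Ht u tu) /DcE; rewrite evalE => /(_ (m0 M) (mle0 _)).
by rewrite mlen0 madd0l mshift0; apply.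
Qed.
End Induction.

Lemma frc_T2 m (A : form m) : b = false -> T2 k A -> forall n (G D : spred n) tau,
  PiDef G -> PiDef D -> frc A G D tau.
Proof.
move=> b0; case=> {m A} [m A PVA|m A hA] n G D tau pG pD; first exact: frc_PV.
move=> n1 sg1 G1 D1 e1 [f0 fS] n2 sg2 G2 D2 e2 s; have [pG2 pD2 _ _] := e2.
apply: (frc_ind hA pG2 pD2 s b0).
  exact: (frc_mono (A := inst A t0) e2 f0).
exact: (frc_mono (A := All (Imp A (repl A (tS x0)))) e2 fS).
Qed.

Lemma frc_S2 m (A : form m) : S2 k A -> forall n (G D : spred n) tau,
  PiDef G -> PiDef D -> frc A G D tau.
Proof.
case=> {m A} [m A PVA|m A hA] n G D tau pG pD; first exact: frc_PV.
move=> n1 sg1 G1 D1 e1 [f0 fS] n2 sg2 G2 D2 e2 s; have [pG2 pD2 _ _] := e2.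
apply: (frc_pind hA pG2 pD2 s).
  exact: (frc_mono (A := inst A t0) e2 f0).
exact: (frc_mono (A := All (Imp (repl A (thalf x0)) A)) e2 fS).
Qed.

(** The interpretation is evaluated at the condition (A, B): [A] is forced there, hence so is [B],
    which means a flow from [A] to [B] or [B]. *)
Lemma flow_of_proof (T : theory) n (A B : form n) : hPi k A -> hPi k B ->
  (forall m (C : form m), T m C -> forall n' (G D : spred n') tau,
     PiDef G -> PiDef D -> frc C G D tau) ->
  proves T (Imp A B) ->
  Flow (fun M : PVmodel => @sat M n A) (fun M : PVmodel => @sat M n B).
Proof.
move=> hA hB FT prAB.
have pA := PiDef_hPi (leqnn k) hA; have pB := PiDef_hPi (leqnn k) hB.
have tA := (truthful_bounded b k_gt0).2 _ _ _ hA (leqnn k).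
have tB := (truthful_bounded b k_gt0).2 _ _ _ hB (leqnn k).
have fAB := frc_sound k_gt0 FT prAB (tau := Var) pA pB (fun C => False_ind _).
have := fAB _ _ _ _ (ext_refl pA pB); rewrite subst_id => {}fAB.
have /(tB _ _ _ _ pA pB) : frc B (fun M : PVmodel => @sat M n A)
    (fun M : PVmodel => @sat M n B) Var.
  by apply: fAB; apply/(tA _ _ _ _ pA pB); exact: tr_hyp.
by apply: flow_mono => // M rho [].
Qed.

(** The required equivalences at the ends are enforced by overwriting the running formula: it is [A]
    at time 0 and [B] at time t + 1, with [H] in between. *)
Lemma kflow_of_flow n (A B : form n) : hPi k A -> hPi k B ->
  Flow (fun M : PVmodel => @sat M n A) (fun M : PVmodel => @sat M n B) ->
  exists (H : form n.+1) (t : term n), lenOK b t /\ kflow k A B H t.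
Proof.
move=> hA hB [H [t [pH tOK HP]]].
have pA := PiDef_hPi (leqnn k) hA; have pB := PiDef_hPi (leqnn k) hB.
pose u0 : form n.+1 := Eq x0 t0.
pose uT : form n.+1 := Eq x0 (tS (tshift t)).
pose mid : form n.+1 := And (Imp u0 Bot) (Imp uT Bot).
pose late : form n.+1 := Le (tS (tshift t)) x0.
pose H' : spred n.+1 := fun M rho =>
  (sat u0 rho -> sat A (fun i => rho (lift ord0 i))) /\
  ((sat mid rho -> H M rho) /\ (sat late rho -> sat B (fun i => rho (lift ord0 i)))).
have [F hF FE] : PiDef H'.
  apply: PiDef_and.
    by apply: PiDef_imp => //; exact: (PiDef_shift pA).
  apply: PiDef_and; first exact: PiDef_imp.
  by apply: PiDef_imp => //; exact: (PiDef_shift pB).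
have wkE (M : PVmodel) (rho : 'I_n -> M) u : (fun i => tcons u rho (lift ord0 i)) = rho.
  by apply/funext => i; rewrite tconsS.
have H'E (M : PVmodel) (rho : 'I_n -> M) u : sat F (tcons u rho) <->
    [/\ u = m0 M -> sat A rho,
        u <> m0 M -> u <> mS (eval rho t) -> H M (tcons u rho) &
        eval rho t < u -> sat B rho].
  rewrite -FE /H' wkE.
  have -> : sat u0 (tcons u rho) = (u = m0 M) by rewrite /u0 -[sat _ _]/(_ = _) evalE.
  have -> : sat late (tcons u rho) = (eval rho t < u).
    by rewrite /late -[sat _ _]/(_ <= _) !evalE.
  have -> : sat mid (tcons u rho) = (u <> m0 M /\ u <> mS (eval rho t)).
    by rewrite /mid -[sat _ _]/((_ = _ -> False) /\ (_ = _ -> False)) !evalE.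
  by split=> [[h1 [h2 h3]]|[h1 h2 h3]]; split; tauto.
(* Length t + 1 keeps the two overwritten ends apart even when [t] is 0. *)
exists F, (tS t); split; first by move=> /tOK; exact: len_polyS.
split=> //; apply: pv_complete => M rho; have [H0 HS Ht] := HP M rho.
- rewrite /= sat_inst evalE H'E; split=> [[/(_ erefl)] //|Ar]; split=> //.
  by move=> /mle_0 /mS_neq0.
- rewrite /= sat_inst evalE H'E; split=> [[_ _] |Br]; first by apply; exact: mle_refl.
  by split=> // /mS_neq0.
apply/sat_step => u; rewrite evalE => /mleSS ut /H'E [h1 h2 h3]; apply/H'E.
have Hu1 : H M (tcons (mS u) rho).
  apply: HS; have [u_0|u_neq0] := pselect (u = m0 M); first by rewrite u_0; apply/H0/h1.
  by apply: h2 => // uE; apply: (@mltn _ (eval rho t)); rewrite -uE.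
split=> // [/mS_neq0 //|tu]; apply: (Ht (mS u)) => //.
by apply: mltW.
Qed.
End ForcedTheories.

(** * From flows to proofs *)

Section FlowProof.
Variables (k n : nat) (A B : form n) (H : form n.+1) (t : term n).
Hypothesis flowH : kflow k A B H t.

Lemma kflow_sat (M : PVmodel) (rho : 'I_n -> M) :
  [/\ sat A rho -> sat H (tcons (m0 M) rho),
      (forall u, leint (mS u) (eval rho t) ->
         sat H (tcons u rho) -> sat H (tcons (mS u) rho)) &
      sat H (tcons (eval rho t) rho) -> sat B rho].
Proof.
case: flowH => _ /pv_sound/(_ M rho) H0 /pv_sound/(_ M rho) Ht /pv_sound/(_ M rho) HS.
split.
- by move: H0; rewrite /= sat_inst evalE => -[].
- exact/sat_step.
- by move: Ht; rewrite /= sat_inst => -[].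
Qed.

(** Ordinary induction on u, applied in a model to u <= t -> H(u); the implication is written as a
    disjunction to stay in [hPi k]. *)
Lemma T2_of_kflow : proves (T2 k) (Imp A B).
Proof.
apply: completeness => M0 MT rho0.
have MPV : models M0 PV by move=> m C PVC; apply: MT; exact: T2_PV.
pose M := Build_PVmodel MPV; pose rho : 'I_n -> M := rho0.
have [H0 HS Ht] := kflow_sat rho.
have [K hK KE] : exists2 K, hPi k K & forall u : M,
    sat K (tcons u rho) <-> (leint u (eval rho t) -> sat H (tcons u rho)).
  exists (Or (Imp (Le x0 (tshift t)) Bot) H) => [|u].
    by apply: hPi_or; [exact: hPi_qf_any | case: flowH].
  rewrite -[sat _ _]/((leint _ _ -> False) \/ sat H _) eval_tshift.
  by have := EM (leint (tcons u rho ord0) (eval rho t)); rewrite -[tcons u rho ord0]/u; tauto.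
move=> Ar; apply: Ht.
have /= := MT _ _ (T2_induct hK) rho; rewrite sat_inst (@eval_0 M).
move=> ind; suff all_K u : sat K (tcons u rho).
  by apply/(KE (eval rho t)).1; [exact: all_K | exact: mle_refl].
apply: ind; split=> [|v]; first by apply/KE => _; exact: H0.
rewrite sat_repl (@eval_S M) => /KE Kv; apply/KE => lt_v.
by apply: HS => //; apply: Kv; exact: mltW.
Qed.

(** Induction on notation moves |u| by one, so it runs the flow at time |u|. Since [Z] only
    guarantees |Z| >= t, the formula also records that [B] holds once |u| has reached t. *)
Lemma S2_of_kflow : hPi k B -> len_poly t -> proves (S2 k) (Imp A B).
Proof.
move=> hB pt; apply: completeness => M0 MT rho0.
have MPV : models M0 PV by move=> m C PVC; apply: MT; exact: S2_PV.
pose M := Build_PVmodel MPV; pose rho : 'I_n -> M := rho0.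
have [H0 HS Ht] := kflow_sat rho.
have [Z ZP] := len_poly_code pt.
pose le_t : form n.+1 := Le (len x0) (tshift t).
pose ge_t : form n.+1 := Le (tshift t) (len x0).
have [K hK KE] : exists2 K, hPi k K & forall u : M, sat K (tcons u rho) <->
    (leint (mlen u) (eval rho t) -> sat H (tcons (mlen u) rho)) /\
    (leint (eval rho t) (mlen u) -> sat B rho).
  exists (And (Or (Imp le_t Bot) (repl H (len x0))) (Or (Imp ge_t Bot) (fshift B)))
    => [|u].
    apply: hPi_and; apply: hPi_or; try exact: hPi_qf_any.
      by apply: hSigma_hPi_fsubst.2; case: flowH.
    exact: hSigma_hPi_fsubst.2.
  rewrite -[sat _ _]/(((sat le_t _ -> False) \/ sat _ _) /\
    ((sat ge_t _ -> False) \/ sat _ _)) sat_repl sat_fshift (@eval_len M).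
  have -> : sat le_t (tcons u rho) = leint (mlen u) (eval rho t).
    by rewrite /le_t -[sat _ _]/(leint _ _) (@eval_len M) eval_tshift.
  have -> : sat ge_t (tcons u rho) = leint (eval rho t) (mlen u).
    by rewrite /ge_t -[sat _ _]/(leint _ _) (@eval_len M) eval_tshift.
  rewrite -[eval _ x0]/u.
  have := EM (leint (mlen u) (eval rho t)).
  by have := EM (leint (eval rho t) (mlen u)); tauto.
move=> Ar; have /= := MT _ _ (S2_pinduct hK) rho; rewrite sat_inst (@eval_0 M).
move=> ind; suff all_K u : sat K (tcons u rho).
  by case/KE: (all_K (eval rho Z)) => _; apply; exact: ZP.
have K0 : sat K (tcons (m0 M) rho).
  apply/KE; rewrite mlen0; split=> [_|/mle_0 t0]; first exact: H0.
  by apply: Ht; rewrite t0; exact: H0.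
apply: ind; split=> [//|v].
rewrite sat_repl (@eval_half M) -[eval _ x0]/v.
(* Halving 0 does not shorten it, so this value is settled by the base case. *)
have [->|v0] := pselect (v = m0 M); first by [].
move=> /KE; have := @mlen_half M v v0; move: (@mlen M (@mhalf M v)) => l lE [h1 h2].
have Hl : leint (@mlen M v) (eval rho t) -> sat H (tcons (@mlen M v) rho).
  by rewrite lE => lt; apply: HS => //; apply: h1; exact: mltW.
(* Either t was reached already at the half of v, or |v| = t exactly and the end of the flow gives
   [B]. *)
apply/KE; split=> // tv; have [|vt] := mleP (eval rho t) l; first exact: h2.
have e : @mlen M v = eval rho t by apply: mle_anti => //; rewrite lE.
by apply: Ht; rewrite -e; apply: Hl; rewrite e; exact: mle_refl.
Qed.

End FlowProof.

Lemma hPi_bigAnd k n (G : seq (form n)) :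
  (forall A, List.In A G -> hPi k A) -> hPi k (bigAnd G).
Proof.
elim: G => [|A G IH] hG; first exact: hPi_qf_any.
by apply: hPi_and; [apply: hG; left | apply: IH => B GB; apply: hG; right].
Qed.

Lemma hPi_bigOr k n (G : seq (form n)) :
  (forall A, List.In A G -> hPi k A) -> hPi k (bigOr G).
Proof.
elim: G => [|A G IH] hG; first exact: hPi_qf_any.
by apply: hPi_or; [apply: hG; left | apply: IH => B GB; apply: hG; right].
Qed.

Theorem theorem5p10 (k n : nat) (Gamma Delta : seq (form n))
    (hk : 1 <= k)
    (hGamma : forall A : form n, List.In A Gamma -> hPi k A)
    (hDelta : forall A : form n, List.In A Delta -> hPi k A) :
  (proves (S2 k) (Imp (bigAnd Gamma) (bigOr Delta)) <-> pflows k Gamma Delta) /\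
  (proves (T2 k) (Imp (bigAnd Gamma) (bigOr Delta)) <-> flows k Gamma Delta).
Proof.
have hG := hPi_bigAnd hGamma; have hD := hPi_bigOr hDelta.
split; split.
- move/(flow_of_proof hk hG hD (frc_S2 true hk))/(kflow_of_flow hG hD).
  by move=> [H [t [/(_ isT) pt fH]]]; exists H, t.
- by move=> [H [t [pt fH]]]; exact: S2_of_kflow fH hD pt.
- move/(flow_of_proof hk hG hD (fun m C => frc_T2 hk erefl))/(kflow_of_flow hG hD).
  by move=> [H [t [_ fH]]]; exists H, t.
- by move=> [H [t fH]]; exact: T2_of_kflow fH.
Qed.
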